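(* Let $n\ge 2$, let $P\subset\mathbb{R}^n$ be an $n$-dimensional polytope, and let $P_N=[X_1,\dots,X_N]$ be the convex hull of $N$ independent random points distributed uniformly on the boundary $\partial P$. Then, as $N\to\infty$, the expected number of vertices of $P_N$ satisfies $$\mathbb{E} f_0(P_N)=c_{n-1,0}\,\operatorname{flag}(P)\,(\ln N)^{n-2}(1+o(1)),$$ where $c_{n-1,0}$ is the constant (independent of $P$) defined in the context.
   Context: $f_\ell(Q)$ is the number of $\ell$-dimensional faces of a polytope $Q$. A flag of an $n$-dimensional polytope $P$ is a sequence $F_0\subset F_1\subset\dots\subset F_{n-1}$ of faces of $P$ with $\dim F_i=i$; $\operatorname{flag}(P)$ is the number of flags of $P$. Uniformly distributed on $\partial P$ means with respect to normalized $(n-1)$-dimensional Hausdorff measure on $\partial P$. Definition of $c_{d,\ell}$: by known results (Bárány–Buchta, Reitzner), for every $d\geq 1$ and $\ell\in\{0,\dots,d-1\}$ there is a constant $c_{d,\ell}$, depending only on $d$ and $\ell$, such that for every $d$-dimensional polytope $Q\subset\mathbb{R}^d$ the convex hull $Q_N$ of $N$ independent points distributed uniformly in $Q$ (i.e. with respect to normalized $d$-dimensional Lebesgue measure on $Q$) satisfies $\mathbb{E} f_\ell(Q_N)=c_{d,\ell}\operatorname{flag}(Q)(\ln N)^{d-1}(1+o(1))$ as $N\to\infty$. This known fact may be taken as given. *)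

(* Defs.v *)
From HB Require Import structures.
From mathcomp Require Import all_boot all_order all_algebra.
From mathcomp Require Import finmap.
From mathcomp Require Import all_classical all_reals all_analysis.

Set Implicit Arguments.
Unset Strict Implicit.
Unset Printing Implicit Defensive.

Import Order.TTheory GRing.Theory Num.Theory.
Import numFieldNormedType.Exports.

Local Open Scope classical_set_scope.
Local Open Scope ring_scope.

Section Polytopes.
Context {R : realType} {n : nat}.
Local Notation V := 'rV[R]_n.

Definition dotp (u x : V) : R := \sum_(i < n) u 0 i * x 0 i.

(* The library norm on ['rV[R]_n] is the sup norm. *)
Definition enorm (x : V) : R := Num.sqrt (\sum_(i < n) x 0 i ^+ 2).

Definition hull m (v : 'I_m -> V) : set V :=
  [set y | exists a : 'I_m -> R,
     [/\ forall i, 0 <= a i, \sum_(i < m) a i = 1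
       & y = \sum_(i < m) a i *: v i]].

Definition aff_hull (A : set V) : set V :=
  [set y | exists m (x : 'I_m -> V) (a : 'I_m -> R),
     [/\ forall i, A (x i), \sum_(i < m) a i = 1
       & y = \sum_(i < m) a i *: x i]].

(* False for every [k] when [A] is empty. *)
Definition has_dim (A : set V) (k : nat) : Prop :=
  exists (x0 : V) (W : {vspace V}),
    \dim W = k /\ aff_hull A = [set x | x - x0 \in W].

Definition polytope (Q : set V) : Prop :=
  exists m (v : 'I_m -> V), Q = hull v.

(* [u = 0] is allowed, so [Q] itself and the empty set are faces. *)
Definition face (Q F : set V) : Prop :=
  exists (u : V) (b : R),
    (forall x, Q x -> dotp u x <= b) /\ F = Q `&` [set x | dotp u x = b].

(* A polytope has finitely many faces, so the junk value of [fset_set] on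
   infinite sets is irrelevant here and in [flag]. *)
Definition nb_faces (l : nat) (Q : set V) : nat :=
  #|` fset_set [set F : set V | face Q F /\ has_dim F l]|%fset.

Definition is_flag (Q : set V) (F : {ffun 'I_n -> set V}) : Prop :=
  (forall i : 'I_n, face Q (F i) /\ has_dim (F i) i) /\
  (forall i j : 'I_n, (i < j)%N -> F i `<=` F j).

(* Meant for [n]-dimensional [Q] only: flags have length [n]. *)
Definition flag (Q : set V) : nat :=
  #|` fset_set [set F : {ffun 'I_n -> set V} | is_flag Q F]|%fset.

Definition boundary (A : set V) : set V := closure A `\` interior A.

End Polytopes.

Section Measures.
Context {R : realType} {n : nat}.
Local Notation V := 'rV[R]_n.
Local Open Scope ereal_scope.

Definition box (a b : V) : set V :=
  [set x | forall i, (a 0 i <= x 0 i <= b 0 i)%R].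

(* Outer Lebesgue measure; it is Lebesgue measure on Borel sets. *)
Definition lebesgue_rV (A : set V) : \bar R :=
  ereal_inf [set s | exists a b : nat -> V,
    [/\ forall k i, (a k 0 i <= b k 0 i)%R,
        A `<=` \bigcup_k box (a k) (b k)
      & s = \sum_(0 <= k <oo) (\prod_(i < n) (b k 0 i - a k 0 i)%R)%:E]].

(* The [0] makes the diameter of the empty set equal to [0]. *)
Definition diam (A : set V) : \bar R :=
  ereal_sup ([set 0%:E] `|` [set r | exists x y, [/\ A x, A y & r = (enorm (x - y))%:E]]).

Definition hausdorff_pre (s : nat) (delta : R) (A : set V) : \bar R :=
  ereal_inf [set t | exists U : nat -> set V,
    [/\ forall k, diam (U k) <= delta%:E,
        A `<=` \bigcup_k U k
      & t = \sum_(0 <= k <oo) (diam (U k)) ^+ s]].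

(* [s]-dimensional Hausdorff (outer) measure for [s >= 1], without the usual
   dimensional constant, which cancels in [uniform_on]. For [s = 0] the
   convention [0 ^+ 0 = 1] would make this degenerate. *)
Definition hausdorff (s : nat) (A : set V) : \bar R :=
  ereal_sup [set hausdorff_pre s delta A | delta in [set d : R | (0 < d)%R]].

End Measures.

Definition borel_rV (R : realType) (n : nat) :=
  g_sigma_algebraType (@open 'rV[R]_n).

Section RandomPoints.
Context {R : realType} {n : nat}.
Local Open Scope ereal_scope.

(* The law of [X] is the normalized restriction of [mu] to [D]. *)
Definition uniform_on (mu : set 'rV[R]_n -> \bar R) (D : set 'rV[R]_n)
    d (T : measurableType d) (Pr : probability T R)
    (X : {RV Pr >-> borel_rV R n}) : Prop :=
  forall B : set (borel_rV R n), measurable B ->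
    Pr (X @^-1` B) = mu (B `&` D) / mu D.

(* Taking [B i = setT] for some [i] gives the product rule for subfamilies. *)
Definition independent_points N d (T : measurableType d)
    (Pr : probability T R) (X : 'I_N -> {RV Pr >-> borel_rV R n}) : Prop :=
  forall B : 'I_N -> set (borel_rV R n), (forall i, measurable (B i)) ->
    Pr (\bigcap_(i in [set: 'I_N]) (X i @^-1` B i))
    = \prod_(i < N) Pr (X i @^-1` B i).

(* E f_l([X_1, ..., X_N]) = K (ln N)^p (1 + o(1)) for independent points [X_i]
   uniform on [D] with respect to [mu]. The expectation depends only on the
   law of the points, so the error term [eps] is chosen before the probability
   space carrying them. *)
Definition expected_faces_asymp (mu : set 'rV[R]_n -> \bar R)
    (D : set 'rV[R]_n) (l : nat) (K : R) (p : nat) : Prop :=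
  exists eps : nat -> R,
    eps @ \oo --> (0 : R)%R /\
    \forall N \near \oo,
      forall d (T : measurableType d) (Pr : probability T R)
        (X : 'I_N -> {RV Pr >-> borel_rV R n}),
        (forall i, uniform_on mu D (X i)) -> independent_points X ->
        'E_Pr[fun w => (nb_faces l (hull (fun i => X i w : 'rV[R]_n)))%:R]
        = (K * ln N%:R ^+ p * (1 + eps N))%:E.

End RandomPoints.

(* The property defining the constants c_{d,l}; it determines [c d l] for
   [l < d], since the flag number of a polytope is positive. *)
Definition face_constants (R : realType) (c : nat -> nat -> R) : Prop :=
  forall d l, (1 <= d)%N -> (l < d)%N ->
  forall Q : set 'rV[R]_d, polytope Q -> has_dim Q d ->
    expected_faces_asymp lebesgue_rV Q l (c d l * (flag Q)%:R) (d - 1).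

(* Main.v *)
Require Import Defs.
From HB Require Import structures.
From mathcomp Require Import all_boot all_order all_algebra.
From mathcomp Require Import finmap.
From mathcomp Require Import all_classical all_reals all_analysis.
From mathcomp Require Import measurable_realfun.
From mathcomp Require Import ring lra.

(** A vertex of [P_N] lying on a facet [F] of [P] is the same thing as
    a vertex of the convex hull of those [X_i] that lie on [F], and almost surely
    every [X_i] lies on exactly one facet. So [f_0(P_N)] is the sum over the facets
    of the numbers of vertices of these hulls. Given the set [S] of the indices
    [i] with [X_i] on [F], the points on [F] are independent and uniform on [F],
    an [(n-1)]-dimensional polytope, and the known asymptotics applies to them
    with [|S|] points. As [|S|] is binomial with a positive success probability
    [p], [|S| >= N/M] outside an event of exponentially small probability, so that
    [ln |S|] may be replaced by [ln N] in the expectation. Finally the flag numbers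
    of the facets add up to that of [P]. *)

Set Implicit Arguments.
Unset Strict Implicit.
Unset Printing Implicit Defensive.

Import Order.TTheory GRing.Theory Num.Theory.
Import numFieldNormedType.Exports.

Local Open Scope classical_set_scope.
Local Open Scope ring_scope.

(** * Linear functionals, affine hulls and charts *)

(** No area formula is used. Pulled back along an affine chart of a facet, Hausdorff measure scales
    alike on all cubes, which makes it a multiple of Lebesgue measure, and the unknown factor
    cancels in the uniform law. Positivity and finiteness of the measure of the boundary are not
    computed either: they follow from the existence of one uniform point, and without such points
    the claim is vacuous. Conditioning on the index set needs no conditional expectation. The same
    sample space is given the normalised restriction of its probability to the event in question,
    and the known asymptotics, which quantifies over all probability spaces, applies there. The
    final obstacle is the form of the claim: one sequence [eps] must serve all probability spaces,
    and the error is relative. Hence every threshold on [N] is independent of the space, the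
    expectation is shown to depend on [N] only, and a vanishing constant is treated apart, since an
    absolute error cannot then be made relative. *)

Section Dot.
Context {R : realType}.

Lemma dotpC n (u x : 'rV[R]_n) : dotp u x = dotp x u.
Proof. by apply: eq_bigr => i _; rewrite mulrC. Qed.

Lemma dotpDr n (u x y : 'rV[R]_n) : dotp u (x + y) = dotp u x + dotp u y.
Proof. by rewrite -big_split; apply: eq_bigr => i _; rewrite mxE mulrDr. Qed.

Lemma dotpZr n (u x : 'rV[R]_n) a : dotp u (a *: x) = a * dotp u x.
Proof. by rewrite big_distrr; apply: eq_bigr => i _; rewrite mxE /= mulrCA. Qed.

Lemma dotpDl n (u v x : 'rV[R]_n) : dotp (u + v) x = dotp u x + dotp v x.
Proof. by rewrite dotpC dotpDr !(dotpC x). Qed.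

Lemma dotpZl n (u x : 'rV[R]_n) a : dotp (a *: u) x = a * dotp u x.
Proof. by rewrite dotpC dotpZr dotpC. Qed.

Lemma dotpBr n (u x y : 'rV[R]_n) : dotp u (x - y) = dotp u x - dotp u y.
Proof. by rewrite -scaleN1r dotpDr dotpZr mulN1r. Qed.

Lemma dotpBl n (u v x : 'rV[R]_n) : dotp (u - v) x = dotp u x - dotp v x.
Proof. by rewrite -scaleN1r dotpDl dotpZl mulN1r. Qed.

Lemma dotp0l n (x : 'rV[R]_n) : dotp 0 x = 0.
Proof. by rewrite -(scale0r 0) dotpZl mul0r. Qed.

Lemma dotp0r n (x : 'rV[R]_n) : dotp x 0 = 0.
Proof. by rewrite dotpC dotp0l. Qed.

Lemma dotp_sumr n (u : 'rV[R]_n) m (a : 'I_m -> R) (x : 'I_m -> 'rV[R]_n) :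
  dotp u (\sum_i a i *: x i) = \sum_i a i * dotp u (x i).
Proof.
elim/big_ind2 : _ => [|y s z t <- <-|i _]; rewrite ?dotp0r ?dotpDr//.
by rewrite dotpZr.
Qed.

Lemma dotpp_ge0 n (u : 'rV[R]_n) : 0 <= dotp u u.
Proof. by apply: sumr_ge0 => i _; rewrite -expr2 sqr_ge0. Qed.

Lemma dotpp_eq0 n (u : 'rV[R]_n) : dotp u u = 0 -> u = 0.
Proof.
move/eqP; rewrite psumr_eq0 => [/allP h|i _]; last by rewrite -expr2 sqr_ge0.
apply/rowP => i; rewrite mxE.
by have := h i (mem_index_enum _); rewrite -expr2 sqrf_eq0 => /eqP.
Qed.

Lemma dotpp_gt0 n (u : 'rV[R]_n) : u != 0 -> 0 < dotp u u.
Proof.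
by move=> u0; rewrite lt_def dotpp_ge0 andbT; apply: contra_neq u0; exact: dotpp_eq0.
Qed.

Lemma dotp_mulmx n k (u : 'rV[R]_n) (a : 'rV[R]_k) (W : 'M[R]_(k, n)) :
  dotp u (a *m W) = dotp (u *m W^T) a.
Proof.
rewrite /dotp; under eq_bigr do rewrite mxE big_distrr/=.
rewrite exchange_big; apply: eq_bigr => i _; rewrite mxE big_distrl/=.
by apply: eq_bigr => j _; rewrite mxE mulrCA mulrC.
Qed.

Lemma dotp_row_mx n k (u x : 'rV[R]_n) (v y : 'rV[R]_k) :
  dotp (row_mx u v) (row_mx x y) = dotp u x + dotp v y.
Proof.
rewrite /dotp big_split_ord/=; congr (_ + _); apply: eq_bigr => i _.
  by rewrite !row_mxEl.
by rewrite !row_mxEr.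
Qed.

(* Bartl's proof: induction on the number of generators, projecting along the
   last generator when the inductive certificate is wrong for it. *)
Lemma farkas k m (v : 'I_m -> 'rV[R]_k) (y : 'rV[R]_k) :
  (exists a : 'I_m -> R, (forall i, 0 <= a i) /\ y = \sum_i a i *: v i) \/
  (exists u, (forall i, dotp u (v i) <= 0) /\ 0 < dotp u y).
Proof.
elim: m => [|m IH] in v y *.
  have [->|y0] := eqVneq y 0.
    by left; exists (fun=> 0); split=> //; rewrite big_ord0.
  by right; exists y; split=> [[]//|]; exact: dotpp_gt0.
have [[a [a0 ->]]|[u [uv uy]]] := IH (v \o lift ord0) y.
  left; exists (fun i => oapp a 0 (unlift ord0 i)); split=> [i|].
    by case: unliftP => [j|] _ //=.
  rewrite big_ord_recl unlift_none scale0r add0r.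
  by apply: eq_bigr => i _; rewrite liftK.
have [uv0|uv0] := leP (dotp u (v ord0)) 0.
  right; exists u; split=> // i; case: (unliftP ord0 i) => [j|] -> //.
  exact: uv.
set s := dotp u (v ord0) in uv0.
pose w z := z - (dotp u z / s) *: v ord0.
have [[a [a0]]|[u' [uv' uy']]] := IH (w \o v \o lift ord0) (w y).
  rewrite /w /= => wy; left.
  pose b := dotp u y / s - \sum_i a i * (dotp u (v (lift ord0 i)) / s).
  exists (fun i => oapp a b (unlift ord0 i)); split=> [i|].
    case: unliftP => [j|] _ //=; rewrite /b.
    rewrite addr_ge0 ?divr_ge0 ?(ltW uy) ?(ltW uv0)// oppr_ge0.
    apply: sumr_le0 => j _; rewrite mulr_ge0_le0//.
    by rewrite mulr_le0_ge0 ?uv ?invr_ge0 ?ltW.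
  rewrite big_ord_recl unlift_none /=.
  under eq_bigr do rewrite liftK /=.
  have -> : y = (dotp u y / s) *: v ord0 + (y - (dotp u y / s) *: v ord0).
    by rewrite addrC subrK.
  rewrite wy; under eq_bigr do rewrite scalerBr scalerA.
  by rewrite sumrB -scaler_suml /b scalerBl addrA addrAC.
right; exists (u' - (dotp u' (v ord0) / s) *: u); split=> [i|].
  rewrite dotpBl dotpZl; case: (unliftP ord0 i) => [j|] ->.
    have := uv' j; rewrite /= /w dotpBr dotpZr.
    move/(le_trans _); apply; rewrite le_eqVlt; apply/orP; left; apply/eqP.
    by field; rewrite gt_eqF.
  by rewrite -/s divfK ?gt_eqF// subrr.
move: uy'; rewrite /w dotpBr dotpZr dotpBl dotpZl.
move/lt_le_trans; apply; rewrite le_eqVlt; apply/orP; left; apply/eqP.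
by field; rewrite gt_eqF.
Qed.
End Dot.

(** * Convex hulls, affine hulls and dimension *)

Section Affine.
Context {R : realType}.

Lemma hull_vertex n m (v : 'I_m -> 'rV[R]_n) i : hull v (v i).
Proof.
exists (fun j => (j == i)%:R); split=> [j||]; first by rewrite ler0n.
  by rewrite (bigD1 i)//= eqxx big1 ?addr0// => j /negPf ->.
rewrite (bigD1 i)//= eqxx scale1r big1 ?addr0// => j /negPf ->.
by rewrite scale0r.
Qed.

Lemma hull_le n m (v : 'I_m -> 'rV[R]_n) u b :
  (forall i, dotp u (v i) <= b) -> forall x, hull v x -> dotp u x <= b.
Proof.
move=> h x [a [a0 a1 ->]]; rewrite dotp_sumr -[b]mul1r -a1 big_distrl/=.
by apply: ler_sum => i _; rewrite ler_wpM2l.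
Qed.

(** Convex membership becomes conic membership once a coordinate equal to 1 is appended, so this is
    [farkas] one dimension higher; the last coordinate of the certificate yields the threshold
    [b]. *)
Lemma hull_sep n m (v : 'I_m -> 'rV[R]_n) y : ~ hull v y ->
  exists u b, (forall i, dotp u (v i) <= b) /\ b < dotp u y.
Proof.
move=> nh; pose e : 'rV[R]_1 := const_mx 1.
have [[a [a0 ha]]|[u [uv uy]]] := farkas (fun i => row_mx (v i) e) (row_mx y e).
  exfalso; apply: nh; exists a; split=> //.
    move: (congr1 (fun z => rsubmx z 0 0) ha); rewrite linear_sum summxE/=.
    rewrite row_mxKr mxE => /esym {1}<-; apply: eq_bigr => i _.
    by rewrite linearZ/= row_mxKr !mxE mulr1.
  move: (congr1 lsubmx ha); rewrite linear_sum/= row_mxKl => ->.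
  by apply: eq_bigr => i _; rewrite linearZ/= row_mxKl.
exists (lsubmx u), (- dotp (rsubmx u) e); rewrite -[u]hsubmxK in uv uy.
split=> [i|].
  by have := uv i; rewrite dotp_row_mx => h; lra.
by move: uy; rewrite dotp_row_mx => h; lra.
Qed.

Lemma sub_aff_hull n (A : set 'rV[R]_n) : A `<=` aff_hull A.
Proof.
move=> x Ax; exists 1%N, (fun=> x), (fun=> 1).
by rewrite !big_ord1 scale1r.
Qed.

Lemma dotp_aff_hull n (A : set 'rV[R]_n) u b :
  A `<=` [set x | dotp u x = b] -> aff_hull A `<=` [set x | dotp u x = b].
Proof.
move=> h y [m [x [a [xA a1 ->]]]] /=; rewrite dotp_sumr -[RHS]mul1r -a1 big_distrl/=.
by apply: eq_bigr => i _; rewrite h.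
Qed.

Definition chart n k (z0 : 'rV[R]_n) (W : 'M[R]_(k, n)) (a : 'rV[R]_k) : 'rV[R]_n :=
  z0 + a *m W.

Lemma sub_chart_aff_hull n k (z0 : 'rV[R]_n) (W : 'M[R]_(k, n)) (A : set 'rV[R]_n) :
  A `<=` range (chart z0 W) -> aff_hull A `<=` range (chart z0 W).
Proof.
move=> h y [m [x [a [xA a1 ->]]]].
have /choice[g gE] : forall i, exists c, chart z0 W c = x i.
  by move=> i; have [c _] := h _ (xA i); exists c.
exists (\sum_i a i *: g i) => //; rewrite /chart mulmx_suml.
under [RHS]eq_bigr do rewrite -gE /chart scalerDr.
rewrite big_split/= -scaler_suml a1 scale1r; congr (_ + _).
by apply: eq_bigr => i _; rewrite scalemxAl.
Qed.

Lemma chart_sub_aff_hull n k (z0 : 'rV[R]_n) (W : 'M[R]_(k, n)) (A : set 'rV[R]_n) :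
  A z0 -> (forall i, A (z0 + row i W)) -> range (chart z0 W) `<=` aff_hull A.
Proof.
move=> Az0 Ai y [a _ <-]; exists k.+1.
exists (fun i => oapp (fun j => z0 + row j W) z0 (unlift ord0 i)).
exists (fun i => oapp (a 0) (1 - \sum_j a 0 j) (unlift ord0 i)).
split=> [i||].
- by case: unliftP => [j|] _ /=.
- by rewrite big_ord_recl unlift_none /=; under [X in _ + X]eq_bigr do rewrite liftK /=; rewrite subrK.
rewrite big_ord_recl unlift_none /chart /=; under [X in _ = _ + X]eq_bigr do rewrite liftK /= scalerDr.
rewrite big_split/= -scaler_suml addrA scalerBl scale1r subrK.
by rewrite mulmx_sum_row.
Qed.

Lemma aff_hull_chart n k (z0 : 'rV[R]_n) (W : 'M[R]_(k, n)) (A : set 'rV[R]_k) :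
  aff_hull (chart z0 W @` A) = chart z0 W @` aff_hull A.
Proof.
apply/seteqP; split=> [y [m [x [a [xA a1 ->]]]]|_ [_ [m [x [a [xA a1 ->]]]] <-]].
  have /choice[g gE] : forall i, exists c, A c /\ chart z0 W c = x i.
    by move=> i; have [c ? ?] := xA i; exists c.
  exists (\sum_i a i *: g i).
    by exists m, g, a; split=> // i; apply: (gE i).1.
  rewrite /chart mulmx_suml; under [RHS]eq_bigr do rewrite -(gE _).2 /chart scalerDr.
  rewrite big_split/= -scaler_suml a1 scale1r; congr (_ + _).
  by apply: eq_bigr => i _; rewrite scalemxAl.
exists m, (chart z0 W \o x), a; split=> // [i|]; first by exists (x i).
rewrite /chart mulmx_suml; under [RHS]eq_bigr do rewrite /= scalerDr.
rewrite big_split/= -scaler_suml a1 scale1r; congr (_ + _).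
by apply: eq_bigr => i _; rewrite scalemxAl.
Qed.

Lemma chart_inj n k (z0 : 'rV[R]_n) (W : 'M[R]_(k, n)) :
  row_free W -> injective (chart z0 W).
Proof. by move=> Wf a b /addrI; exact: row_free_inj. Qed.

(** [has_dim] is phrased with [{vspace}], charts with matrices; this lemma and the next translate
    between the two. *)
Lemma row_mulmx_vspace n k (W : 'M[R]_(k, n)) (z : 'rV[R]_n) :
  (z \in <<[seq row i W | i <- enum 'I_k]>>%VS) <-> exists a, z = a *m W.
Proof.
set s := map _ _.
have ss : size s == k by rewrite size_map size_enum_ord.
have sE (i : 'I_k) : s`_i = row i W by rewrite (nth_map i) ?size_enum_ord// nth_ord_enum.
split=> [zs|[a ->]].
  have := coord_span (X := Tuple ss) zs => {1}->.
  exists (\row_i coord (Tuple ss) i z); rewrite mulmx_sum_row.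
  by apply: eq_bigr => i _; rewrite mxE -sE.
rewrite mulmx_sum_row memv_suml// => i _; rewrite memvZ// memv_span//.
by apply/mapP; exists i; rewrite ?mem_enum.
Qed.

Lemma row_free_free n k (W : 'M[R]_(k, n)) :
  row_free W = free [seq row i W | i <- enum 'I_k].
Proof.
set s := map _ _.
have ss : size s == k by rewrite size_map size_enum_ord.
have sE (i : 'I_k) : s`_i = row i W by rewrite (nth_map i) ?size_enum_ord// nth_ord_enum.
apply/idP/idP => [Wf|/(@freeP _ _ _ (Tuple ss)) h].
  apply/(@freeP _ _ _ (Tuple ss)) => c h i.
  have : (\row_j c j) *m W = 0 *m W.
    rewrite mul0mx -[RHS]h mulmx_sum_row.
    by apply: eq_bigr => j _; rewrite mxE sE.
  by move/(row_free_inj Wf)/rowP/(_ i); rewrite !mxE.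
apply: inj_row_free => a; rewrite mulmx_sum_row => h0; apply/rowP => i.
by rewrite mxE; apply: (h (fun i => a 0 i)); rewrite -[RHS]h0; apply: eq_bigr => j _; rewrite /= sE.
Qed.

Lemma chart_has_dim n k (z0 : 'rV[R]_n) (W : 'M[R]_(k, n)) (A : set 'rV[R]_n) :
  row_free W -> aff_hull A = range (chart z0 W) -> has_dim A k.
Proof.
move=> Wf hA; exists z0, <<[seq row i W | i <- enum 'I_k]>>%VS; split.
  have /eqP -> : free [seq row i W | i <- enum 'I_k] by rewrite -row_free_free.
  by rewrite size_map size_enum_ord.
rewrite hA; apply/seteqP; split=> [_ [a _ <-]|x /row_mulmx_vspace[a h]] /=.
  by apply/row_mulmx_vspace; exists a; rewrite /chart addrC addKr.
by exists a => //; rewrite /chart -h addrC subrK.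
Qed.

(* A maximal linearly independent family of differences. *)
Lemma aff_frame n (A : set 'rV[R]_n) z0 : A z0 ->
  exists k (W : 'M[R]_(k, n)),
    [/\ row_free W, forall i, A (z0 + row i W) & aff_hull A = range (chart z0 W)].
Proof.
move=> Az0.
pose P k := `[< exists W : 'M[R]_(k, n), row_free W /\ forall i, A (z0 + row i W) >].
have P0 : P 0%N by apply/asboolP; exists 0; split=> [|[]//]; rewrite -row_leq_rank.
have Pn k : P k -> (k <= n)%N.
  by move/asboolP => [W [/eqP Wk _]]; rewrite -{1}Wk rank_leq_col.
have exP : exists k, P k by exists 0%N.
have [k /asboolP[W [Wf WA]] kmax] := ex_maxnP exP Pn.
exists k, W; split=> //; apply/seteqP; split; last exact: chart_sub_aff_hull.
apply: sub_chart_aff_hull => y Ay.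
have [/submxP[a ha]|nW] := boolP (y - z0 <= W)%MS.
  by exists a => //; rewrite /chart -ha addrC subrK.
suff : P k.+1 by move/kmax; rewrite ltnn.
apply/asboolP; exists (\matrix_i oapp (fun j => row j W) (y - z0) (unlift ord0 i)).
split; last first.
  move=> i; rewrite rowK; case: unliftP => [j|] _ //=.
  by rewrite addrC subrK.
apply: inj_row_free => a; rewrite mulmx_sum_row big_ord_recl rowK unlift_none /=.
under eq_bigr do rewrite rowK liftK /=.
have -> : \sum_(i < k) a 0 (lift ord0 i) *: row i W = (\row_i a 0 (lift ord0 i)) *m W.
  by rewrite mulmx_sum_row; apply: eq_bigr => i _; rewrite mxE.
move=> h.
have a0 : a 0 ord0 = 0.
  apply/eqP/negPn/negP => a0; move/negP: nW; apply.
  apply/submxP; exists (- (a 0 ord0)^-1 *: \row_i a 0 (lift ord0 i)).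
  move/eqP: h; rewrite addrC addr_eq0 => /eqP h.
  by rewrite -scalemxAl h scalerN scaleNr opprK scalerA mulVf// scale1r.
move: h; rewrite a0 scale0r add0r => h0.
have /rowP h1 := row_free_inj Wf (etrans h0 (esym (mul0mx _ W))).
by apply/rowP => i; rewrite mxE; case: (unliftP ord0 i) => [j|] ->//; have := h1 j; rewrite !mxE.
Qed.

Lemma has_dim_ex n (A : set 'rV[R]_n) : A !=set0 -> exists k, has_dim A k.
Proof.
by case=> z /aff_frame[k [W [Wf _ h]]]; exists k; exact: chart_has_dim h.
Qed.

Lemma has_dim_nonempty n (A : set 'rV[R]_n) k : has_dim A k -> A !=set0.
Proof.
move=> [x0 [W [_ /seteqP[_ /(_ x0)]]]]; rewrite /= subrr mem0v => /(_ isT).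
move=> [[|m] [x [a [xA a1 _]]]]; last by exists (x ord0).
by move: a1; rewrite big_ord0 => /esym/eqP; rewrite oner_eq0.
Qed.

Lemma has_dim_uniq n (A : set 'rV[R]_n) k l : has_dim A k -> has_dim A l -> k = l.
Proof.
move=> [x [V [<- hV]]] [y [W [<-]]]; rewrite hV => VW; congr (\dim _).
have xy : x - y \in W.
  by have := congr1 (fun S : set _ => S x) VW; rewrite /= subrr mem0v => <-.
apply/vspaceP => z.
have := congr1 (fun S : set _ => S (z + x)) VW; rewrite /= addrK -addrA => zE.
have -> : (z \in V) = (z + (x - y) \in W) by apply/idP/idP; rewrite zE.
by rewrite rpredDr.
Qed.

(** The frame is taken inside [A] itself, not merely in its affine hull: in chart coordinates [A]
    then contains the origin and the unit vectors. *)
Lemma has_dim_chart n (A : set 'rV[R]_n) k : has_dim A k ->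
  exists z0 (W : 'M[R]_(k, n)),
    [/\ A z0, row_free W, forall i, A (z0 + row i W) & aff_hull A = range (chart z0 W)].
Proof.
move=> dA; have [z Az] := has_dim_nonempty dA.
have [l [W [Wf AW hA]]] := aff_frame Az.
have kl := has_dim_uniq dA (chart_has_dim Wf hA).
by subst l; exists z, W.
Qed.

Lemma has_dim_chartE n k (z0 : 'rV[R]_n) (W : 'M[R]_(k, n)) (A : set 'rV[R]_k) l :
  row_free W -> has_dim (chart z0 W @` A) l <-> has_dim A l.
Proof.
move=> Wf.
have h j : has_dim A j -> has_dim (chart z0 W @` A) j.
  move=> /has_dim_chart[a [V [_ Vf _ hA]]].
  apply: (@chart_has_dim _ _ (chart z0 W a) (V *m W)).
    apply: inj_row_free => x; rewrite mulmxA -[X in _ = X -> _](mul0mx _ W).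
    by move/(row_free_inj Wf); rewrite -[X in _ = X -> _](mul0mx _ V) => /(row_free_inj Vf).
  rewrite aff_hull_chart hA; apply/seteqP; split=> [_ [_ [x _ <-] <-]|_ [x _ <-]].
    by exists x => //; rewrite /chart mulmxA mulmxDl addrA.
  by exists (chart a V x); [exists x|rewrite /chart mulmxA mulmxDl addrA].
split=> [dA|]; last exact: h.
have [_ [a Aa _]] : chart z0 W @` A !=set0 := has_dim_nonempty dA.
have [j dj] : exists j, has_dim A j by apply: has_dim_ex; exists a.
by rewrite (has_dim_uniq dA (h _ dj)).
Qed.

Lemma has_dim_full n (A : set 'rV[R]_n) : has_dim A n -> aff_hull A = setT.
Proof.
move=> [x0 [W [dW ->]]]; apply/seteqP; split=> // x _ /=.
suff -> : W = fullv by rewrite memvf.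
by apply/eqP; rewrite eqEdim subvf dimvf/= /dim/= mul1n dW leqnn.
Qed.
End Affine.

(** * Facets *)

Section Facets.
Context {R : realType}.

(** A vector outside the row space is detected by some column of the cokernel matrix, which
    annihilates that space. *)
Lemma span_alternative n m (v : 'I_m -> 'rV[R]_n) x :
  (exists a : 'I_m -> R, x = \sum_i a i *: v i) \/
  (exists u, (forall i, dotp u (v i) = 0) /\ dotp u x != 0).
Proof.
pose V := \matrix_i v i.
have [/submxP[a ->]|] := boolP (x <= V)%MS.
  left; exists (fun i => a 0 i); rewrite mulmx_sum_row.
  by apply: eq_bigr => i _; rewrite rowK.
rewrite submxE => /rV0Pn[j xj]; right.
have dE z : dotp (col j (cokermx V))^T z = (z *m cokermx V) 0 j.
  by rewrite dotpC mxE; apply: eq_bigr => i _; rewrite !mxE.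
exists (col j (cokermx V))^T; split=> [i|]; last by rewrite dE.
by rewrite dE -[v i](rowK v) -row_mul mulmx_coker !mxE.
Qed.

(** The hyperplane is rotated about its intersection with the one where [w] equals [c], until it
    first meets a generator with [w] above [c]; the smallest ratio [f] tells when. *)
Lemma tilt n m (v : 'I_m -> 'rV[R]_n) u b w c j0 :
  (forall i, dotp u (v i) <= b) -> c < dotp w (v j0) ->
  exists t j, [/\ forall i, dotp (u + t *: w) (v i) <= b + t * c,
    dotp w (v j) != c & dotp (u + t *: w) (v j) = b + t * c].
Proof.
move=> uv wj0; pose f i := (b - dotp u (v i)) / (dotp w (v i) - c).
pose Q i := c < dotp w (v i).
have Qj0 : Q j0 by [].
case: (arg_minP f Qj0) => j Qj jmin; exists (f j), j.
have dj : 0 < dotp w (v j) - c by rewrite subr_gt0.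
have f0 : 0 <= f j by rewrite divr_ge0 ?subr_ge0 ?uv//; exact: ltW.
split=> [i||]; last 2 first.
- by rewrite gt_eqF.
- rewrite dotpDl dotpZl; apply/eqP; rewrite -subr_eq0; apply/eqP.
  by rewrite /f; field; rewrite gt_eqF.
rewrite dotpDl dotpZl; have [wi|wi] := leP (dotp w (v i)) c.
  by rewrite lerD ?uv// ler_wpM2l.
have := jmin i wi; rewrite {2}/f ler_pdivlMr ?subr_gt0// => h.
by rewrite -subr_ge0; move: h; rewrite -subr_ge0; congr (_ <= _); ring.
Qed.

(** [b - dotp u] is nonnegative on the generators, so its weighted average vanishes only if every
    term does. *)
Lemma face_tight n m (v : 'I_m -> 'rV[R]_n) u b (a : 'I_m -> R) :
  (forall i, dotp u (v i) <= b) -> (forall i, 0 <= a i) -> \sum_i a i = 1 ->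
  dotp u (\sum_i a i *: v i) = b <-> forall i, dotp u (v i) != b -> a i = 0.
Proof.
move=> uv a0 a1; rewrite dotp_sumr; split=> [h i ui|h].
  have /eqP : \sum_i a i * (b - dotp u (v i)) = 0.
    under eq_bigr do rewrite mulrBr; rewrite sumrB h -mulr_suml a1; ring.
  rewrite psumr_eq0 => [/allP/(_ i (mem_index_enum _))|j _]; last first.
    by rewrite mulr_ge0// subr_ge0.
  by rewrite mulf_eq0 subr_eq0 [b == _]eq_sym (negPf ui) orbF => /eqP.
rewrite -[RHS]mul1r -a1 mulr_suml; apply: eq_bigr => i _.
by have [->//|/h ->] := eqVneq (dotp u (v i)) b; rewrite !mul0r.
Qed.

Lemma hyperplane_sub n (u u' : 'rV[R]_n) b b' : u != 0 ->
  [set x | dotp u x = b] `<=` [set x | dotp u' x = b'] ->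
  exists l, u' = l *: u /\ b' = l * b.
Proof.
move=> u0 h; have uu := dotpp_gt0 u0.
pose z0 := (b / dotp u u) *: u.
have uz0 : dotp u z0 = b by rewrite dotpZr divfK ?gt_eqF.
have h0 z : dotp u z = 0 -> dotp u' z = 0.
  move=> uz; have /= h1 := h z0 uz0; have := h (z0 + z).
  by rewrite /= !dotpDr uz0 uz addr0 h1 => /(_ erefl); lra.
pose l := dotp u' u / dotp u u; exists l.
have uE : u' = l *: u.
  apply/eqP; rewrite -subr_eq0; apply/eqP/dotpp_eq0.
  have uz : dotp u (u' - l *: u) = 0.
    by rewrite dotpBr dotpZr dotpC /l divfK ?subrr// gt_eqF.
  by rewrite dotpBl dotpZl uz h0// mulr0 subrr.
by split=> //; rewrite -(h z0 uz0) uE dotpZl uz0.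
Qed.

(** The condition on the affine hull encodes the dimension: [F] spans its whole supporting
    hyperplane. [facetP] relates this to [has_dim]. *)
Definition facet_at n (P F : set 'rV[R]_n) (u : 'rV[R]_n) (b : R) :=
  [/\ forall x, P x -> dotp u x <= b, u != 0, F = P `&` [set x | dotp u x = b]
    & aff_hull F = [set x | dotp u x = b]].

(* Among the functionals separating [y] from the hull, one with the largest
   number of tight vertices is a facet functional: otherwise it could be tilted
   while its values at [y] and at the tight vertices are kept. *)
Lemma facet_sep n m (v : 'I_m -> 'rV[R]_n) y :
  aff_hull (hull v) = setT -> ~ hull v y ->
  exists u b, facet_at (hull v) (hull v `&` [set x | dotp u x = b]) u b /\ b < dotp u y.
Proof.
move=> hfull hy.
pose tight u b : {set 'I_m} := finset (fun i => dotp u (v i) == b).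
pose P k := `[< exists u b, [/\ forall i, dotp u (v i) <= b, b < dotp u y & #|tight u b| = k] >].
have [u0 [b0 [u0v u0y]]] := hull_sep hy.
have exP : exists k, P k.
  by exists #|tight u0 b0|; apply/asboolP; exists u0, b0.
have Pm k : P k -> (k <= m)%N.
  by move=> /asboolP[? [? [_ _ <-]]]; rewrite (leq_trans (max_card _))// card_ord.
have [k /asboolP[u [b [uv uy ku]]] kmax] := ex_maxnP exP Pm.
have stuck w c : (forall i, dotp u (v i) = b -> dotp w (v i) = c) -> dotp w y = c ->
    forall i, dotp w (v i) <= c.
  move=> wt wy i; rewrite leNgt; apply/negP => wi.
  have [t [j [h1 h2 h3]]] := tilt uv wi.
  suff : P #|tight (u + t *: w) (b + t * c)|.
    move/kmax; apply/negP; rewrite -ltnNge -ku; apply: proper_card.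
    apply/fintype.properP; split.
      apply/fintype.subsetP => l; rewrite !finset.in_set => /eqP ul.
      by rewrite dotpDl dotpZl ul wt.
    exists j; rewrite finset.in_set ?h3//; apply: contra h2 => /eqP uj.
    by apply/eqP/wt.
  apply/asboolP; exists (u + t *: w), (b + t * c); split=> //.
  by rewrite dotpDl dotpZl wy ltrD2r.
(* Applied to both [w] and its negative, [stuck] makes [w] constant on the hull, hence everywhere
   because the hull spans the space. *)
have stuck0 w c : (forall i, dotp u (v i) = b -> dotp w (v i) = c) -> dotp w y = c ->
    forall x, dotp w x = c.
  move=> wt wy x; suff : [set x | dotp w x = c] x by [].
  have : aff_hull (hull v) x by rewrite hfull.
  apply: dotp_aff_hull => {}x xv /=; apply/eqP; rewrite eq_le; apply/andP; split.
    by apply: hull_le xv => i; exact: stuck.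
  rewrite -lerN2 -mulN1r -dotpZl; apply: hull_le xv => i.
  apply: stuck => [{}i ui|]; rewrite dotpZl mulN1r; first by rewrite wt.
  by rewrite wy.
(* Otherwise the linear alternative gives a functional that is constant on the tight generators and
   [y] but takes another value at [x], against [stuck0]. The extra generator [y] gets coefficient
   zero because it lies off the hyperplane. *)
have span x : dotp u x = b -> exists a : 'I_m -> R,
    [/\ forall i, dotp u (v i) != b -> a i = 0, \sum_i a i = 1 & x = \sum_i a i *: v i].
  move=> ux; pose e : 'rV[R]_1 := const_mx 1.
  pose g (i : 'I_m.+1) : 'rV[R]_(n + 1) := oapp
    (fun j => if dotp u (v j) == b then row_mx (v j) e else 0) (row_mx y e) (unlift ord0 i).
  have [[a xa]|[w [wg]]] := span_alternative g (row_mx x e); last first.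
    rewrite -[w]hsubmxK; set w1 := lsubmx w; set w2 := rsubmx w.
    rewrite -[w]hsubmxK -/w1 -/w2 in wg.
    rewrite dotp_row_mx (stuck0 w1 (- dotp w2 e)) ?addNr ?eqxx//.
      move=> i ui; have := wg (lift ord0 i).
      by rewrite /g liftK/= ui eqxx dotp_row_mx => h; lra.
    by have := wg ord0; rewrite /g unlift_none/= dotp_row_mx => h; lra.
  pose a' i := if dotp u (v i) == b then a (lift ord0 i) else 0.
  have gE : row_mx x e = a ord0 *: row_mx y e + \sum_i a' i *: row_mx (v i) e.
    rewrite xa big_ord_recl /g unlift_none/=; congr (_ + _); apply: eq_bigr => i _.
    by rewrite liftK /= /a'; case: ifP => _ //; rewrite scaler0 scale0r.
  have xE : x = a ord0 *: y + \sum_i a' i *: v i.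
    have := congr1 lsubmx gE; rewrite linearD linear_sum/= linearZ/= !row_mxKl => ->.
    by congr (_ + _); apply: eq_bigr => i _; rewrite linearZ/= row_mxKl.
  have a1 : 1 = a ord0 + \sum_i a' i.
    have := congr1 (fun z => rsubmx z 0 0) gE; rewrite linearD linear_sum/= linearZ/= !row_mxKr.
    rewrite !mxE mulr1 summxE => ->.
    by congr (_ + _); apply: eq_bigr => i _; rewrite linearZ/= row_mxKr !mxE mulr1.
  have a00 : a ord0 = 0.
    have : a ord0 * (dotp u y - b) = 0.
      move: ux; rewrite xE dotpDr dotpZr dotp_sumr.
      have -> : \sum_i a' i * dotp u (v i) = (\sum_i a' i) * b.
        rewrite mulr_suml; apply: eq_bigr => i _; rewrite /a'.
        by case: eqP => [->//|_]; rewrite !mul0r.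
      have -> : \sum_i a' i = 1 - a ord0 by rewrite a1 addrC addKr.
      by move=> h; rewrite mulrBr; lra.
    by move/eqP; rewrite mulf_eq0 subr_eq0 [_ == b]gt_eqF// orbF => /eqP.
  exists a'; split=> [i /negPf h||]; first by rewrite /a' h.
    by rewrite a1 a00 add0r.
  by rewrite xE a00 scale0r add0r.
have u_neq0 : u != 0.
  apply: contra_ltN uy => /eqP u00; rewrite u00 dotp0l.
  have : aff_hull (hull v) 0 by rewrite hfull.
  move=> [[|p] [x [a [xv a1 _]]]].
    by move: a1 => /eqP; rewrite big_ord0 eq_sym oner_eq0.
  by rewrite -(dotp0l (x ord0)) -u00; apply: hull_le (xv ord0).
have [i0 ui0] : exists i, dotp u (v i) = b.
  have uu := dotpp_gt0 u_neq0.
  have [|a [a0 a1 _]] := span ((b / dotp u u) *: u); first by rewrite dotpZr divfK ?gt_eqF.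
  apply: contrapT => hn; move: a1; rewrite big1 => [/eqP|i _].
    by rewrite eq_sym oner_eq0.
  by apply: a0; apply/eqP => hi; apply: hn; exists i.
exists u, b; split=> //; split=> //; first exact: hull_le.
apply/seteqP; split=> [|x /span[a [a0 a1 ->]]].
  by apply: dotp_aff_hull => x [].
exists m, (fun i => if dotp u (v i) == b then v i else v i0), a; split=> // [i|].
  by case: eqP => ui; split => //; exact: hull_vertex.
apply: eq_bigr => i _; case: ifPn => [//|/a0 ->].
by rewrite !scale0r.
Qed.

Lemma facet_at_face n m (v : 'I_m -> 'rV[R]_n) u b u' b' :
  (forall i, dotp u (v i) <= b) -> (forall i, dotp u' (v i) <= b') ->
  (forall i, (dotp u (v i) == b) = (dotp u' (v i) == b')) ->
  hull v `&` [set x | dotp u x = b] = hull v `&` [set x | dotp u' x = b'].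
Proof.
move=> uv uv' uu'; apply/seteqP; split=> x [xv] /= h; split=> //=;
  move: xv h => [a [a0 a1 ->]] /(face_tight _ a0 a1) h; apply/(face_tight _ a0 a1) => // i ui;
  by apply: h => //; rewrite ?uu'// -uu'.
Qed.

(** Facets are indexed by their sets of tight generators, so choosing one functional per set gives a
    finite list. Two facet functionals with the same tight set cut out the same face and are
    therefore proportional. *)
Lemma hull_facets n m (v : 'I_m -> 'rV[R]_n) : aff_hull (hull v) = setT ->
  exists s : seq ('rV[R]_n * R),
    (forall p, p \in s -> facet_at (hull v) (hull v `&` [set x | dotp p.1 x = p.2]) p.1 p.2) /\
    hull v = [set x | forall p, p \in s -> dotp p.1 x <= p.2].
Proof.
move=> hfull.
pose good (p : 'rV[R]_n * R) := facet_at (hull v) (hull v `&` [set x | dotp p.1 x = p.2]) p.1 p.2.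
pose tight (p : 'rV[R]_n * R) : {set 'I_m} := finset (fun i => dotp p.1 (v i) == p.2).
have /choice[f fP] : forall J : {set 'I_m}, exists o : option ('rV[R]_n * R),
    (forall p, o = Some p -> good p /\ tight p = J) /\
    ((exists p, good p /\ tight p = J) -> o <> None).
  move=> J; have [[p pJ]|nJ] := pselect (exists p, good p /\ tight p = J).
    by exists (Some p); split=> // q [<-].
  by exists None.
exists (pmap f (enum {set 'I_m})); split=> [p|].
  rewrite mem_pmap => /mapP[J _ /esym fJ].
  by have [/(_ _ fJ)[]] := fP J.
apply/seteqP; split=> [x vx p|y hy].
  rewrite mem_pmap => /mapP[J _ /esym fJ].
  by have [/(_ _ fJ)[[+ _ _ _] _] _] := fP J; apply.
apply: contrapT => /(facet_sep hfull)[u' [b' [[uv' u'0 _ aff'] uy']]].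
have good' : good (u', b') by [].
have [h1 h2] := fP (tight (u', b')).
case fJ : (f (tight (u', b'))) => [[u b]|]; last by apply: h2 fJ; exists (u', b').
have [[/= uv u0 _ aff] tt] := h1 _ fJ.
have FF : hull v `&` [set x | dotp u x = b] = hull v `&` [set x | dotp u' x = b'].
  apply: facet_at_face => i; [exact/uv/hull_vertex|exact/uv'/hull_vertex|].
  by have := congr1 (fun J : {set 'I_m} => i \in J) tt; rewrite !finset.in_set.
have [l [u'E b'E]] : exists l, u' = l *: u /\ b' = l * b.
  by apply: hyperplane_sub => //; rewrite -aff -aff' FF.
have uy : dotp u y <= b.
  by apply: (hy (u, b)); rewrite mem_pmap -fJ map_f// mem_enum.
(* A generator strictly below the hyperplane fixes the sign of the factor [l]; it exists because the
   hull does not lie in a hyperplane. *)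
have [i ui] : exists i, dotp u (v i) < b.
  apply: contrapT => hn; move/eqP: u0; apply; apply: dotpp_eq0.
  have vb : aff_hull (hull v) `<=` [set x | dotp u x = b].
    apply: dotp_aff_hull => x [a [a0 a1 ->]] /=.
    rewrite dotp_sumr -[RHS]mul1r -a1 mulr_suml; apply: eq_bigr => i _.
    congr (_ * _); apply/eqP; rewrite eq_le uv /=; last exact: hull_vertex.
    by rewrite leNgt; apply/negP => ?; apply: hn; exists i.
  rewrite hfull in vb; have /= := vb 0 I; have /= -> := vb u I.
  by rewrite dotp0r.
move: uy'; rewrite u'E b'E dotpZl; have := uv' _ (hull_vertex v i).
rewrite u'E b'E dotpZl => h3 h4.
have l0 : 0 <= l by nra.
by move: h4; rewrite ltNge ler_wpM2l.
Qed.

Lemma hyperplane_vspace n (u : 'rV[R]_n.+1) b : u != 0 ->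
  exists x0 (W : {vspace 'rV[R]_n.+1}),
    \dim W = n /\ [set x | dotp u x = b] = [set x | x - x0 \in W].
Proof.
move=> u0; have uu := dotpp_gt0 u0.
pose f := linfun (mulmxr u^T : 'rV[R]_n.+1 -> 'M[R]_1).
have fE x : (f x == 0) = (dotp u x == 0).
  rewrite lfunE /=; apply/eqP/eqP => [/matrixP/(_ 0 0)|h].
    by rewrite !mxE dotpC => h; rewrite -[RHS]h; apply: eq_bigr => i _; rewrite !mxE.
  apply/matrixP => i j; rewrite !ord1 !mxE -[RHS]h dotpC.
  by apply: eq_bigr => k _; rewrite !mxE.
exists ((b / dotp u u) *: u), (lker f); split.
  have := limg_ker_dim f fullv; rewrite capfv dimvf /dim/= mul1n.
  suff -> : \dim (limg f) = 1%N by rewrite addn1 => -[].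
  apply/eqP; rewrite eqn_leq; apply/andP; split.
    by rewrite (leq_trans (dimvS (subvf _)))// dimvf.
  rewrite lt0n dimv_eq0; apply/eqP => h.
  have : f u \in limg f by rewrite memv_img ?memvf.
  by rewrite h memv0 fE gt_eqF.
apply/seteqP; split=> x /=; rewrite memv_ker fE dotpBr dotpZr divfK ?(gt_eqF uu)//.
  by move=> ->; rewrite subrr.
by rewrite subr_eq0 => /eqP.
Qed.

Lemma facet_at_dim n (P F : set 'rV[R]_n.+1) u b : facet_at P F u b -> has_dim F n.
Proof.
move=> [_ u0 _ hF]; have [x0 [W [dW hW]]] := hyperplane_vspace b u0.
by exists x0, W; rewrite hF.
Qed.

Lemma facetP n (P F : set 'rV[R]_n.+1) : has_dim P n.+1 ->
  face P F /\ has_dim F n <-> exists u b, facet_at P F u b.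
Proof.
move=> dP; split=> [[[u [b [uP FE]]] dF]|[u [b hF]]]; last first.
  by split; [have [? _ -> _] := hF; exists u, b|exact: facet_at_dim hF].
have u0 : u != 0.
  apply/eqP => u0; have FP : F = P.
    rewrite FE u0; apply/setIidPl => x _ /=; rewrite dotp0l.
    have [y] := has_dim_nonempty dF; rewrite FE u0 => -[_ /=].
    by rewrite dotp0l.
  by move: dF; rewrite FP => /(has_dim_uniq dP) /eqP; rewrite eqn_leq ltnn.
exists u, b; split=> //.
have Fu : aff_hull F `<=` [set x | dotp u x = b].
  by apply: dotp_aff_hull => x; rewrite FE => -[].
have [x0 [W [dW hW]]] := hyperplane_vspace b u0.
have [y0 [W' [dW' hW']]] := dF.
rewrite hW' hW in Fu *.
have y0W : y0 - x0 \in W by apply: Fu; rewrite /= subrr mem0v.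
have /eqP WW : W' == W.
  rewrite eqEdim dW dW' leqnn andbT; apply/subvP => w wW'.
  have : y0 + w - x0 \in W by apply: Fu; rewrite /= addrAC subrr add0r.
  by rewrite addrAC rpredDl.
rewrite -WW in y0W *; apply/seteqP; split=> x /=.
  by move=> xy; rewrite -(subrK y0 x) -addrA rpredD.
by move=> xx; rewrite -(subrK x0 x) -addrA rpredD// -opprB rpredN.
Qed.

Lemma dotp_continuous n (u : 'rV[R]_n) : continuous (dotp u).
Proof.
move=> x; rewrite /continuous_at /dotp.
apply: (@cvg_big R _ +%R 0 xpredT _ _ (nbhs x) _ (fun i x => u 0 i * x 0 i)) => [|i _].
  exact: add_continuous.
by apply: cvgM; [exact: cvg_cst|exact: coord_continuous].
Qed.

Lemma closed_halfspace n (u : 'rV[R]_n) b : closed [set x | dotp u x <= b].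
Proof. by apply: (@preimage_closed _ _ _ [set z | z <= b]) => [x _|];
  [exact: dotp_continuous|exact: closed_le]. Qed.

Lemma closed_hyperplane n (u : 'rV[R]_n) b : closed [set x | dotp u x = b].
Proof. by apply: (@preimage_closed _ _ _ [set z | z = b]) => [x _|];
  [exact: dotp_continuous|exact: closed_eq]. Qed.

Lemma closed_hull n m (v : 'I_m -> 'rV[R]_n) : aff_hull (hull v) = setT -> closed (hull v).
Proof.
move=> /hull_facets[s [_ ->]].
have -> : [set x | forall p, p \in s -> dotp p.1 x <= p.2] =
    \bigcap_(p in [set` s]) [set x | dotp p.1 x <= p.2] by [].
by apply: closed_bigI => p _; exact: closed_halfspace.
Qed.

(** An interior point could be moved a little along [u], which would push [dotp u] beyond its
    maximum. *)
Lemma facet_sub_boundary n (P F : set 'rV[R]_n) u b : facet_at P F u b -> F `<=` boundary P.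
Proof.
move=> [uP u0 FE _] x; rewrite FE => -[Px /= ux]; split; first exact: subset_closure.
rewrite /interior /= => Pnx.
have : \forall t \near (0 : R)^'+, P (x + t *: u).
  have c : (fun t : R => x + t *: u) @ 0^'+ --> x + 0 *: u.
    apply: cvgD; first exact: cvg_cst.
    by apply: cvgZr_tmp; exact: cvg_at_right_filter.
  by apply: c; rewrite scale0r addr0.
move=> Pt; have : \forall t \near (0 : R)^'+, P (x + t *: u) /\ 0 < t.
  by near=> t; split; [near: t|near: t; exact: nbhs_right_gt].
move=> /filter_ex[t [/uP]]; rewrite dotpDr dotpZr ux => h t0.
by have := dotpp_gt0 u0; nra.
Unshelve. all: by end_near. Qed.

(** A point on none of the finitely many facets satisfies all defining inequalities strictly, and
    this persists in a neighbourhood. *)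
Lemma boundary_facets n m (v : 'I_m -> 'rV[R]_n) x : aff_hull (hull v) = setT ->
  boundary (hull v) x -> exists F u b, facet_at (hull v) F u b /\ F x.
Proof.
move=> hfull [cx ix]; have [s [sf hs]] := hull_facets hfull.
have vx : hull v x by rewrite -((closure_id _).1 (closed_hull hfull)) in cx.
have [[p [ps px]]|hn] := pselect (exists p, p \in s /\ dotp p.1 x = p.2).
  exists (hull v `&` [set x | dotp p.1 x = p.2]), p.1, p.2; split; last by [].
  exact: sf.
exfalso; apply: ix; rewrite /interior /= hs.
have : nbhs x (\bigcap_(p in [set` s]) [set y | dotp p.1 y < p.2]).
  have -> : [set` s] = [set` [fset p in s]%fset] by apply/seteqP; split=> p /=; rewrite in_fset.
  apply: filter_bigI => p; rewrite in_fset => /= ps.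
  have : dotp p.1 x < p.2.
    rewrite lt_neqAle; apply/andP; split; last by rewrite hs in vx; exact: vx.
    by apply/eqP => px; apply: hn; exists p.
  move=> px; apply: (@dotp_continuous n p.1 x [set z | z < p.2]).
  exact: lt_nbhsl.
by apply: filterS => y h p ps; exact/ltW/h.
Qed.

End Facets.

(** * Faces and flags *)

Section Faces.
Context {R : realType}.

(* A combined functional [M *: u + u'] attains its maximum on the face cut out
   by [u'] within the face cut out by [u]: a face of a face is a face. *)
Lemma lex_functional n (s : seq 'rV[R]_n) u b u' b' : (forall z, z \in s -> dotp u z <= b) ->
  exists2 M, 0 < M & forall z, z \in s -> dotp u z != b ->
    dotp (M *: u + u') z < M * b + b'.
Proof.
move=> us; pose f z := `|dotp u' z - b'| / (b - dotp u z).
have f0 z : z \in s -> 0 <= f z by move=> zs; rewrite divr_ge0// subr_ge0 us.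
exists (1 + \sum_(z <- s) f z) => [|z zs uz].
  rewrite ltr_wpDr// big_seq; apply: sumr_ge0 => z zs; exact: f0.
have uz' : 0 < b - dotp u z by rewrite subr_gt0 lt_neqAle uz us.
have Mz : f z < 1 + \sum_(z <- s) f z.
  rewrite (perm_big _ (perm_to_rem zs)) big_cons addrCA ltrDl ltr_wpDr// big_seq.
  by apply: sumr_ge0 => y /mem_rem; exact: f0.
move: Mz; rewrite {1}/f ltr_pdivrMr// dotpDl dotpZl => h.
have := ler_norm (dotp u' z - b'); set M := 1 + _ in h *; nra.
Qed.

Lemma face_sub n (P F : set 'rV[R]_n) : face P F -> F `<=` P.
Proof. by move=> [u [b [_ ->]]]; exact: subIsetl. Qed.

Lemma finite_faces n m (v : 'I_m -> 'rV[R]_n) : finite_set [set F | face (hull v) F].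
Proof.
pose g (J : {set 'I_m}) := [set y | exists a : 'I_m -> R,
  [/\ forall i, 0 <= a i, \sum_i a i = 1, forall i, i \notin J -> a i = 0
    & y = \sum_i a i *: v i]].
apply: (@sub_finite_set _ _ (range g)); last first.
  by apply: finite_image; exact: finite_finset.
move=> F [u [b [uv ->]]]; exists (finset (fun i => dotp u (v i) == b)) => //.
have uv' i : dotp u (v i) <= b by exact/uv/hull_vertex.
apply/seteqP; split=> [_ [a [a0 a1 aJ ->]]|_ [[a [a0 a1 ->]] /= h]].
  split; first by exists a.
  by apply/(face_tight uv' a0 a1) => i ui; apply: aJ; rewrite finset.in_set.
exists a; split=> // i; rewrite finset.in_set => ui.
by move/(face_tight uv' a0 a1): h; apply.
Qed.

Lemma face_face n m (v : 'I_m -> 'rV[R]_n) F G :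
  face (hull v) F -> G `<=` F -> face F G <-> face (hull v) G.
Proof.
move=> [u [b [uv FE]]] GF; split=> [[u' [b' [uF GE]]]|[u' [b' [uv' GE]]]]; last first.
  exists u', b'; split=> [x Fx|]; first by apply: uv'; rewrite FE in Fx; exact: Fx.1.
  apply/seteqP; split=> [x Gx|x [Fx /= ux]]; last first.
    by rewrite GE; split=> //; rewrite FE in Fx; exact: Fx.1.
  by split; [exact: GF|rewrite GE in Gx; exact: Gx.2].
have uv0 i : dotp u (v i) <= b by exact/uv/hull_vertex.
have [M M0 MP] : exists2 M, 0 < M & forall z, z \in codom v -> dotp u z != b ->
    dotp (M *: u + u') z < M * b + b'.
  by apply: lex_functional => z /codomP[i ->].
have Mv i : dotp (M *: u + u') (v i) <= M * b + b'.
  have [ui|ui] := eqVneq (dotp u (v i)) b; last by rewrite ltW// MP// codom_f.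
  rewrite dotpDl dotpZl ui lerD2l; apply: uF; rewrite FE; split=> //.
  exact: hull_vertex.
exists (M *: u + u'), (M * b + b'); split; first exact: hull_le.
rewrite GE FE; apply/seteqP; split=> [x [[vx /= ux] ux']|_ [[a [a0 a1 ->]] /= h]].
  by split=> //=; rewrite dotpDl dotpZl ux ux'.
move/(face_tight Mv a0 a1) : h => h.
have aT i : a i != 0 -> dotp u (v i) = b /\ dotp u' (v i) = b'.
  move=> ai; have Mi : dotp (M *: u + u') (v i) = M * b + b'.
    by apply/eqP; apply: contraNT ai => /h ->.
  have ui : dotp u (v i) = b.
    apply/eqP/negPn/negP => /MP -/(_ (codom_f _ _)).
    by rewrite Mi ltxx.
  by split=> //; move: Mi; rewrite dotpDl dotpZl ui => /addrI.
split; first split.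
- by exists a.
- apply/(face_tight uv0 a0 a1) => i ui; apply/eqP/negPn/negP => /aT[ui' _].
  by rewrite ui' eqxx in ui.
rewrite /= dotp_sumr -[RHS]mul1r -a1 mulr_suml; apply: eq_bigr => i _.
by have [->|/aT[_ ->]//] := eqVneq (a i) 0; rewrite !mul0r.
Qed.

Lemma face_hull n m (v : 'I_m -> 'rV[R]_n) F : face (hull v) F -> F !=set0 ->
  exists w : 'I_m -> 'rV[R]_n, F = hull w.
Proof.
move=> [u [b [uv FE]]] [x Fx].
have uv0 i : dotp u (v i) <= b by exact/uv/hull_vertex.
have [i0 ui0] : exists i, dotp u (v i) = b.
  move: Fx; rewrite FE => -[[a [a0 a1 ->]]] /(face_tight uv0 a0 a1) h.
  apply: contrapT => hn; move/eqP: a1; rewrite big1 ?(eq_sym 0) ?oner_eq0// => i _.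
  by apply: h; apply/eqP => ui; apply: hn; exists i.
(* Generators off the face are replaced by one on it instead of being deleted, so the index type
   ['I_m] is the same for all faces. *)
exists (fun i => if dotp u (v i) == b then v i else v i0).
rewrite FE; apply/seteqP; split=> [_ [[a [a0 a1 ->]] /(face_tight uv0 a0 a1) h]|].
  exists a; split=> //; apply: eq_bigr => i _; case: ifPn => // /h ->.
  by rewrite !scale0r.
move=> _ [a [a0 a1 ->]]; split=> /=.
  exists (fun j => \sum_i a i * ((if dotp u (v i) == b then i else i0) == j)%:R).
  have e i (f : 'I_m -> 'rV[R]_n) : \sum_j (i == j)%:R *: f j = f i.
    rewrite (bigD1 i)//= eqxx scale1r big1 ?addr0// => j ji.
    by rewrite eq_sym (negPf ji) scale0r.
  have e' i : \sum_j (i == j)%:R = 1 :> R.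
    by rewrite (bigD1 i)//= eqxx big1 ?addr0// => j ji; rewrite eq_sym (negPf ji).
  split=> [j||].
  - by apply: sumr_ge0 => i _; rewrite mulr_ge0.
  - rewrite exchange_big -[RHS]a1; apply: eq_bigr => i _.
    by rewrite -mulr_sumr e' mulr1.
  under [RHS]eq_bigr do rewrite scaler_suml.
  rewrite exchange_big; apply: eq_bigr => i _.
  under eq_bigr do rewrite -scalerA.
  by rewrite -scaler_sumr e; case: ifP.
rewrite dotp_sumr -[RHS]mul1r -a1 mulr_suml; apply: eq_bigr => i _; congr (_ * _).
by case: eqP.
Qed.

Lemma hull_chart n k (z0 : 'rV[R]_n) (W : 'M[R]_(k, n)) m (w : 'I_m -> 'rV[R]_k) :
  hull (chart z0 W \o w) = chart z0 W @` hull w.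
Proof.
have h (a : 'I_m -> R) : \sum_i a i = 1 ->
    \sum_i a i *: chart z0 W (w i) = chart z0 W (\sum_i a i *: w i).
  move=> a1; rewrite /chart mulmx_suml; under eq_bigr do rewrite scalerDr.
  rewrite big_split/= -scaler_suml a1 scale1r; congr (_ + _).
  by apply: eq_bigr => i _; rewrite scalemxAl.
apply/seteqP; split=> [_ [a [a0 a1 ->]]|_ [_ [a [a0 a1 ->]] <-]].
  by exists (\sum_i a i *: w i); [exists a|rewrite -h].
by exists a; split=> //=; rewrite h.
Qed.

(** Left inverse of the chart, for row free [W], through the pseudo-inverse. It is affine on the
    whole space, so it may be applied to random points that miss the facet. *)
Definition cochart n k (z0 : 'rV[R]_n) (W : 'M[R]_(k, n)) (y : 'rV[R]_n) : 'rV[R]_k :=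
  (y - z0) *m pinvmx W.

Lemma chartK n k (z0 : 'rV[R]_n) (W : 'M[R]_(k, n)) :
  row_free W -> cancel (chart z0 W) (cochart z0 W).
Proof. by move=> Wf a; rewrite /cochart /chart addrAC subrr add0r mulmxKp. Qed.

Lemma cochartK n k (z0 : 'rV[R]_n) (W : 'M[R]_(k, n)) y :
  row_free W -> range (chart z0 W) y -> chart z0 W (cochart z0 W y) = y.
Proof. by move=> Wf [a _ <-]; rewrite chartK. Qed.

Lemma dotp_chart n k (z0 : 'rV[R]_n) (W : 'M[R]_(k, n)) u a :
  dotp u (chart z0 W a) = dotp u z0 + dotp (u *m W^T) a.
Proof. by rewrite /chart dotpDr dotp_mulmx. Qed.

Lemma dotp_cochart n k (z0 : 'rV[R]_n) (W : 'M[R]_(k, n)) (u : 'rV[R]_k) a : row_free W ->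
  dotp u a = dotp (u *m (pinvmx W)^T) (chart z0 W a) - dotp (u *m (pinvmx W)^T) z0.
Proof.
by move=> Wf; rewrite -{1}(@chartK _ _ z0 _ Wf a) /cochart dotp_mulmx dotpBr.
Qed.

Lemma face_chart n k (z0 : 'rV[R]_n) (W : 'M[R]_(k, n)) (Q G : set 'rV[R]_k) :
  row_free W -> face (chart z0 W @` Q) (chart z0 W @` G) <-> face Q G.
Proof.
move=> Wf; have ci := @chart_inj _ _ _ z0 _ Wf; split=> -[u [b [uQ GE]]].
  exists (u *m W^T), (b - dotp u z0); split=> [a Qa|].
    have := uQ (chart z0 W a) (imageP _ Qa).
    by rewrite dotp_chart => h; lra.
  apply/seteqP; split=> [a Ga|a [Qa /= ua]].
    have : (chart z0 W @` G) (chart z0 W a) by exists a.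
    rewrite GE => -[[a' Qa' /ci <-]] /=; rewrite dotp_chart => h; split=> //=; lra.
  have : (chart z0 W @` G) (chart z0 W a).
    rewrite GE; split; first by exists a.
    by rewrite /= dotp_chart; lra.
  by move=> [a' Ga' /ci <-].
exists (u *m (pinvmx W)^T), (b + dotp (u *m (pinvmx W)^T) z0); split=> [_ [a Qa <-]|].
  by have := uQ _ Qa; rewrite (dotp_cochart z0 _ _ Wf) => h; lra.
rewrite GE; apply/seteqP; split=> [_ [a [Qa /= ua] <-]|_ [[a Qa <-] /= h]].
  by split; [exists a|rewrite /= -ua (dotp_cochart z0 _ _ Wf); lra].
exists a => //; split=> //=; rewrite (dotp_cochart z0 _ _ Wf); lra.
Qed.
End Faces.

(** * Flags of a polytope and of its facets *)

Section Flags.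
Context {R : realType}.

Definition facets n (P : set 'rV[R]_n.+1) := [set F | face P F /\ has_dim F n].

Lemma finite_facets n m (v : 'I_m -> 'rV[R]_n.+1) : finite_set (facets (hull v)).
Proof. by apply: sub_finite_set (finite_faces v) => F []. Qed.

Lemma finite_flags n m (v : 'I_m -> 'rV[R]_n) :
  finite_set [set F : {ffun 'I_n -> set 'rV[R]_n} | is_flag (hull v) F].
Proof.
have [X XE] := finite_fsetP.1 (finite_faces v).
pose g (f : {ffun 'I_n -> X}) : {ffun 'I_n -> set 'rV[R]_n} := [ffun i => val (f i)].
apply: (@sub_finite_set _ _ (range g)); last by apply: finite_image; exact: finite_finset.
move=> F [FP _].
have FX i : F i \in X.
  by have : [set` X] (F i) by rewrite -XE; exact: (FP i).1.
by exists [ffun i => [` FX i]%fset] => //; apply/ffunP => i; rewrite !ffunE.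
Qed.

(** The last clause, that the flattened facet contains the standard simplex, comes from the frame
    being chosen inside [F]; it will place a cube inside the facet. *)
Lemma facet_chart n m (v : 'I_m -> 'rV[R]_n.+1) F : facets (hull v) F ->
  exists z0 (W : 'M[R]_(n, n.+1)) (w : 'I_m -> 'rV[R]_n),
    [/\ row_free W, F = chart z0 W @` hull w, has_dim (hull w) n,
      aff_hull F = range (chart z0 W) & hull w 0 /\ forall i, hull w (delta_mx 0 i)].
Proof.
move=> [PF dF]; have [w Fw] := face_hull PF (has_dim_nonempty dF).
have [z0 [W [Fz0 Wf FW Faff]]] := has_dim_chart dF.
have Fr y : F y -> range (chart z0 W) y by move=> Fy; rewrite -Faff; exact: sub_aff_hull.
pose w' := cochart z0 W \o w.
have FE : F = chart z0 W @` hull w'.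
  rewrite Fw -hull_chart; congr hull; apply/funext => i /=.
  by rewrite cochartK//; apply: Fr; rewrite Fw; exact: hull_vertex.
have Q a : F (chart z0 W a) -> hull w' a.
  by rewrite FE => -[a' ? /(chart_inj Wf) <-].
exists z0, W, w'; split=> //.
- by apply/(has_dim_chartE z0 _ _ Wf); rewrite -FE.
split=> [|i]; first by apply: Q; rewrite /chart mul0mx addr0.
by apply: Q; rewrite /chart -rowE.
Qed.

(** The faces of [hull v] contained in [F] are the chart images of the faces of [hull w], with equal
    dimensions, so a flag ending in [F] is a flag of [hull w] followed by [F]. *)
Lemma flags_through_facet n m (v : 'I_m -> 'rV[R]_n.+1) F z0 (W : 'M[R]_(n, n.+1))
    k (w : 'I_k -> 'rV[R]_n) :
  facets (hull v) F -> row_free W -> F = chart z0 W @` hull w ->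
  #|` fset_set [set D : {ffun 'I_n.+1 -> set 'rV[R]_n.+1} |
      is_flag (hull v) D /\ D ord_max = F]|%fset = flag (hull w).
Proof.
set Q := hull w.
move=> [PF dF] Wf FE; have ci := @chart_inj _ _ _ z0 _ Wf.
pose e (G : {ffun 'I_n -> set 'rV[R]_n}) : {ffun 'I_n.+1 -> set 'rV[R]_n.+1} :=
  [ffun i => oapp (fun j => chart z0 W @` G j) F (unlift ord_max i)].
have e_max G : e G ord_max = F by rewrite ffunE unlift_none.
have e_lift G j : e G (lift ord_max j) = chart z0 W @` G j by rewrite ffunE liftK.
have GQF (G : set 'rV[R]_n) : G `<=` Q -> chart z0 W @` G `<=` F.
  by rewrite FE => GQ; exact: image_subset.
have eP : [set D | is_flag (hull v) D /\ D ord_max = F] = e @` [set G | is_flag Q G].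
  apply/seteqP; split=> [D [[Df Ds] DF]|_ [G [Gf Gs] <-]]; last first.
    split; last by rewrite e_max.
    split=> [i|i j].
      case: (unliftP ord_max i) => [j|] ->; last by rewrite e_max.
      have [fG dG] := Gf j.
      rewrite e_lift; split; last by apply/(has_dim_chartE z0 _ _ Wf); rewrite lift_max.
      apply/(face_face PF (GQF _ (face_sub fG))).
      by rewrite FE; exact/face_chart.
    case: (unliftP ord_max i) => [i'|] ->; last by rewrite ltnNge leq_ord.
    case: (unliftP ord_max j) => [j'|] ->; rewrite ?e_lift ?e_max ?lift_max.
      by move=> ij; apply: image_subset; exact: Gs.
    by move=> _; apply: GQF; have [/face_sub] := Gf i'.
  have DjF j : D (lift ord_max j) `<=` F.
    by rewrite -DF; apply: Ds; rewrite lift_max /=.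
  have DjE j : chart z0 W @` (chart z0 W @^-1` D (lift ord_max j)) = D (lift ord_max j).
    apply/seteqP; split=> [_ [a ? <-]//|y Dy].
    have [a Qa ay] : (chart z0 W @` Q) y by rewrite -FE; exact: DjF Dy.
    by exists a; rewrite //= ay.
  exists [ffun j => chart z0 W @^-1` D (lift ord_max j)].
    split=> [i|i j ij] /=; rewrite !ffunE.
      have [fD dD] := Df (lift ord_max i).
      split; last by apply/(has_dim_chartE z0 _ _ Wf); rewrite DjE -[X in has_dim _ X]lift_max.
      by apply/(face_chart z0 _ _ Wf); rewrite DjE -FE; apply/(face_face PF (@DjF i)).
    by apply: preimage_subset; apply: Ds; rewrite !lift_max.
  apply/ffunP => i; case: (unliftP ord_max i) => [j|] ->; last by rewrite e_max.
  by rewrite e_lift ffunE DjE.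
rewrite eP fset_set_image; last exact: finite_flags.
apply: card_imfset => G G' GG'; apply/ffunP => j.
have {}GG' : chart z0 W @` G j = chart z0 W @` G' j by rewrite -!e_lift GG'.
apply/seteqP; split=> a Ga.
  by have [a' Ga' /ci <-] : (chart z0 W @` G' j) (chart z0 W a) by rewrite -GG'; exists a.
by have [a' Ga' /ci <-] : (chart z0 W @` G j) (chart z0 W a) by rewrite GG'; exists a.
Qed.

(** Every flag has exactly one last member, and it is a facet: incidences of flags and facets are
    counted in two ways. *)
Lemma flag_sum_facets n m (v : 'I_m -> 'rV[R]_n.+1) :
  flag (hull v) = (\sum_(F <- fset_set (facets (hull v)))
    #|` fset_set [set D : {ffun 'I_n.+1 -> set 'rV[R]_n.+1} |
      is_flag (hull v) D /\ D ord_max = F]|%fset)%N.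
Proof.
have fin := finite_flags v.
rewrite /flag card_fset_sum1.
transitivity (\sum_(D <- fset_set [set D | is_flag (hull v) D])
   \sum_(F <- fset_set (facets (hull v))) (D ord_max == F))%N.
  rewrite !big_seq; apply: eq_bigr => D; rewrite in_fset_set// inE => -[Df _].
  rewrite (big_fsetD1 (D ord_max)) /=; last first.
    by rewrite in_fset_set ?inE; [exact: Df|exact: finite_facets].
  rewrite eqxx big_seq big1 => [|F]; first by rewrite addn0.
  by rewrite in_fsetD1 eq_sym => /andP[/negPf ->].
rewrite exchange_big; apply: eq_bigr => F _.
rewrite card_fset_sum1 -big_mkcond/= big_fset_condE; apply: eq_fbig => // D.
rewrite in_fset_set; last by apply: sub_finite_set fin => ? [].
rewrite in_fset/= inE/= in_fset_set//.
by apply/andP/idP => [[/set_mem ? /eqP ?]|/set_mem[? ?]]; [exact/mem_set|split; [exact/mem_set|exact/eqP]].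
Qed.
End Flags.

(** * Vertices of a hull of points *)

Section Vertices.
Context {R : realType}.

(** An exposed point. The first alternative tolerates repetitions of [y] in the list; [nb_extreme]
    counts each value once. *)
Definition extreme n (s : seq 'rV[R]_n) y :=
  exists u, forall z, z \in s -> z = y \/ dotp u z < dotp u y.

Definition nb_extreme n (s : seq 'rV[R]_n) : nat :=
  size (undup [seq y <- s | `[< extreme s y >]]).

Lemma vertex_extreme n N (x : 'I_N -> 'rV[R]_n) F :
  face (hull x) F /\ has_dim F 0 <->
  exists2 y, y \in codom x /\ extreme (codom x) y & F = [set y].
Proof.
split=> [[[u [b [ub FE]]] dF]|[y [/codomP[i ->] [u uP]] ->]].
  have [z0 [W [Fz0 _ _ hF]]] := has_dim_chart dF.
  have F1 z : F z -> z = z0.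
    move=> Fz; have : aff_hull F z by exact: sub_aff_hull.
    by rewrite hF => -[a _ <-]; rewrite /chart (flatmx0 W) mulmx0 addr0.
  have ux i : dotp u (x i) <= b by exact/ub/hull_vertex.
  have [i xi] : exists i, x i = z0.
    move: (Fz0); rewrite {1}FE => -[[a [a0 a1 z0E]]] /=; rewrite z0E.
    move=> /(face_tight ux a0 a1) h; apply: contrapT => hn.
    move/eqP: a1; rewrite big1 ?(eq_sym 0) ?oner_eq0// => i _.
    apply: h; apply/eqP => ui; apply: hn; exists i; rewrite -z0E; apply: F1.
    by rewrite FE; split=> //; exact: hull_vertex.
  exists z0; last by apply/seteqP; split=> [z /F1//|_ ->].
  split; first by rewrite -xi codom_f.
  have uz0 : dotp u z0 = b by move: Fz0; rewrite FE => -[].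
  exists u => z /codomP[j ->].
  have [uj|uj] := eqVneq (dotp u (x j)) b.
    by left; apply: F1; rewrite FE; split=> //; exact: hull_vertex.
  by right; rewrite uz0 lt_neqAle uj ux.
have ux j : dotp u (x j) <= dotp u (x i).
  by have [->|/ltW] := uP _ (codom_f x j).
split.
  exists u, (dotp u (x i)); split; first exact: hull_le.
  apply/seteqP; split=> [_ ->|_ [[a [a0 a1 ->]] /= h]].
    by split=> //; exact: hull_vertex.
  move/(face_tight ux a0 a1) : h => h.
  rewrite (eq_bigr (fun j => a j *: x i)) => [|j _].
    by rewrite -scaler_suml a1 scale1r.
  have [->|uj] := uP _ (codom_f x j); first by [].
  by rewrite h ?scale0r// lt_eqF.
apply: (@chart_has_dim _ _ _ (x i) 0) => //; first by rewrite -row_leq_rank.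
apply/seteqP; split; first apply: sub_chart_aff_hull => _ ->; last first.
  by move=> _ [a _ <-]; rewrite /chart mulmx0 addr0; exact: sub_aff_hull.
by exists 0 => //; rewrite /chart mulmx0 addr0.
Qed.

Lemma nb_faces0 n N (x : 'I_N -> 'rV[R]_n) :
  nb_faces 0 (hull x) = nb_extreme (codom x).
Proof.
pose s := [seq y <- codom x | `[< extreme (codom x) y >]].
have -> : nb_faces 0 (hull x) = #|` fset_set (set1 @` [set` s])|%fset.
  congr (#|` fset_set _|%fset); apply/seteqP; split=> F.
    move=> /vertex_extreme[y [ys ye] ->]; exists y => //=.
    by rewrite mem_filter ys andbT; exact/asboolP.
  move=> [y /=]; rewrite mem_filter => /andP[/asboolP ye ys] <-.
  by apply/vertex_extreme; exists y.
rewrite fset_set_image; last exact: finite_seq.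
rewrite card_imfset; last by move=> y z /seteqP[/(_ y erefl)].
rewrite /nb_extreme -/s -card_fseq; congr (#|` _|%fset).
apply/fsetP => y; rewrite in_fset_set ?in_fset//=.
by apply/idP/idP => [/set_mem|/mem_set].
Qed.

Lemma nb_extreme_chart n k (z0 : 'rV[R]_n) (W : 'M[R]_(k, n)) (s : seq 'rV[R]_k) :
  row_free W -> nb_extreme (map (chart z0 W) s) = nb_extreme s.
Proof.
move=> Wf; have ci := @chart_inj _ _ _ z0 _ Wf.
have eE y : extreme (map (chart z0 W) s) (chart z0 W y) <-> extreme s y.
  split=> -[u uP]; [exists (u *m W^T)|exists (u *m (pinvmx W)^T)] => z.
    move=> /(map_f (chart z0 W))/uP[/ci|]; first by left.
    by rewrite !dotp_chart ltrD2l; right.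
  move=> /mapP[a /uP[->|ay] ->]; [by left|right].
  by move: ay; rewrite !(dotp_cochart z0 _ _ Wf) ltrBlDr subrK.
rewrite /nb_extreme filter_map undup_map_inj// size_map; congr (size (undup _)).
by apply: eq_filter => y /=; apply/asboolP/asboolP => /eE.
Qed.

(** A functional exposing [y] among the points on [F] may fail against points off [F]; adding a
    large multiple of the facet functional [u] pushes those below. *)
Lemma extreme_face n m (v : 'I_m -> 'rV[R]_n) F u b (s : seq 'rV[R]_n) y :
  (forall z, z \in s -> hull v z) -> facet_at (hull v) F u b -> F y ->
  extreme [seq z <- s | z \in F] y <-> extreme s y.
Proof.
move=> sv [uv _ FE _] Fy; split=> -[u' u'P]; last first.
  by exists u' => z; rewrite mem_filter => /andP[_]; exact: u'P.
have [M M0 MP] : exists2 M, 0 < M & forall z, z \in s -> dotp u z != b ->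
    dotp (M *: u + u') z < M * b + dotp u' y.
  by apply: lex_functional => z /sv; exact: uv.
have uy : dotp u y = b by move: Fy; rewrite FE => -[].
exists (M *: u + u') => z zs; rewrite !dotpDl !dotpZl uy.
have [uz|/(MP _ zs)] := eqVneq (dotp u z) b; last first.
  by rewrite dotpDl dotpZl; right.
rewrite uz ltrD2l; apply: u'P; rewrite mem_filter zs andbT.
by apply/mem_set; rewrite FE; split=> //; exact: sv.
Qed.

Lemma nb_extreme_facets n m (v : 'I_m -> 'rV[R]_n) (Fs : {fset set 'rV[R]_n}) (s : seq 'rV[R]_n) :
  (forall F, F \in Fs -> exists u b, facet_at (hull v) F u b) ->
  (forall z, z \in s -> exists2 F, F \in Fs /\ F z & forall G, G \in Fs -> G z -> G = F) ->
  nb_extreme s = (\sum_(F <- Fs) nb_extreme [seq z <- s | z \in F])%N.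
Proof.
move=> FsP sP.
have sv z : z \in s -> hull v z.
  by move=> /sP[F [/FsP[u [b [_ _ -> _]]] []]].
have e (t : seq 'rV[R]_n) (p : pred 'rV[R]_n) : size (undup (seq.filter p t)) = (\sum_(y <- undup t) p y)%N.
  by rewrite -filter_undup size_filter -sum1_count big_mkcond.
rewrite /nb_extreme e; under [RHS]eq_bigr do rewrite e.
transitivity (\sum_(y <- undup s) \sum_(F <- Fs) (y \in F) * `[< extreme s y >])%N.
  rewrite !big_seq; apply: eq_bigr => y; rewrite mem_undup => /sP[F [FF Fy] FG].
  rewrite (big_fsetD1 F)//= mem_set// mul1n big_seq big1 ?addn0// => G.
  rewrite in_fsetD1 => /andP[GF Gs]; apply/eqP; rewrite muln_eq0 eqb0.
  by apply/orP; left; apply: contraNN GF => /set_mem Gy; apply/eqP/FG.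
rewrite exchange_big /= !big_seq; apply: eq_bigr => F /FsP[u [b hF]].
rewrite -filter_undup big_filter [RHS]big_mkcond; apply: eq_bigr => y _ /=.
have [Fy|Fy] := pselect (F y); last by rewrite !(memNset Fy).
rewrite !(mem_set Fy) mul1n; congr nat_of_bool.
by apply/asboolP/asboolP => /(extreme_face sv hF Fy).
Qed.

(** A point of maximal Euclidean norm is exposed by itself, taken as a functional. *)
Lemma nb_extreme_gt0 n N (x : 'I_N.+1 -> 'rV[R]_n) : (0 < nb_extreme (codom x))%N.
Proof.
have [i _ imax] := arg_maxP (fun i => dotp (x i) (x i)) (erefl : xpredT (ord0 : 'I_N.+1)).
suff : x i \in undup [seq y <- codom x | `[< extreme (codom x) y >]].
  by rewrite /nb_extreme; case: undup.
rewrite mem_undup mem_filter codom_f andbT; apply/asboolP; exists (x i).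
move=> z /codomP[j ->]; have [->|xji] := eqVneq (x j) (x i); [by left|right].
have : 0 < dotp (x j - x i) (x j - x i) by apply: dotpp_gt0; rewrite subr_eq0.
have /= := imax j isT; rewrite !dotpBl !dotpBr [dotp (x j) (x i)]dotpC => h1 h2; lra.
Qed.

(** [undup] keeps the last occurrence of a value, so each value is counted at the last index where
    it is taken. *)
Lemma size_undup_codom (T : eqType) N (x : 'I_N -> T) (p : pred T) :
  size (undup [seq y <- codom x | p y]) =
  (\sum_(i < N) (p (x i) && [forall j : 'I_N, (i < j)%N ==> (x j != x i)]))%N.
Proof.
rewrite -filter_undup size_filter.
elim: N => [|N IH] in x *.
  by rewrite big_ord0 /codom /image_mem (size0nil (size_enum_ord 0)).
have -> : codom x = x ord0 :: codom (x \o lift ord0).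
  by rewrite /codom /image_mem enum_ordSl /= -map_comp.
have hlift (i : 'I_N) :
   [forall j : 'I_N, (i < j)%N ==> ((x \o lift ord0) j != (x \o lift ord0) i)] =
   [forall j : 'I_N.+1, (lift ord0 i < j)%N ==> (x j != x (lift ord0 i))].
  apply/forallP/forallP => h j; last by have := h (lift ord0 j); rewrite !lift0.
  by case: (unliftP ord0 j) => [j'|] -> //; have := h j'; rewrite !lift0.
rewrite big_ord_recl; under [X in (_ = _ + X)%N]eq_bigr do rewrite -hlift.
have -> : [forall j : 'I_N.+1, (0 < j)%N ==> (x j != x ord0)] = (x ord0 \notin codom (x \o lift ord0)).
  apply/forallP/negP => [h /codomP[j xj]|h j].
    by have := h (lift ord0 j); rewrite lift0 /= -[x (lift _ _)]xj eqxx.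
  case: (unliftP ord0 j) => [j'|] -> //; rewrite lift0/=.
  by apply/eqP => xj; apply: h; apply/codomP; exists j'.
rewrite -(IH (x \o lift ord0)) /=; case: ifP => /= _; first by rewrite andbF.
by rewrite andbT.
Qed.

(* Rational functionals suffice, so that being a vertex is a countable union of
   measurable conditions. *)
Lemma extreme_rat n (s : seq 'rV[R]_n) y : extreme s y <->
  exists q : 'rV[rat]_n, forall z, z \in s ->
    z = y \/ dotp (map_mx ratr q) z < dotp (map_mx ratr q) y.
Proof.
split=> [[u uP]|[q qP]]; last by exists (map_mx ratr q).
have : nbhs u (\bigcap_(z in [set` [fset z in [seq z <- s | z != y]]%fset])
    [set u' | 0 < dotp (y - z) u']).
  apply: filter_bigI => z; rewrite in_fset/= mem_filter => /andP[zy zs].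
  apply: (@dotp_continuous _ n (y - z) u [set t | 0 < t]).
  apply: lt_nbhsr; rewrite dotpC dotpBr subr_gt0.
  by have [/eqP|//] := uP z zs; rewrite (negPf zy).
move=> /nbhs_ballP[e /= e0 ue].
have /choice[q qP] : forall i, exists q : rat, ball (u 0 i) e (ratr q).
  move=> i; have [|q] := @rat_in_itvoo R (u 0 i - e) (u 0 i + e); first by lra.
  rewrite in_itv/= => /andP[h1 h2]; exists q; rewrite /ball/= ltr_norml; apply/andP; split; lra.
exists (\row_i q i) => z zs; have [->|zy] := eqVneq z y; [by left|right].
rewrite -subr_gt0 -dotpBr dotpC; apply: (ue _ _ z).
  by split=> // i j; rewrite ord1 !mxE.
by rewrite /= in_fset/= mem_filter zy.
Qed.
End Vertices.

(** * Lebesgue and Hausdorff measure *)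

Section CoverOuter.
Context {R : realType} {T I : Type} (S : I -> set T) (w : I -> \bar R) (D : set I).
Hypothesis w0 : forall i, (0 <= w i)%E.
Local Open Scope ereal_scope.

(** Lebesgue measure and, for each mesh, the Hausdorff premeasure are both of this kind, so that
    countable subadditivity is proved once. *)
Definition cover_outer (A : set T) : \bar R :=
  ereal_inf [set s | exists u : nat -> I,
    [/\ forall k, D (u k), A `<=` \bigcup_k S (u k) & s = \sum_(0 <= k <oo) w (u k)]].

Lemma cover_outer_ge0 A : 0 <= cover_outer A.
Proof.
by apply: le_ereal_inf_tmp => x [u [_ _ ->]]; exact: nneseries_ge0.
Qed.

Lemma le_cover_outer : {homo cover_outer : A B / A `<=` B >-> A <= B}.
Proof.
move=> A B AB; apply: ereal_inf_le_tmp => x [u [uD Bu ->]].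
by exists u; split=> //; exact: subset_trans Bu.
Qed.

Lemma cover_outer_sigma_subadditive : sigma_subadditive cover_outer.
Proof.
move=> A; have [[i ioo]|] := pselect (exists i, cover_outer (A i) = +oo).
  rewrite (eseries_pinfty _ _ ioo) ?leey// => n _.
  by rewrite -ltNye (lt_le_trans _ (cover_outer_ge0 _)).
rewrite -forallNE => Aoo; apply/lee_addgt0Pr => e e0.
rewrite (le_trans _ (epsilon_trick _ _ (ltW e0)))//; last first.
  by move=> n; exact: cover_outer_ge0.
have /choice[G GP] : forall n, exists u : nat -> I, [/\ forall k, D (u k),
    A n `<=` \bigcup_k S (u k) &
    \sum_(0 <= k <oo) w (u k) <= cover_outer (A n) + (e / (2 ^ n.+1)%:R)%:E].
  move=> n; have en : (0 < e / (2 ^ n.+1)%:R)%R by rewrite divr_gt0// ltr0n expn_gt0.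
  have fn : cover_outer (A n) \is a fin_num.
    by rewrite ge0_fin_numE ?cover_outer_ge0// ltey; apply/eqP/Aoo.
  have [_ [u [uD uA ->]] us] := lb_ereal_inf_adherent en fn.
  by exists u; split=> //; exact: ltW.
have /card_esym/ppcard_eqP[f] := card_nat2.
apply: (@le_trans _ _ (\sum_(0 <= k <oo) w (G (f k).1 (f k).2))).
  apply: ereal_inf_lbound; exists (fun k => G (f k).1 (f k).2); split=> //.
    by move=> k; have [] := GP (f k).1.
  move=> t [n _ /(let: And3 _ h _ := GP n in h)[k _ tk]].
  by exists (f^-1%FUN (n, k)) => //=; rewrite invK ?inE.
rewrite (_ : \sum_(0 <= k <oo) _ = \sum_(n <oo) \sum_(k <oo) w (G n k)).
  apply: lee_nneseries => n _; last by have [] := GP n.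
  by move=> _; exact: nneseries_ge0.
rewrite nneseries_esumT//.
transitivity (\esum_(p in [set: nat * nat]) w (G p.1 p.2)).
  by apply/esym/(@reindex_esum _ _ _ setT setT f); exact: bij.
rewrite [RHS]nneseries_esumT; last by move=> n; exact: nneseries_ge0.
under [RHS]eq_esum do rewrite nneseries_esumT//.
rewrite esum_esum//; congr esum; apply/seteqP; split=> //.
Qed.
End CoverOuter.

Section OuterMeasures.
Context {R : realType}.
Local Open Scope ereal_scope.

(** The absolute values make the weight nonnegative on all pairs, as the general results ask; on
    ordered corners they change nothing. *)
Lemma lebesgue_rVE n (A : set 'rV[R]_n) : lebesgue_rV A =
  cover_outer (fun p : 'rV[R]_n * 'rV[R]_n => box p.1 p.2)
    (fun p => (\prod_(i < n) `|p.2 0 i - p.1 0 i|%R)%:E)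
    [set p : 'rV[R]_n * 'rV[R]_n | forall i, (p.1 0 i <= p.2 0 i)%R] A.
Proof.
congr ereal_inf; apply/seteqP; split=> x.
  move=> [a [b [ab Aab ->]]]; exists (fun k => (a k, b k)); split=> //.
  apply: eq_eseriesr => k _; congr _%:E; apply: eq_bigr => i _ /=.
  by rewrite ger0_norm// subr_ge0.
move=> [u [uD Au ->]]; exists (fst \o u), (snd \o u); split=> //.
apply: eq_eseriesr => k _; congr _%:E; apply: eq_bigr => i _ /=.
by rewrite ger0_norm// subr_ge0; exact: uD.
Qed.

Lemma nneseries_head (f : nat -> \bar R) : (forall k, 0 <= f k) ->
  (forall k, f k.+1 = 0) -> \sum_(0 <= k <oo) f k = f 0%N.
Proof.
move=> f0 f1; rewrite nneseries_recl// eseries_cond/= eseries0 ?adde0//.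
by move=> [|k].
Qed.

Lemma cover_outer_single T I (S : I -> set T) (w : I -> \bar R) (D : set I) i0 i A :
  (forall i, 0 <= w i) -> D i0 -> w i0 = 0 -> D i -> A `<=` S i ->
  cover_outer S w D A <= w i.
Proof.
move=> w0 Di0 wi0 Di Ai; apply: ereal_inf_lbound.
exists (fun k => if k == 0%N then i else i0); split=> [k||].
- by case: ifP.
- by move=> x Ax; exists 0%N => //; exact: Ai.
by rewrite nneseries_head// => k; case: ifP.
Qed.

(** One box is padded to a sequence by null boxes, hence the positive dimension: in dimension 0 the
    empty product is 1. *)
Lemma lebesgue_rV_le_box n (A : set 'rV[R]_n.+1) (a b : 'rV[R]_n.+1) :
  (forall i, a 0 i <= b 0 i)%R -> A `<=` box a b ->
  lebesgue_rV A <= (\prod_(i < n.+1) (b 0 i - a 0 i)%R)%:E.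
Proof.
move=> ab Aab; rewrite lebesgue_rVE.
have -> : (\prod_(i < n.+1) (b 0 i - a 0 i)%R = \prod_(i < n.+1) `|(b 0 i - a 0 i)|)%R.
  by apply: eq_bigr => i _; rewrite ger0_norm// subr_ge0.
apply: (@cover_outer_single _ _ _ _ _ (0%R, 0%R) (a, b)) => //.
- by move=> p; rewrite lee_fin prodr_ge0.
- by rewrite /= big_ord_recl !mxE subrr normr0 mul0r.
Qed.

Lemma lebesgue_rV_ge0 n (A : set 'rV[R]_n) : 0 <= lebesgue_rV A.
Proof. by rewrite lebesgue_rVE; apply: cover_outer_ge0 => p; rewrite lee_fin prodr_ge0. Qed.

Lemma le_lebesgue_rV n : {homo @lebesgue_rV R n : A B / A `<=` B >-> A <= B}.
Proof. by move=> A B AB; rewrite !lebesgue_rVE; exact: le_cover_outer. Qed.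

Lemma lebesgue_rV_sigma_subadditive n : sigma_subadditive (@lebesgue_rV R n).
Proof.
move=> A; rewrite lebesgue_rVE; under eq_eseriesr do rewrite lebesgue_rVE.
by apply: cover_outer_sigma_subadditive => p; rewrite lee_fin prodr_ge0.
Qed.

Lemma lebesgue_rV0 n : @lebesgue_rV R n.+1 set0 = 0.
Proof.
apply/eqP; rewrite eq_le lebesgue_rV_ge0 andbT.
rewrite (le_trans (@lebesgue_rV_le_box _ _ 0%R 0%R _ _))//.
by rewrite big_ord_recl subrr mul0r.
Qed.

HB.instance Definition _ n := isOuterMeasure.Build R _ (@lebesgue_rV R n.+1)
  (@lebesgue_rV0 n) (@lebesgue_rV_ge0 n.+1) (@le_lebesgue_rV n.+1)
  (@lebesgue_rV_sigma_subadditive n.+1).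

Lemma diam_ge0 n (A : set 'rV[R]_n) : 0 <= diam A.
Proof. by apply: ereal_sup_ubound; left. Qed.

Lemma diam0 n : diam (set0 : set 'rV[R]_n) = 0.
Proof.
apply/eqP; rewrite eq_le diam_ge0 andbT; apply: ge_ereal_sup => x [->//|].
by move=> [? [? []]].
Qed.

Lemma hausdorff_preE n s d (A : set 'rV[R]_n) : hausdorff_pre s d A =
  cover_outer id (fun U => diam U ^+ s) [set U | diam U <= d%:E] A.
Proof. by []. Qed.

Lemma diamX_ge0 n s (A : set 'rV[R]_n) : 0 <= diam A ^+ s.
Proof. by rewrite expe_ge0// diam_ge0. Qed.

Lemma le_hausdorff n s : {homo @hausdorff R n s : A B / A `<=` B >-> A <= B}.
Proof.
move=> A B AB; apply: ge_ereal_sup => _ [d d0 <-]; apply: le_trans (ereal_sup_ubound _).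
  by rewrite hausdorff_preE; apply: le_cover_outer AB.
by exists d.
Qed.

Lemma hausdorff_pre_le n s d (A : set 'rV[R]_n) : (0 < d)%R ->
  hausdorff_pre s d A <= hausdorff s A.
Proof. by move=> d0; apply: ereal_sup_ubound; exists d. Qed.

Lemma hausdorff_ge0 n s (A : set 'rV[R]_n) : 0 <= hausdorff s A.
Proof.
apply: le_trans (hausdorff_pre_le s A ltr01).
by rewrite hausdorff_preE; apply: cover_outer_ge0 => U; exact: diamX_ge0.
Qed.

Lemma hausdorff_sigma_subadditive n s : sigma_subadditive (@hausdorff R n s).
Proof.
move=> A; apply: ge_ereal_sup => _ [d d0 <-].
rewrite hausdorff_preE (le_trans (cover_outer_sigma_subadditive _ _ _ _))//.
  by move=> U; exact: diamX_ge0.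
apply: lee_nneseries => k _; last exact: hausdorff_pre_le.
by move=> _; apply: cover_outer_ge0 => U; exact: diamX_ge0.
Qed.

Lemma hausdorff0 n s : hausdorff s.+1 (set0 : set 'rV[R]_n) = 0.
Proof.
apply/eqP; rewrite eq_le hausdorff_ge0 andbT; apply: ge_ereal_sup => _ [d d0 <-].
have d00 : diam (set0 : set 'rV[R]_n) ^+ s.+1 = 0 by rewrite diam0 expeS mul0e.
rewrite hausdorff_preE -[leRHS]d00; apply: (@cover_outer_single _ _ _ _ _ set0) => //.
- by move=> U; exact: diamX_ge0.
- by rewrite /= diam0 lee_fin ltW.
- by rewrite /= diam0 lee_fin ltW.
Qed.

HB.instance Definition _ n s := isOuterMeasure.Build R _ (@hausdorff R n s.+1)
  (@hausdorff0 n s) (@hausdorff_ge0 n s.+1) (@le_hausdorff n s.+1)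
  (@hausdorff_sigma_subadditive n s.+1).

Lemma diam_lip n k (f : 'rV[R]_n -> 'rV[R]_k) (L : R) (A : set 'rV[R]_n) : (0 < L)%R ->
  (forall x y, enorm (f x - f y) <= L * enorm (x - y))%R ->
  diam (f @` A) <= L%:E * diam A.
Proof.
move=> L0 fL; apply: ge_ereal_sup => z [->|]; first by rewrite mule_ge0 ?diam_ge0// lee_fin ltW.
move=> [_ [_ [[x Ax <-] [y Ay <-] ->]]].
apply: (@le_trans _ _ (L%:E * (enorm (x - y))%:E)); first by rewrite -EFinM lee_fin.
rewrite lee_pmul2l ?lte_fin//; apply: ereal_sup_ubound; right.
by exists x, y.
Qed.

(** The images of a cover of mesh [d / L] form a cover of mesh [d]. *)
Lemma hausdorff_lip n k (f : 'rV[R]_n -> 'rV[R]_k) (L : R) (A : set 'rV[R]_n) s : (0 < L)%R ->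
  (forall x y, enorm (f x - f y) <= L * enorm (x - y))%R ->
  hausdorff s (f @` A) <= (L ^+ s)%:E * hausdorff s A.
Proof.
move=> L0 fL; apply: ge_ereal_sup => _ [d /= d0 <-].
have dL : (0 < d / L)%R by rewrite divr_gt0.
apply: (@le_trans _ _ ((L ^+ s)%:E * hausdorff_pre s (d / L) A)); last first.
  by rewrite lee_pmul2l ?lte_fin ?exprn_gt0//; exact: hausdorff_pre_le.
rewrite -lee_pdivrMl ?exprn_gt0//; apply: le_ereal_inf_tmp => _ [U [Ud AU ->]].
rewrite lee_pdivrMl ?exprn_gt0// -nneseriesZl//; last by move=> i _; exact: diamX_ge0.
apply: (@le_trans _ _ (\sum_(0 <= i <oo) diam (f @` U i) ^+ s)).
  apply: ereal_inf_lbound; exists (fun i => f @` U i); split=> // [i|_ [x Ax <-]].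
    rewrite (le_trans (diam_lip _ L0 fL))// -(@divfK _ L _ d) ?gt_eqF// mulrC EFinM.
    by rewrite lee_pmul2l ?lte_fin.
  by have [i _ Ui] := AU x Ax; exists i => //; exists x.
apply: lee_nneseries => i _; first by move=> _; exact: diamX_ge0.
have fin : diam (U i) \is a fin_num.
  by rewrite ge0_fin_numE ?diam_ge0// (le_lt_trans (Ud i))// ltry.
have fin' : diam (f @` U i) \is a fin_num.
  by rewrite ge0_fin_numE ?diam_ge0// (le_lt_trans (diam_lip _ L0 fL))// -(fineK fin) -EFinM ltry.
have := @diam_lip _ _ f L (U i) L0 fL.
rewrite -(fineK fin) -(fineK fin') -EFinM -!EFin_expe -EFinM !lee_fin -exprMn => h.
by rewrite lerXn2r// nnegrE ?fine_ge0 ?diam_ge0// mulr_ge0 ?fine_ge0 ?diam_ge0// ltW.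
Qed.
End OuterMeasures.

(** * Caratheodory measurability of Borel sets for Lebesgue outer measure *)

Section LebesgueBorel.
Context {R : realType} {n : nat}.
Local Notation V := 'rV[R]_n.+1.
Local Notation leb := (@lebesgue_rV R n.+1).

Definition upd (a : V) (i : 'I_n.+1) (t : R) : V := \row_j (if j == i then t else a 0 j).

(** Each box of a cover is cut along [x 0 i = c]. The clamped corners [b'] and [a'] give a
    degenerate piece when the box lies on one side, and the two side lengths always add up to the
    original one. *)
Lemma caratheodory_halfspace (i : 'I_n.+1) (c : R) :
  leb.-caratheodory [set x : V | (x 0 i <= c)%R].
Proof.
apply: le_caratheodory_measurable => X; apply: le_ereal_inf_tmp => _ [a [b [ab Xab ->]]].
pose b' k := upd (b k) i (Num.max (a k 0 i) (Num.min (b k 0 i) c)).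
pose a' k := upd (a k) i (Num.min (b k 0 i) (Num.max (a k 0 i) c)).
have ab' k j : (a k 0 j <= b' k 0 j)%R.
  by rewrite mxE; case: eqP => // ->; rewrite le_max lexx.
have a'b k j : (a' k 0 j <= b k 0 j)%R.
  by rewrite mxE; case: eqP => // ->; rewrite ge_min lexx.
have prod_ge0 (p q : V) : (forall j, p 0 j <= q 0 j)%R ->
    (0 <= (\prod_(j < n.+1) (q 0 j - p 0 j)%R)%:E)%E.
  by move=> pq; rewrite lee_fin prodr_ge0// => j _; rewrite subr_ge0.
apply: (@le_trans _ _ (\sum_(0 <= k <oo) (\prod_(j < n.+1) (b' k 0 j - a k 0 j)%R)%:E +
   \sum_(0 <= k <oo) (\prod_(j < n.+1) (b k 0 j - a' k 0 j)%R)%:E)%E).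
  apply: leeD; apply: ereal_inf_lbound.
    exists a, b'; split=> // x [Xx /= xc]; have [k _ xk] := Xab _ Xx.
    exists k => // j; rewrite mxE; have /andP[h1 h2] := xk j; rewrite h1/=.
    by case: eqP => // ji; subst j; rewrite le_max le_min h2 xc orbT.
  exists a', b; split=> // x [Xx /= /negP]; rewrite -ltNge => xc; have [k _ xk] := Xab _ Xx.
  exists k => // j; rewrite mxE; have /andP[h1 h2] := xk j; rewrite h2 andbT.
  by case: eqP => // ji; subst j; rewrite ge_min ge_max h1 (ltW xc) orbT.
rewrite -nneseriesD; [|by move=> k _ _; exact: prod_ge0..].
apply: lee_nneseries => k _; first by move=> _; apply: adde_ge0; exact: prod_ge0.
rewrite -EFinD lee_fin (bigD1 i)//= [X in (_ + X <= _)%R](bigD1 i)//= [X in (_ <= X)%R](bigD1 i)//=.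
rewrite (eq_bigr (fun j => b k 0 j - a k 0 j)%R); last by move=> j /negPf ji; rewrite mxE ji.
rewrite [X in (_ + _ * X <= _)%R](eq_bigr (fun j => b k 0 j - a k 0 j)%R); last first.
  by move=> j /negPf ji; rewrite mxE ji.
rewrite -mulrDl ler_wpM2r//; first by apply: prodr_ge0 => j _; rewrite subr_ge0.
rewrite !mxE eqxx; have := ab k i; rewrite !minEle !maxEle; move: (a k 0 i) (b k 0 i) => p q pq.
by repeat case: ifPn; rewrite -?ltNge; lra.
Qed.

(** Countably many such boxes exhaust an open set; the half-open shape is what half-spaces of the
    kind just treated and their complements produce. *)
Let halfopen (p q : 'rV[rat]_n.+1) : set V :=
  [set x | forall i, (ratr (p 0 i) < x 0 i <= ratr (q 0 i))%R].

Lemma caratheodory_open (U : set V) : open U -> leb.-caratheodory U.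
Proof.
move=> Uo; pose T := caratheodory_type leb.
have mhalf i c : measurable ([set x : V | (x 0 i <= c)%R] : set T) := caratheodory_halfspace i c.
have mho p q : measurable (halfopen p q : set T).
  have -> : halfopen p q = \bigcap_(i in [set: 'I_n.+1])
     (~` [set x : V | (x 0 i <= ratr (p 0 i))%R] `&` [set x : V | (x 0 i <= ratr (q 0 i))%R]).
    apply/seteqP; split=> x h i; first by move=> _; have /andP[h1 h2] := h i;
      split=> //=; apply/negP; rewrite -ltNge.
    by have [//|/negP h1 h2] := h i; rewrite ltNge h1.
  apply: fin_bigcap_measurable; first exact: finite_finset.
  by move=> i _; apply: measurableI => //; apply: measurableC.
have -> : U = \bigcup_(pq : 'rV[rat]_n.+1 * 'rV[rat]_n.+1)
    (if `[< halfopen pq.1 pq.2 `<=` U >] then halfopen pq.1 pq.2 else set0).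
  apply/seteqP; split=> [x Ux|x [pq _]]; last by case: asboolP => // h /h.
  have /nbhs_ballP[e /= e0 xe] : nbhs x U by exact: open_nbhs_nbhs.
  have /choice[p pP] : forall i, exists q : rat, (x 0 i - e < ratr q < x 0 i)%R.
    by move=> i; have [|q] := @rat_in_itvoo R (x 0 i - e)%R (x 0 i); [lra|rewrite in_itv; exists q].
  have /choice[q qP] : forall i, exists q : rat, (x 0 i < ratr q < x 0 i + e)%R.
    by move=> i; have [|q] := @rat_in_itvoo R (x 0 i) (x 0 i + e)%R; [lra|rewrite in_itv; exists q].
  exists (\row_i p i, \row_i q i) => //=.
  case: asboolP => h; first by move=> i; rewrite !mxE;
    have /andP[_ ->] := pP i; have /andP[/ltW -> _] := qP i.
  exfalso; apply: h => y hy; apply: xe; split=> // i j.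
  rewrite ord1 /ball/= ltr_norml; have := hy j; rewrite !mxE => /andP[h1 h2].
  have /andP[? ?] := pP j; have /andP[? ?] := qP j.
  by apply/andP; split; lra.
apply: (@countable_bigcupT_measurable _ T) => [|pq]; last by case: ifP.
exact: countableP.
Qed.

Lemma caratheodory_borel (B : set V) : measurable (B : set (borel_rV R n.+1)) ->
  leb.-caratheodory B.
Proof.
move: B; apply: (smallest_sub (@sigma_algebra_measurable _ (caratheodory_type leb))).
by move=> U; exact: caratheodory_open.
Qed.

Lemma lebesgue_rV_shift (t : V) (A : set V) : (leb ((fun x => x + t)%R @` A) <= leb A)%E.
Proof.
apply: le_ereal_inf_tmp => _ [a [b [ab Aab ->]]]; apply: ereal_inf_lbound.
exists (fun k => a k + t)%R, (fun k => b k + t)%R; split=> [k i|_ [x Ax <-]|].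
- by rewrite !mxE lerD2r.
- by have [k _ xk] := Aab x Ax; exists k => // i; rewrite !mxE !lerD2r.
apply: eq_eseriesr => k _; congr _%:E; apply: eq_bigr => i _.
by rewrite !mxE; ring.
Qed.
End LebesgueBorel.

(** Two upper bounds whose sum is also a lower bound are both attained; finiteness is inherited from
    [t]. *)
Lemma squeeze_add (R : realType) (k t : R) (x y p q : \bar R) : 0 < k ->
  t%:E = (x + y)%E -> (p <= k%:E * x)%E -> (q <= k%:E * y)%E -> ((k * t)%:E <= p + q)%E ->
  (0 <= q)%E -> (0 <= p)%E -> (0 <= y)%E -> (0 <= x)%E -> p = (k%:E * x)%E.
Proof.
move=> k0 txy px qy kt q0 p0 y0 x0.
have /andP[xf yf] : (x \is a fin_num) && (y \is a fin_num) by rewrite -fin_numD -txy.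
have pf : p \is a fin_num.
  by rewrite ge0_fin_numE// (le_lt_trans px)// -(fineK xf) -EFinM ltry.
have qf : q \is a fin_num.
  by rewrite ge0_fin_numE// (le_lt_trans qy)// -(fineK yf) -EFinM ltry.
move: txy px qy kt; rewrite -(fineK xf) -(fineK yf) -(fineK pf) -(fineK qf).
rewrite -!EFinD -!EFinM !lee_fin => -[->] px qy kt; congr _%:E.
apply/eqP; rewrite eq_le px /=; rewrite mulrDr in kt; lra.
Qed.

(** * Outer measures proportional to Lebesgue measure *)

Section Proportional.
Context {R : realType} {n : nat}.
Local Notation V := 'rV[R]_n.+1.
Local Notation leb := (@lebesgue_rV R n.+1).
Variable mu : {outer_measure set V -> \bar R}.

Lemma outer_measure_bigsetU (I : finType) (P : pred I) (F : I -> set V) :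
  (mu (\big[setU/set0]_(i | P i) F i) <= \sum_(i | P i) mu (F i))%E.
Proof.
elim/big_ind2 : _ => [|x1 x2 y1 y2 h1 h2|//]; first by rewrite outer_measure0.
by rewrite (le_trans (outer_measureU2 _ _ _))// leeD.
Qed.

Definition cube (c : V) (s : R) := box c (c + const_mx s).

(* A measure that is at most [kappa] times Lebesgue measure on cubes and reaches
   this value on one cube is proportional to Lebesgue measure inside that cube.
   For Hausdorff measure in a chart, all cubes scale alike because the measure is
   homogeneous and translation invariant; so no value of [kappa] is needed. *)
Variable kappa : R.
Hypothesis kappa_gt0 : 0 < kappa.
Hypothesis mu_cube : forall c s, 0 < s -> (mu (cube c s) <= (kappa * s ^+ n.+1)%:E)%E.

(** Cubes of side [s] anchored at [a] cover the box; in direction [i] their number times [s] exceeds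
    the side of the box by at most [s]. *)
Lemma mu_box_grid (a b : V) s : (forall i, a 0 i <= b 0 i) -> 0 < s ->
  (mu (box a b) <= (kappa * \prod_(i < n.+1) (b 0 i - a 0 i + s))%:E)%E.
Proof.
move=> ab s0; pose N i := Num.truncn ((b 0 i - a 0 i) / s).
have N0 i : 0 <= (b 0 i - a 0 i) / s by rewrite divr_ge0 ?subr_ge0// ltW.
(* A common bound for all directions, so that the cubes are indexed by one finite function type. *)
pose K := (\sum_i N i)%N.
have NK i : (N i <= K)%N by rewrite /K (bigD1 i)//= leq_addr.
pose Q (i : 'I_n.+1) : pred 'I_K.+1 := fun j => (j <= N i)%N.
pose corner (f : {ffun 'I_n.+1 -> 'I_K.+1}) : V := \row_i (a 0 i + s *+ f i).
have cov : box a b `<=` \big[setU/set0]_(f in family Q) cube (corner f) s.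
  move=> x xab.
  pose T i := Num.truncn ((x 0 i - a 0 i) / s).
  have TN i : (T i <= N i)%N.
    by have /andP[_ h] := xab i; apply: le_truncn; rewrite ler_pM2r ?invr_gt0// lerD2r.
  have TK i : (T i < K.+1)%N by rewrite ltnS (leq_trans (TN i)).
  pose f : {ffun 'I_n.+1 -> 'I_K.+1} := [ffun i => Ordinal (TK i)].
  have fQ : f \in family Q by apply/familyP => i; rewrite ffunE; exact: TN.
  rewrite (bigD1 f)//=; left=> i; rewrite !mxE ffunE /=.
  have /andP[h _] := xab i.
  have h0 : 0 <= (x 0 i - a 0 i) / s by rewrite divr_ge0 ?subr_ge0// ltW.
  have /andP[] := truncn_itv h0; rewrite -/(T i) ler_pdivlMr// ltr_pdivrMr// -natr1 mulrDl mul1r.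
  by rewrite -mulr_natl => h1 h2; apply/andP; split; lra.
apply: (le_trans (le_outer_measure mu _ _ cov)).
apply: (le_trans (outer_measure_bigsetU _ _)).
apply: (@le_trans _ _ (\sum_(f in family Q) (kappa * s ^+ n.+1)%:E)%E).
  by apply: lee_sum => f _; exact: mu_cube.
rewrite sumEFin lee_fin -mulr_sumr ler_wpM2l//; first exact: ltW.
have -> : \sum_(f in family Q) s ^+ n.+1 = \prod_(i < n.+1) \sum_(j | Q i j) s.
  rewrite (bigA_distr_big_dep Q (fun _ _ => s)); apply: eq_bigr => f _.
  by rewrite prodr_const card_ord.
apply: ler_prod => i _; apply/andP; split; first by apply: sumr_ge0 => j _; exact: ltW.
rewrite sumr_const; have -> : #|Q i| = (N i).+1.
  rewrite -sum1_card (eq_bigl (fun j : 'I_K.+1 => (j < (N i).+1)%N)); last by move=> j.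
  rewrite -(big_ord_widen _ (fun=> 1%N)) ?ltnS ?NK// sum1_card card_ord//.
have /andP[h _] := truncn_itv (N0 i); rewrite -/(N i) ler_pdivlMr// in h.
by rewrite -mulr_natl -natr1 mulrDl mul1r lerD2r.
Qed.

Lemma mu_box (a b : V) : (forall i, a 0 i <= b 0 i) ->
  (mu (box a b) <= (kappa * \prod_(i < n.+1) (b 0 i - a 0 i))%:E)%E.
Proof.
move=> ab; pose g s := kappa * \prod_(i < n.+1) (b 0 i - a 0 i + s).
have gc : g s @[s --> 0^'+] --> kappa * \prod_(i < n.+1) (b 0 i - a 0 i + 0).
  apply: cvgM; first exact: cvg_cst.
  apply: (@cvg_big R _ *%R 1 xpredT _ _ (0^'+) _ (fun i s => b 0 i - a 0 i + s)) => [|i _].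
    exact: mul_continuous.
  by apply: cvgD; [exact: cvg_cst|exact: cvg_at_right_filter].
have -> : \prod_(i < n.+1) (b 0 i - a 0 i) = \prod_(i < n.+1) (b 0 i - a 0 i + 0).
  by apply: eq_bigr => i _; rewrite addr0.
apply/lee_addgt0Pr => e e0; rewrite -EFinD.
have : \forall s \near 0^'+, g s <= kappa * \prod_(i < n.+1) (b 0 i - a 0 i + 0) + e.
  by apply: (cvgr_le _ gc); rewrite ltrDl.
move=> ge; have : \forall s \near (0 : R)^'+,
    g s <= kappa * \prod_(i < n.+1) (b 0 i - a 0 i + 0) + e /\ 0 < s.
  by near=> s; split; [near: s|near: s; exact: nbhs_right_gt].
move=> /filter_ex[s [gs s0]].
by rewrite (le_trans (mu_box_grid ab s0))// lee_fin.
Unshelve. all: by end_near. Qed.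

Lemma le_mu_lebesgue A : (mu A <= kappa%:E * leb A)%E.
Proof.
rewrite -lee_pdivrMl//; apply: le_ereal_inf_tmp => _ [a [b [ab Aab ->]]].
rewrite lee_pdivrMl// -nneseriesZl//; last first.
  by move=> k _; rewrite lee_fin prodr_ge0// => i _; rewrite subr_ge0.
apply: (le_trans (le_outer_measure mu _ _ Aab)).
apply: (le_trans (outer_measure_sigma_subadditive mu _)).
apply: lee_nneseries => k _; first by move=> _; exact: outer_measure_ge0.
by rewrite -EFinM; exact: mu_box.
Qed.

Variables (c : V) (s : R).
Hypothesis s_gt0 : 0 < s.
Hypothesis mu_C : mu (cube c s) = (kappa * s ^+ n.+1)%:E.

Lemma lebesgue_cube_le c' t : 0 <= t -> (leb (cube c' t) <= (t ^+ n.+1)%:E)%E.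
Proof.
move=> t0; apply: (le_trans (@lebesgue_rV_le_box _ _ _ c' (c' + const_mx t) _ _)) => //.
  by move=> i; rewrite !mxE lerDl.
rewrite (eq_bigr (fun=> t)) ?prodr_const ?card_ord// => i _.
by rewrite !mxE addrAC subrr add0r.
Qed.

(** The lower bound needs no compactness: it is read off [mu], which has a known value on this cube
    and is at most [kappa] times Lebesgue measure. *)
Lemma lebesgue_cube : leb (cube c s) = (s ^+ n.+1)%:E.
Proof.
apply/eqP; rewrite eq_le lebesgue_cube_le/=; last exact: ltW.
have := le_mu_lebesgue (cube c s); rewrite mu_C EFinM.
by rewrite lee_pmul2l ?lte_fin.
Qed.

(* Equality, because subadditivity of [mu] turns the upper bounds for [A] and
   its complement in the cube into a lower bound. *)
Lemma mu_lebesgue (A : set V) : measurable (A : set (borel_rV R n.+1)) ->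
  A `<=` cube c s -> mu A = (kappa%:E * leb A)%E.
Proof.
move=> mA AC; have cA := caratheodory_borel mA (cube c s).
rewrite setIC (setIidl AC) lebesgue_cube in cA.
have h1 := le_mu_lebesgue A; have h2 := le_mu_lebesgue (cube c s `&` ~` A).
have h3 := le_outer_measureIC mu A (cube c s).
rewrite setIC (setIidl AC) mu_C in h3.
have := lebesgue_rV_ge0 A; have := lebesgue_rV_ge0 (cube c s `&` ~` A).
have := outer_measure_ge0 mu A; have := outer_measure_ge0 mu (cube c s `&` ~` A).
exact: squeeze_add cA h1 h2 h3.
Qed.
End Proportional.

Section Norm.
Context {R : realType}.

Lemma ler_coord_enorm n (x : 'rV[R]_n) i : `|x 0 i| <= enorm x.
Proof.
rewrite -sqrtr_sqr ler_wsqrtr// (bigD1 i)//= lerDl; apply: sumr_ge0 => j _.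
exact: sqr_ge0.
Qed.

Lemma enorm_ge0 n (x : 'rV[R]_n) : 0 <= enorm x.
Proof. exact: sqrtr_ge0. Qed.

Lemma enorm_le_sum n (x : 'rV[R]_n) : enorm x <= \sum_i `|x 0 i|.
Proof.
have s0 : 0 <= \sum_i `|x 0 i| by apply: sumr_ge0.
rewrite -[leRHS](ger0_norm s0) -sqrtr_sqr ler_wsqrtr// expr2 mulr_suml.
apply: ler_sum => i _; rewrite -real_normK ?num_real// expr2 ler_wpM2l//.
by rewrite (bigD1 i)//= lerDl sumr_ge0.
Qed.

Lemma enormZ n (a : R) (x : 'rV[R]_n) : 0 <= a -> enorm (a *: x) = a * enorm x.
Proof.
move=> a0; rewrite /enorm; under eq_bigr do rewrite mxE exprMn.
by rewrite -mulr_sumr sqrtrM ?sqr_ge0// sqrtr_sqr ger0_norm.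
Qed.

Lemma enorm_mulmx n k (W : 'M[R]_(n, k)) : exists2 L, 0 < L &
  forall x : 'rV[R]_n, enorm (x *m W) <= L * enorm x.
Proof.
exists (1 + \sum_j \sum_i `|W i j|) => [|x].
  by rewrite ltr_pwDl// sumr_ge0// => j _; apply: sumr_ge0.
rewrite mulrDl mul1r ler_wpDl ?enorm_ge0// mulr_suml (le_trans (enorm_le_sum _))//.
apply: ler_sum => j _; rewrite mxE mulr_suml (le_trans (ler_norm_sum _ _ _))//.
apply: ler_sum => i _; rewrite normrM mulrC ler_wpM2l//.
exact: ler_coord_enorm.
Qed.
End Norm.

Section Boxes.
Context {R : realType}.

Lemma caratheodory_bigsetU (T : pointedType) (mu : {outer_measure set T -> \bar R})
    (A : nat -> set T) k : (forall j, mu.-caratheodory (A j)) -> trivIset [set: nat] A ->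
  mu (\big[setU/set0]_(j < k) A j) = (\sum_(j < k) mu (A j))%E.
Proof.
move=> cA tA.
have := @measure_semi_additive_ord_I _ (caratheodory_type mu) R mu A k (fun j _ => cA j).
apply; first exact: sub_trivIset tA.
by apply: bigsetU_measurable => j _; exact: cA.
Qed.

Lemma closed_box n (a b : 'rV[R]_n) : closed (box a b).
Proof.
have -> : box a b = \bigcap_(i in [set: 'I_n])
    ((fun x : 'rV[R]_n => x 0 i) @^-1` [set t | a 0 i <= t] `&`
     (fun x : 'rV[R]_n => x 0 i) @^-1` [set t | t <= b 0 i]).
  apply/seteqP; split=> x h i; first by move=> _; apply/andP/h.
  by apply/andP/h.
apply: closed_bigI => i _; apply: closedI; apply: preimage_closed.
- by move=> x _; exact: coord_continuous.
- exact: closed_ge.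
- by move=> x _; exact: coord_continuous.
- exact: closed_le.
Qed.

Lemma closed_measurable_rV n (A : set 'rV[R]_n) : closed A -> measurable (A : set (borel_rV R n)).
Proof.
move=> Ac; rewrite -[A]setCK; apply: measurableC.
by apply: sub_sigma_algebra; exact: closed_openC.
Qed.

(** Arbitrarily many disjoint translates of the slice, shifted along a coordinate direction in which
    [u] is nonzero, fit into the cube of side [2 * s], whose measure is finite. *)
Lemma lebesgue_hyperplane n (u c : 'rV[R]_n.+1) (b s : R) : u != 0 -> 0 < s ->
  lebesgue_rV ([set x | dotp u x = b] `&` cube c s) = 0%E.
Proof.
move=> /rV0Pn[i ui] s0; set h := _ `&` _.
pose e : 'rV[R]_n.+1 := delta_mx 0 i.
have ue : dotp u e = u 0 i.
  rewrite /dotp (bigD1 i)//= big1 => [|j /negPf ji]; first by rewrite mxE !eqxx mulr1 addr0.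
  by rewrite mxE ji andbF mulr0.
suff key k : (k%:R%:E * lebesgue_rV h <= ((2 * s) ^+ n.+1)%:E)%E.
  have fin : lebesgue_rV h \is a fin_num.
    by rewrite ge0_fin_numE ?lebesgue_rV_ge0// -[lebesgue_rV h]mul1e (le_lt_trans (key 1%N))// ltry.
  apply/eqP; rewrite -(fineK fin) eqe; apply/negPn/negP => h0.
  have hp : 0 < fine (lebesgue_rV h) by rewrite lt_def h0 fine_ge0// lebesgue_rV_ge0.
  have := key (Num.truncn ((2 * s) ^+ n.+1 / fine (lebesgue_rV h))).+1.
  rewrite -{2}(fineK fin) -EFinM lee_fin -ler_pdivlMr// leNgt.
  by rewrite truncnS_gt.
pose t (j : nat) := s * j%:R / k.+1%:R.
pose A (j : nat) := [set x | dotp u x = b + t j * u 0 i] `&` cube (c + t j *: e) s.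
have mA j : measurable (A j : set (borel_rV R n.+1)).
  by apply: closed_measurable_rV; apply: closedI; [exact: closed_hyperplane|exact: closed_box].
have cA j := caratheodory_borel (mA j).
have hA j : (lebesgue_rV h <= lebesgue_rV (A j))%E.
  apply: le_trans (lebesgue_rV_shift (- (t j *: e)) _); apply: le_outer_measure.
  move=> x [/= ux xc]; exists (x + t j *: e); last by rewrite addrK.
  split; first by rewrite /= dotpDr dotpZr ue ux.
  move=> l; have := xc l; rewrite !mxE; lra.
have tA : trivIset [set: nat] A.
  apply/trivIsetP => j l _ _ jl; rewrite -subset0 => x [[/= h1 _] [/= h2 _]].
  have : t j = t l by move: h1; rewrite h2 => /addrI/(mulIf ui)/esym.
  have k0 : 0 < k.+1%:R :> R by rewrite ltr0n.
  move=> /(mulIf (invr_neq0 (lt0r_neq0 k0)))/(mulfI (lt0r_neq0 s0))/eqP.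
  by rewrite eqr_nat (negPf jl).
have AC : \big[setU/set0]_(j < k) A j `<=` cube c (2 * s).
  move=> x; rewrite -bigcup_mkord => -[j /= jk [_ xA]] l; have := xA l; rewrite !mxE eqxx /=.
  have : 0 <= t j * (l == i)%:R <= s.
    have tj : 0 <= t j <= s.
      rewrite /t divr_ge0 ?mulr_ge0 ?ler0n ?(ltW s0)//= ler_pdivrMr ?ltr0n// ler_pM2l// ler_nat.
      by rewrite ltnW// ltnS ltnW.
    by case: (l == i); rewrite ?mulr1 ?mulr0 ?lexx// ltW.
  lra.
apply: (le_trans _ (@lebesgue_cube_le _ _ c (2 * s) _)); last by rewrite mulr_ge0// ltW.
apply: le_trans (le_outer_measure _ _ _ AC).
rewrite (@caratheodory_bigsetU _ _ A k cA tA).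
elim: (k) => [|j IH]; first by rewrite big_ord0 mul0e.
rewrite big_ord_recr/= -natr1 EFinD ge0_muleDl ?lee_fin// mul1e.
by apply: leeD => //; exact: hA.
Qed.
End Boxes.

(** * Hausdorff measure on the facets *)

Section ChartMeasure.
Context {R : realType} {n k : nat}.
Variables (z0 : 'rV[R]_n) (W : 'M[R]_(k, n)) (s : nat).

Definition chart_hausdorff (A : set 'rV[R]_k) := hausdorff s.+1 (chart z0 W @` A).

Lemma chart_hausdorff0 : chart_hausdorff set0 = 0%E.
Proof. by rewrite /chart_hausdorff image_set0 outer_measure0. Qed.

Lemma chart_hausdorff_ge0 A : (0 <= chart_hausdorff A)%E.
Proof. exact: outer_measure_ge0. Qed.

Lemma le_chart_hausdorff : {homo chart_hausdorff : A B / A `<=` B >-> (A <= B)%E}.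
Proof. by move=> A B AB; apply: le_outer_measure; exact: image_subset. Qed.

Lemma chart_hausdorff_sigma_subadditive : sigma_subadditive chart_hausdorff.
Proof.
by move=> A; rewrite /chart_hausdorff image_bigcup; exact: outer_measure_sigma_subadditive.
Qed.

HB.instance Definition _ := isOuterMeasure.Build R _ chart_hausdorff
  chart_hausdorff0 chart_hausdorff_ge0 le_chart_hausdorff chart_hausdorff_sigma_subadditive.
End ChartMeasure.

Section Bounded.
Context {R : realType}.

Lemma hull_hull n m (v : 'I_m -> 'rV[R]_n) p (x : 'I_p -> 'rV[R]_n) :
  (forall i, hull v (x i)) -> hull x `<=` hull v.
Proof.
move=> /choice[g gP] _ [a [a0 a1 ->]].
exists (fun j => \sum_i a i * g i j); split=> [j||].
- by apply: sumr_ge0 => i _; rewrite mulr_ge0//; have [] := gP i.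
- rewrite exchange_big -[RHS]a1; apply: eq_bigr => i _ /=.
  by rewrite -mulr_sumr; have [_ -> _] := gP i; rewrite mulr1.
under [RHS]eq_bigr do rewrite scaler_suml.
rewrite exchange_big; apply: eq_bigr => i _ /=.
have [_ _ {1}->] := gP i; rewrite scaler_sumr; apply: eq_bigr => j _.
by rewrite scalerA.
Qed.

Lemma hull_bounded n m (v : 'I_m -> 'rV[R]_n.+1) :
  exists2 M, 0 < M & hull v `<=` cube (const_mx (- M)) (2 * M).
Proof.
exists (1 + \sum_i \sum_j `|v i 0 j|) => [|_ [a [a0 a1 ->]] j].
  by rewrite ltr_pwDl// sumr_ge0// => i _; apply: sumr_ge0.
set M := 1 + _; rewrite !mxE; suff : `|(\sum_i a i *: v i) 0 j| <= M.
  by rewrite ler_norml => /andP[h1 h2]; apply/andP; split; lra.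
have vM i : `|v i 0 j| <= M.
  apply: (@le_trans _ _ (\sum_j `|v i 0 j|)).
    by rewrite (bigD1 j)//= lerDl sumr_ge0.
  by rewrite /M (bigD1 i)//= addrCA lerDl addr_ge0// sumr_ge0// => l _; apply: sumr_ge0.
rewrite summxE (le_trans (ler_norm_sum _ _ _))// -[M]mul1r -a1 mulr_suml.
by apply: ler_sum => i _; rewrite mxE normrM ger0_norm// ler_wpM2l.
Qed.

(** The weights of [x] on the unit vectors are its coordinates; on this cube they sum to at most 1,
    and the origin takes the rest. *)
Lemma cube_sub_hull n m (v : 'I_m -> 'rV[R]_n.+1) :
  hull v 0 -> (forall i, hull v (delta_mx 0 i)) -> cube 0 (n.+1%:R^-1) `<=` hull v.
Proof.
move=> v0 ve x xc.
pose y (i : 'I_n.+2) : 'rV[R]_n.+1 := oapp (fun j => delta_mx 0 j) 0 (unlift ord0 i).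
apply: (@hull_hull _ _ v _ y); first by move=> i; rewrite /y; case: unliftP => [j|] _ /=.
pose S := \sum_j x 0 j; exists (fun i => oapp (fun j => x 0 j) (1 - S) (unlift ord0 i)).
have xi i : 0 <= x 0 i <= n.+1%:R^-1 by have := xc i; rewrite !mxE add0r.
split=> [i||].
- case: unliftP => [j|] _ /=; first by have /andP[] := xi j.
  rewrite subr_ge0 /S (@le_trans _ _ (\sum_(j < n.+1) n.+1%:R^-1))//.
    by apply: ler_sum => j _; have /andP[] := xi j.
  by rewrite big_const_ord iter_addr_0 -[leLHS]mulr_natr mulVf// pnatr_eq0.
- rewrite big_ord_recl unlift_none /=; under [X in _ + X]eq_bigr do rewrite liftK /=.
  by rewrite -/S subrK.
rewrite big_ord_recl /y unlift_none /= scaler0 add0r.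
by under eq_bigr do rewrite liftK /=; exact: row_sum_delta.
Qed.
End Bounded.

Section ChartScaling.
Context {R : realType} {n k : nat}.

(** A similarity of ratio [t / s] of the ambient space carries the image of one cube to that of the
    other and multiplies Hausdorff measure by at most [(t / s) ^+ k.+1]. *)
Lemma chart_hausdorff_cube (z0 : 'rV[R]_n) (W : 'M[R]_(k.+1, n)) (c c' : 'rV[R]_k.+1) (s t : R) :
  0 < s -> 0 < t ->
  (chart_hausdorff z0 W k (cube c' t) <= ((t / s) ^+ k.+1)%:E * chart_hausdorff z0 W k (cube c s))%E.
Proof.
move=> s0 t0; have ts : 0 < t / s by rewrite divr_gt0.
pose f (y : 'rV[R]_n) := chart z0 W c' + (t / s) *: (y - chart z0 W c).
apply: (@le_trans _ _ (hausdorff k.+1 (f @` (chart z0 W @` cube c s)))).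
  apply: le_outer_measure => _ [x xc <-].
  exists (chart z0 W (c + (s / t) *: (x - c'))).
    exists (c + (s / t) *: (x - c')) => // i.
    have := xc i; rewrite !mxE => /andP[h1 h2].
    have st : 0 < s / t by rewrite divr_gt0.
    rewrite lerDl lerD2l mulr_ge0 ?(ltW st) ?subr_ge0//=.
    by rewrite -ler_pdivlMl// invf_div [leRHS]divfK ?gt_eqF//; lra.
  have cE d : chart z0 W (c + d) - chart z0 W c = d *m W.
    by rewrite /chart mulmxDl addrA [X in X - _]addrC addrK.
  rewrite /f cE -scalemxAl scalerA.
  have -> : t / s * (s / t) = 1 by field; rewrite !gt_eqF.
  by rewrite scale1r /chart mulmxBl addrA addrAC addrK.
apply: hausdorff_lip => // x y; rewrite /f.
have h (A B : 'rV[R]_n) r : A + r *: (x - B) - (A + r *: (y - B)) = r *: (x - y).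
  by rewrite opprD addrACA subrr add0r -scalerBr opprB addrA subrK.
by rewrite h enormZ//; exact: ltW.
Qed.

(** The change of charts is Lipschitz. This lets positivity of the measure pass from one facet to
    another. *)
Lemma chart_hausdorff_le (z0 z1 : 'rV[R]_n) (W W' : 'M[R]_(k.+1, n)) : row_free W ->
  exists2 L, 0 < L & forall A,
    (chart_hausdorff z1 W' k A <= L%:E * chart_hausdorff z0 W k A)%E.
Proof.
move=> Wf; have [L L0 hL] := enorm_mulmx (pinvmx W *m W').
exists (L ^+ k.+1) => [|A]; first by rewrite exprn_gt0.
have -> : chart_hausdorff z1 W' k A =
    hausdorff k.+1 ((chart z1 W' \o cochart z0 W) @` (chart z0 W @` A)).
  rewrite /chart_hausdorff -image_comp; congr hausdorff; congr (_ @` _).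
  apply/seteqP; split=> [a Aa|_ [_ [a Aa <-] <-]]; last by rewrite chartK.
  by exists (chart z0 W a); [exists a|rewrite chartK].
apply: hausdorff_lip => // x y.
rewrite /= /chart opprD addrACA subrr add0r -mulmxBl /cochart -mulmxBl -mulmxA.
by rewrite opprB addrA subrK; exact: hL.
Qed.
End ChartScaling.

Section FacetMeasure.
Context {R : realType} {k m : nat}.
Variable v : 'I_m -> 'rV[R]_k.+2.
Let P := hull v.
Hypothesis dP : has_dim P k.+2.
Local Notation H := (@hausdorff R k.+2 k.+1).
Hypothesis H_gt0 : (0 < H (boundary P))%E.
Hypothesis H_fin : (H (boundary P) < +oo)%E.

Let hfull : aff_hull P = setT := has_dim_full dP.

Lemma boundary_bigcup_facets : boundary P = \bigcup_(F in facets P) F.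
Proof.
apply/seteqP; split=> x.
  move=> /(boundary_facets hfull)[F [u [b [hF Fx]]]]; exists F => //.
  by apply/(facetP _ dP); exists u, b.
by move=> [F /(facetP _ dP)[u [b hF]] Fx]; exact: (facet_sub_boundary hF Fx).
Qed.

Lemma exists_facet_gt0 : exists2 F, facets P F & (0 < H F)%E.
Proof.
apply: contrapT => hn; move: H_gt0; apply/negP; rewrite -leNgt.
have [X XE] := finite_fsetP.1 (finite_facets v).
rewrite boundary_bigcup_facets -/P XE bigcup_fset big_seq.
elim/big_ind : _ => [|A B hA hB|F FX]; first by rewrite outer_measure0.
  by rewrite (le_trans (outer_measureU2 _ _ _))// -[leRHS]adde0 leeD.
by rewrite leNgt; apply/negP => F0; apply: hn; exists F; rewrite // -/P XE.
Qed.

Lemma facet_measure F z0 (W : 'M[R]_(k.+1, k.+2)) (w : 'I_m -> 'rV[R]_k.+1) :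
  facets P F -> row_free W -> F = chart z0 W @` hull w ->
  hull w 0 -> (forall i, hull w (delta_mx 0 i)) ->
  exists2 kappa, 0 < kappa & [/\ (0 < lebesgue_rV (hull w))%E,
    (lebesgue_rV (hull w) < +oo)%E &
    forall A, measurable (A : set (borel_rV R k.+1)) -> A `<=` hull w ->
      H (chart z0 W @` A) = (kappa%:E * lebesgue_rV A)%E].
Proof.
move=> PF Wf FE w0 we.
have FD : F `<=` boundary P by rewrite boundary_bigcup_facets => x Fx; exists F.
pose mu := chart_hausdorff z0 W k.
(* A small cube lies in [hull w], so its image lies in the boundary, whose measure is finite;
   scaling reaches every cube. *)
have cube_fin c s : 0 < s -> (mu (cube c s) < +oo)%E.
  move=> s0; have k0 : 0 < k.+1%:R^-1 :> R by rewrite invr_gt0 ltr0n.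
  apply: (le_lt_trans (chart_hausdorff_cube z0 W 0 c k0 s0)).
  rewrite lte_mul_pinfty//; first by rewrite lee_fin exprn_ge0// divr_ge0// ltW.
  rewrite (le_lt_trans _ H_fin)//; apply: le_outer_measure; apply: subset_trans FD.
  by rewrite FE; apply: image_subset; exact: cube_sub_hull.
(* Some facet has positive measure. Its flattened copy lies in a cube, the comparison of charts
   transfers positivity to the chart of [F], and scaling transfers it to every cube. *)
have cube_gt0 c s : 0 < s -> (0 < mu (cube c s))%E.
  move=> s0; have [F1 PF1 F1p] := exists_facet_gt0.
  have [z1 [W1 [w1 [W1f F1E _ _ _]]]] := facet_chart PF1.
  have [M M0 wM] := hull_bounded w1.
  have [L L0 hL] := chart_hausdorff_le z0 z1 W1 Wf.
  have M20 : 0 < 2 * M by rewrite mulr_gt0.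
  have : (0 < mu (cube (const_mx (- M)%R) (2 * M)%R))%E.
    rewrite -(@lte_pmul2l _ L%:E)// ?lte_fin// mule0.
    apply: lt_le_trans (hL _); apply: (lt_le_trans F1p); apply: le_outer_measure.
    by rewrite F1E; exact: image_subset.
  have := chart_hausdorff_cube z0 W c (const_mx (- M)) s0 M20.
  rewrite -/mu !lt_def !outer_measure_ge0 !andbT => h; apply: contra_neq => h0.
  by apply/eqP; rewrite eq_le outer_measure_ge0 andbT (le_trans h)// h0 mule0.
have [M M0 wM] := hull_bounded w.
pose c : 'rV[R]_k.+1 := const_mx (- M); pose s := 2 * M.
have s0 : 0 < s by rewrite mulr_gt0.
have cf : mu (cube c s) \is a fin_num by rewrite ge0_fin_numE ?outer_measure_ge0// cube_fin.
pose kappa := fine (mu (cube c s)) / s ^+ k.+1.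
have sk : 0 < s ^+ k.+1 by rewrite exprn_gt0.
have kappa0 : 0 < kappa by rewrite divr_gt0// fine_gt0// cube_gt0// cube_fin.
have mu_cube c' t : 0 < t -> (mu (cube c' t) <= (kappa * t ^+ k.+1)%:E)%E.
  move=> t0; rewrite (le_trans (chart_hausdorff_cube z0 W c c' s0 t0))// -/mu -(fineK cf).
  by rewrite -EFinM lee_fin expr_div_n /kappa le_eqVlt; apply/orP; left; apply/eqP; ring.
have muC : mu (cube c s) = (kappa * s ^+ k.+1)%:E by rewrite divfK ?gt_eqF// fineK.
have hQ A : measurable (A : set (borel_rV R k.+1)) -> A `<=` hull w ->
    H (chart z0 W @` A) = (kappa%:E * lebesgue_rV A)%E.
  move=> mA Aw; apply: (mu_lebesgue kappa0 mu_cube s0 muC) => //.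
  exact: subset_trans Aw _.
have dw : has_dim (hull w) k.+1.
  by apply/(has_dim_chartE z0 _ _ Wf); rewrite -FE; exact: PF.2.
have mw : measurable (hull w : set (borel_rV R k.+1)).
  by apply: closed_measurable_rV; apply: closed_hull; exact: has_dim_full.
exists kappa => //; split=> //.
  rewrite -(@lte_pmul2l _ kappa%:E) ?lte_fin// mule0 -hQ// -FE.
  have k0 : 0 < k.+1%:R^-1 :> R by rewrite invr_gt0 ltr0n.
  apply: (lt_le_trans (cube_gt0 0 _ k0)); apply: le_outer_measure.
  by rewrite FE; apply: image_subset; exact: cube_sub_hull.
apply: (@le_lt_trans _ _ ((s ^+ k.+1)%:E)); last by rewrite ltry.
by apply: le_trans (le_outer_measure _ _ _ wM) _; apply: lebesgue_cube_le; exact: ltW.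
Qed.

Lemma facet_inter_null F G : facets P F -> facets P G -> F <> G -> H (F `&` G) = 0%E.
Proof.
move=> PF PG FG; have [z0 [W [w [Wf FE dw Faff [w0 we]]]]] := facet_chart PF.
have [kappa kappa0 [_ _ hQ]] := facet_measure PF Wf FE w0 we.
have [u [b [uP u0 uE uaff]]] := (facetP _ dP).1 PF.
have [u' [b' [uP' u0' uE' uaff']]] := (facetP _ dP).1 PG.
pose A := [set a | dotp (u' *m W^T) a = b' - dotp u' z0] `&` hull w.
have FGE : F `&` G = chart z0 W @` A.
  apply/seteqP; split=> [x [Fx Gx]|_ [a [/= ua wa] <-]].
    move: Fx; rewrite FE => -[a wa ax]; exists a => //; split=> //=.
    by move: Gx; rewrite uE' -ax => -[_]; rewrite /= dotp_chart => <-; rewrite addrC addKr.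
  have Fx : F (chart z0 W a) by rewrite FE; exists a.
  split=> //; rewrite uE'; split; first exact: (face_sub PF.1).
  by rewrite /= dotp_chart ua addrC subrK.
have [FG0|/set0P[x [Fx Gx]]] := eqVneq (F `&` G) set0; first by rewrite FG0 outer_measure0.
(* If the functional of [G] were constant on [F], the common point [x] would put [F] into the
   hyperplane of [G]; the two hyperplanes would coincide, and so would the facets. *)
have Wu : u' *m W^T != 0.
  apply/eqP => Wu0; apply: FG.
  have ub : aff_hull F `<=` [set x | dotp u' x = b'].
    move: Fx Gx; rewrite {1}FE uE' => -[a0 _ <-] [_ /=]; rewrite dotp_chart Wu0 dotp0l addr0 => <-.
    by rewrite Faff => _ [a _ <-] /=; rewrite dotp_chart Wu0 dotp0l addr0.
  rewrite uaff in ub; have [l [u'E bE]] := hyperplane_sub u0 ub.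
  have l0 : l != 0 by apply: contra_neq u0' => l0; rewrite u'E l0 scale0r.
  rewrite uE uE'; congr (_ `&` _); apply/seteqP; split=> y; first exact: ub.
  by rewrite /= u'E bE dotpZl => /(mulfI l0).
rewrite FGE hQ; last 2 first.
- apply: closed_measurable_rV; apply: closedI; first exact: closed_hyperplane.
  by apply: closed_hull; exact: has_dim_full.
- exact: subIsetr.
have [M M0 wM] := hull_bounded w.
apply/eqP; rewrite mule_eq0; apply/orP; right; rewrite eq_le lebesgue_rV_ge0 andbT.
rewrite -(@lebesgue_hyperplane _ _ (u' *m W^T) (const_mx (- M)) (b' - dotp u' z0) (2 * M))//.
  by apply: le_outer_measure; exact: setIS.
by rewrite mulr_gt0.
Qed.
End FacetMeasure.

(** * The number of vertices as a random variable *)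

Section VertexEvents.
Context {R : realType} {n N : nat} {d : measure_display} {T : measurableType d}.
Variable X : 'I_N -> T -> borel_rV R n.
Hypothesis mX : forall i, measurable_fun setT (X i).
Implicit Types (u : 'rV[R]_n).

(* A vertex hit by several points is counted at the last of their indices. *)
Definition vertex_event (i : 'I_N) : set T := [set w |
  `[< extreme (codom (fun j => X j w : 'rV[R]_n)) (X i w) >] &&
  [forall j : 'I_N, (i < j)%N ==> ((X j w : 'rV[R]_n) != X i w)]].

Lemma measurable_preimage i (B : set (borel_rV R n)) : measurable B ->
  measurable (X i @^-1` B).
Proof. by move=> mB; rewrite -[X in measurable X]setTI; exact: mX. Qed.

Lemma measurable_dotp_lt u i j : measurable [set w | dotp u (X i w) < dotp u (X j w)].
Proof.
have -> : [set w | dotp u (X i w) < dotp u (X j w)] =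
    \bigcup_(q : rat) (X i @^-1` [set x : 'rV[R]_n | dotp u x < ratr q] `&`
                       X j @^-1` [set x : 'rV[R]_n | ratr q < dotp u x]).
  apply/seteqP; split=> [w /= /rat_in_itvoo[q]|w [q _ []] /=]; last exact: lt_trans.
  by rewrite in_itv/= => /andP[h1 h2]; exists q.
apply: bigcupT_measurable_rat => q; apply: measurableI; apply: measurable_preimage;
  apply: sub_sigma_algebra.
  exact: (@open_comp _ _ (dotp u) [set z | z < ratr q] (fun x _ => @dotp_continuous _ n u x) (@open_lt _ _)).
exact: (@open_comp _ _ (dotp u) [set z | ratr q < z] (fun x _ => @dotp_continuous _ n u x) (@open_gt _ _)).
Qed.

Lemma measurable_eq_points i j : measurable [set w | X i w = X j w].
Proof.
have -> : [set w | X i w = X j w] = \bigcap_(l in [set: 'I_n])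
    (~` [set w | dotp (delta_mx 0 l) (X i w) < dotp (delta_mx 0 l) (X j w)] `&`
     ~` [set w | dotp (delta_mx 0 l) (X j w) < dotp (delta_mx 0 l) (X i w)]).
  apply/seteqP; split=> [w /= e l _|w /= h]; first by split; rewrite /= e ltxx.
  have dE (x : 'rV[R]_n) l : dotp (delta_mx 0 l) x = x 0 l.
    rewrite /dotp (bigD1 l)//= big1 => [|k /negPf kl]; first by rewrite mxE !eqxx mul1r addr0.
    by rewrite mxE kl andbF mul0r.
  apply/rowP => l; have [//|/negP] := h l; rewrite !dE -!leNgt => h1 /negP.
  by rewrite -leNgt !dE => h2; apply/eqP; rewrite eq_le h1 h2.
apply: fin_bigcap_measurable; first exact: finite_finset.
by move=> l _; apply: measurableI; apply: measurableC; exact: measurable_dotp_lt.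
Qed.

Lemma measurable_vertex_event i : measurable (vertex_event i).
Proof.
have -> : vertex_event i =
    (\bigcup_(q : 'rV[rat]_n) \bigcap_(j in [set: 'I_N]) ([set w | X j w = X i w] `|`
       [set w | dotp (map_mx ratr q) (X j w) < dotp (map_mx ratr q) (X i w)])) `&`
    \bigcap_(j in [set: 'I_N]) (if (i < j)%N then ~` [set w | X j w = X i w] else setT).
  apply/seteqP; split=> [w /andP[/asboolP/extreme_rat[q qP] /forallP h]|w [[q _ qP] h]].
    split=> [|j _]; first by exists q => // j _; exact/qP/codom_f.
    by case: ifP => // ij; have := h j; rewrite ij => /eqP.
  apply/andP; split.
    by apply/asboolP/extreme_rat; exists q => z /codomP[j ->]; exact: qP.
  by apply/forallP => j; apply/implyP => ij; have := h j I; rewrite ij => /eqP.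
apply: measurableI.
  apply: countable_bigcupT_measurable => [|q]; first exact: countableP.
  apply: fin_bigcap_measurable; first exact: finite_finset.
  by move=> j _; apply: measurableU; [exact: measurable_eq_points|exact: measurable_dotp_lt].
apply: fin_bigcap_measurable; first exact: finite_finset.
by move=> j _; case: ifP => // _; apply: measurableC; exact: measurable_eq_points.
Qed.

Lemma nb_faces0_indic w : (nb_faces 0 (hull (fun j => X j w : 'rV[R]_n)))%:R =
  \sum_(i < N) \1_(vertex_event i) w :> R.
Proof.
rewrite nb_faces0 /nb_extreme size_undup_codom natr_sum; apply: eq_bigr => i _.
by rewrite indicE; congr ((nat_of_bool _)%:R); apply/idP/idP => [h|/set_mem//]; exact/mem_set.
Qed.

Lemma measurable_nb_faces0 :
  measurable_fun setT (fun w => (nb_faces 0 (hull (fun j => X j w : 'rV[R]_n)))%:R : R).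
Proof.
under eq_fun do rewrite nb_faces0_indic.
apply: measurable_sum => i; apply: measurable_indic; exact: measurable_vertex_event.
Qed.

Lemma integral_nb_faces0 (m : {measure set T -> \bar R}) A : measurable A ->
  (\int[m]_(w in A) ((nb_faces 0 (hull (fun j => X j w : 'rV[R]_n)))%:R)%:E =
   \sum_(i < N) m (vertex_event i `&` A))%E.
Proof.
move=> mA; under eq_integral do rewrite nb_faces0_indic -sumEFin.
rewrite ge0_integral_sum//; last first.
  by move=> i; apply/measurable_EFinP/measurable_funTS/measurable_indic; exact: measurable_vertex_event.
by apply: eq_bigr => i _; rewrite integral_indic//; exact: measurable_vertex_event.
Qed.

End VertexEvents.

Section Law.
Context {R : realType} {n N : nat}.
Local Notation V := (borel_rV R n).

(** A class closed under intersection that generates the product sigma-algebra on configurations, so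
    a joint law is determined by its values on it. *)
Definition rectangles : set (set ('I_N -> V)) := [set A | exists B : 'I_N -> set V,
  (forall i, measurable (B i)) /\ A = [set x | forall i, B i (x i)]].

Local Notation Omega := (g_sigma_algebraType rectangles).

Lemma measurable_coord i : measurable_fun setT (fun x : Omega => x i).
Proof.
move=> _ B mB; rewrite setTI; apply: sub_sigma_algebra.
exists (fun j => if j == i then B else setT); split=> [j|]; first by case: ifP.
by apply/seteqP; split=> [x xB j|x /(_ i)]; [case: eqP => [->|]|rewrite eqxx].
Qed.

(** The expectation is a sum of probabilities of vertex events, each the preimage of one measurable
    set of configurations under the sampling map. *)
Lemma expected_faces_law d (T : measurableType d) (Pr : probability T R)
    (X : 'I_N -> {RV Pr >-> V}) d' (T' : measurableType d') (Pr' : probability T' R)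
    (X' : 'I_N -> {RV Pr' >-> V}) :
  (forall B : 'I_N -> set V, (forall i, measurable (B i)) ->
    Pr (\bigcap_(i in [set: 'I_N]) (X i @^-1` B i)) =
    Pr' (\bigcap_(i in [set: 'I_N]) (X' i @^-1` B i))) ->
  ('E_Pr[fun w => (nb_faces 0 (hull (fun i => X i w : 'rV[R]_n)))%:R] =
   'E_Pr'[fun w => (nb_faces 0 (hull (fun i => X' i w : 'rV[R]_n)))%:R])%E.
Proof.
move=> XX'.
have preE U (Y : 'I_N -> U -> V) B : (fun w i => Y i w) @^-1` [set x | forall i, B i (x i)] =
    \bigcap_(i in [set: 'I_N]) (Y i @^-1` B i).
  by apply/seteqP; split=> w h i; [move=> _; exact: h|exact: h i I].
have mtuple e (U : measurableType e) (Q : probability U R) (Y : 'I_N -> {RV Q >-> V}) :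
    measurable_fun setT ((fun w i => Y i w) : U -> Omega).
  apply: (@measurability _ _ _ Omega setT _ rectangles) => //.
  move=> _ [_ [B [mB ->]] <-]; rewrite setTI.
  rewrite preE.
  apply: fin_bigcap_measurable; first exact: finite_finset.
  by move=> i _; rewrite -[X in measurable X]setTI; exact: measurable_funPT.
have key : forall A : set Omega, measurable A ->
    Pr ((fun w i => X i w) @^-1` A) = Pr' ((fun w i => X' i w) @^-1` A).
  pose Xt : {mfun T >-> Omega} := mfun_Sub (mem_set (@mtuple _ _ _ X)).
  pose Xt' : {mfun T' >-> Omega} := mfun_Sub (mem_set (@mtuple _ _ _ X')).
  apply: (@measure_unique _ R Omega rectangles (fun=> setT) _ _ _ _
    (distribution Pr Xt) (distribution Pr' Xt')) => //.
  - move=> _ _ [B [mB ->]] [C [mC ->]]; exists (fun i => B i `&` C i).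
    split=> [i|]; first exact: measurableI.
    by apply/seteqP; split=> x; [move=> [h1 h2] i; split; [exact: h1|exact: h2]
      |move=> h; split=> i; have [] := h i].
  - by move=> _; exists (fun=> setT); split=> //; apply/seteqP; split.
  - by rewrite bigcup_const.
  - move=> _ [B [mB ->]]; have := XX' B mB.
    by rewrite -(preE T (fun i => X i)) -(preE T' (fun i => X' i)).
  - by move=> _; apply: (le_lt_trans (probability_le1 Pr measurableT)); rewrite ltry.
rewrite unlock !integral_nb_faces0//.
apply: eq_bigr => i _; rewrite !setIT.
exact: (key _ (measurable_vertex_event measurable_coord i)).
Qed.
End Law.

(** * The points that fall on a facet *)

Section Cochart.
Context {R : realType} {n k : nat}.

Lemma cochart_open (z0 : 'rV[R]_n) (W : 'M[R]_(k, n)) (U : set 'rV[R]_k) :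
  open U -> open (cochart z0 W @^-1` U).
Proof.
rewrite !openE => Uo y /= /Uo /nbhs_ballP[e /= e0 eU].
have [L L0 hL] := enorm_mulmx (pinvmx W).
have n0 : 0 < L * n.+1%:R by rewrite mulr_gt0 ?ltr0n.
apply/nbhs_ballP; exists (e / (L * n.+1%:R)); first by rewrite /= divr_gt0.
move=> x [_ yx]; apply: eU; split=> // i j; rewrite ord1 /ball/=.
have -> : cochart z0 W y 0 j - cochart z0 W x 0 j = ((y - x) *m pinvmx W) 0 j.
  have -> : y - x = (y - z0) - (x - z0) by rewrite opprB addrA subrK.
  by rewrite mulmxBl !mxE.
apply: (le_lt_trans (ler_coord_enorm _ _)); apply: (le_lt_trans (hL _)).
rewrite mulrC -ltr_pdivlMr//; apply: (le_lt_trans (enorm_le_sum _)).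
apply: (@le_lt_trans _ _ (n%:R * (e / (L * n.+1%:R)))).
  rewrite -[n in n%:R](card_ord n) mulr_natl -sumr_const; apply: ler_sum => l _.
  by have := yx 0 l; rewrite /ball/= !mxE => /ltW.
have -> : e / L = n.+1%:R * (e / (L * n.+1%:R)).
  by field; rewrite !gt_eqF// ltr0n.
by rewrite ltr_pM2r ?divr_gt0// ltr_nat.
Qed.

Lemma measurable_cochart (z0 : 'rV[R]_n) (W : 'M[R]_(k, n)) :
  measurable_fun setT (cochart z0 W : borel_rV R n -> borel_rV R k).
Proof.
apply: (@measurability _ _ _ (borel_rV R k) setT _ open) => //.
move=> _ [U Uo <-]; rewrite setTI; apply: sub_sigma_algebra.
exact: cochart_open.
Qed.
End Cochart.

(** For [B := setT] the quotient [mu D / mu D] must be 1, but by convention it is [0] when [mu D] is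
    [0] or [+oo]. *)
Lemma uniform_on_gt0_fin (R : realType) n (mu : set 'rV[R]_n -> \bar R) (D : set 'rV[R]_n)
    d (T : measurableType d) (Pr : probability T R) (X : {RV Pr >-> borel_rV R n}) :
  (0 <= mu D)%E -> uniform_on mu D X -> (0 < mu D)%E /\ (mu D < +oo)%E.
Proof.
move=> D0 /(_ setT measurableT); rewrite preimage_setT probability_setT setTI => h.
split; last by rewrite ltey; apply/eqP => Dy; move: h; rewrite Dy invey mule0 => /eqP; rewrite onee_eq0.
rewrite lt_def D0 andbT; apply/eqP => Dz; move: h; rewrite Dz mul0e => /eqP.
by rewrite onee_eq0.
Qed.

(** The probability that [S] is exactly the set of successes in [N] independent trials with success
    probability [p]. *)
Definition weight (R : realType) N (p : R) (S : {set 'I_N}) : R :=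
  \prod_(i < N) (if i \in S then p else 1 - p).

(** * Conditioning on the set of points that lie on a facet *)

Section Conditioning.
Context {R : realType} {k m N : nat} {d : measure_display} {T : measurableType d}.
Variable v : 'I_m -> 'rV[R]_k.+2.
Local Notation P := (hull v).
Local Notation D := (boundary P).
Local Notation H := (@hausdorff R k.+2 k.+1).
Local Notation leb := (@lebesgue_rV R k.+1).
Local Notation V := (borel_rV R k.+2).
Hypothesis dP : has_dim P k.+2.
Hypothesis H_gt0 : (0 < H D)%E.
Hypothesis H_fin : (H D < +oo)%E.
Variables (Pr : probability T R) (X : 'I_N -> {RV Pr >-> V}).
Hypothesis hX : forall i, uniform_on H D (X i).
Hypothesis hI : independent_points X.

Definition bd_law (B : set V) : R := fine (H (B `&` D) / H D).

Lemma Pr_X i (B : set V) : measurable B -> Pr (X i @^-1` B) = (bd_law B)%:E.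
Proof.
move=> mB; rewrite /bd_law -(hX i mB) fineK//.
have mXB : measurable (X i @^-1` B) by rewrite -[X in measurable X]setTI; exact: measurable_funPT.
by rewrite ge0_fin_numE// (le_lt_trans (probability_le1 _ mXB))// ltry.
Qed.

Lemma Pr_rect (B : 'I_N -> set V) : (forall i, measurable (B i)) ->
  Pr (\bigcap_(i in [set: 'I_N]) (X i @^-1` B i)) = (\prod_(i < N) bd_law (B i))%:E.
Proof.
move=> mB; rewrite hI// -prodEFin; apply: eq_bigr => i _; exact: Pr_X.
Qed.

Lemma measurable_facet F : facets P F -> measurable (F : set V).
Proof.
move=> /(facetP _ dP)[u [b [_ _ FE _]]].
have Fc : closed F.
  rewrite FE; apply: closedI; last exact: closed_hyperplane.
  by apply: closed_hull; exact: has_dim_full.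
exact: closed_measurable_rV.
Qed.

Variables (F : set 'rV[R]_k.+2) (z0 : 'rV[R]_k.+2) (W : 'M[R]_(k.+1, k.+2)).
Variable w : 'I_m -> 'rV[R]_k.+1.
Hypotheses (PF : facets P F) (Wf : row_free W) (FE : F = chart z0 W @` hull w).
Hypotheses (w0 : hull w 0) (we : forall i, hull w (delta_mx 0 i)).
Let mF := measurable_facet PF.

Lemma facet_slice : exists2 ka, 0 < ka &
  [/\ (0 < leb (hull w))%E, (leb (hull w) < +oo)%E &
    forall B : set (borel_rV R k.+1), measurable B ->
      H (F `&` cochart z0 W @^-1` B `&` D) = (ka%:E * leb (B `&` hull w))%E].
Proof.
have [ka ka0 [l0 loo hl]] := facet_measure dP H_gt0 H_fin PF Wf FE w0 we.
exists ka => //; split=> // B mB.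
have FD : F `<=` D by rewrite (boundary_bigcup_facets dP) => x Fx; exists F.
have Qc : closed (hull w).
  apply: closed_hull; apply: has_dim_full; apply/(has_dim_chartE z0 _ _ Wf).
  by rewrite -FE; case: PF.
rewrite -hl; [|by apply: measurableI => //; exact: closed_measurable_rV|by move=> x []].
congr (H _); apply/seteqP; split=> [x [[Fx Bx] _]|x [y [By Qy] <-]].
  move: Fx Bx; rewrite {1}FE => -[y Qy <-]; rewrite /= chartK// => By.
  by exists y.
have Fy : F (chart z0 W y) by rewrite FE; exists y.
by split; [split=> //=; rewrite chartK|exact: FD].
Qed.

Definition facet_law (B : set (borel_rV R k.+1)) : R := fine (leb (B `&` hull w) / leb (hull w)).

(** Here the factor between Hausdorff and Lebesgue measure cancels: it occurs in the measure of the
    slice and in that of [F]. *)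
Lemma facet_lawE B : measurable B -> [/\ 0 < bd_law F,
  (facet_law B)%:E = (leb (B `&` hull w) / leb (hull w))%E &
  bd_law (F `&` cochart z0 W @^-1` B) = bd_law F * facet_law B].
Proof.
move=> mB; have [ka ka0 [l0 loo hl]] := facet_slice.
have := hl setT measurableT; rewrite preimage_setT setIT setTI => hT.
have lB : (leb (B `&` hull w) <= leb (hull w))%E by apply: le_lebesgue_rV; exact: subIsetr.
have hD0 := H_gt0; have hDf := H_fin.
rewrite /facet_law /bd_law hl// hT.
have : leb (B `&` hull w) \is a fin_num.
  by rewrite ge0_fin_numE ?lebesgue_rV_ge0// (le_lt_trans lB).
have : leb (hull w) \is a fin_num by rewrite ge0_fin_numE ?lebesgue_rV_ge0.
have : H D \is a fin_num by rewrite ge0_fin_numE ?ltW.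
move: l0 lB hD0; case: (H D) => // h; case: (leb (hull w)) => // l.
case: (leb (B `&` hull w)) => // b; rewrite !lte_fin lee_fin => l0 bl h0 _ _ _.
rewrite -!EFinM !inver !gt_eqF// -!EFinM /=; split=> //; first by rewrite !mulr_gt0 ?invr_gt0.
by field; rewrite !gt_eqF.
Qed.

(** The index supplies a random point with law [bd_law], so the complement rule is inherited from
    [Pr]. *)
Lemma bd_lawC (i : 'I_N) : bd_law (~` F) = 1 - bd_law F.
Proof.
apply: EFin_inj; rewrite EFinB -!(Pr_X i)//; last exact: measurableC.
rewrite preimage_setC probability_setC//.
by rewrite -[X in measurable X]setTI; exact: measurable_funPT.
Qed.

Definition facet_event (S : {set 'I_N}) : set T :=
  \bigcap_(i in [set: 'I_N]) (X i @^-1` (if i \in S then F else ~` F)).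

Lemma measurable_facet_event S : measurable (facet_event S).
Proof.
apply: fin_bigcap_measurable; first exact: finite_finset.
move=> i _; rewrite -[X in measurable X]setTI; apply: measurable_funPT => //.
by case: ifP => _ //; exact: measurableC.
Qed.

(* Given the set [S] of the indices of the points on [F], these points are
   independent and uniform on [F]; the points off [F] only contribute the factor
   [Pr (X i \notin F)]. *)
Lemma cond_law (S : {set 'I_N}) (B : 'I_#|S| -> set (borel_rV R k.+1)) :
  (forall j, measurable (B j)) ->
  Pr (\bigcap_(j in [set: 'I_#|S|]) ((fun x => cochart z0 W (X (enum_val j) x)) @^-1` B j)
      `&` facet_event S) =
  (weight (bd_law F) S * \prod_j facet_law (B j))%:E.
Proof.
(* [B'] reindexes the family by ['I_N]: at most one condition applies for each [i], and none when
   [i] is outside [S]. *)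
move=> mB; pose B' i : set (borel_rV R k.+1) := [set y | forall j, enum_val j = i -> B j y].
have B'E j : B' (enum_val j) = B j.
  by apply/seteqP; split=> y; [apply|move=> By l /enum_val_inj ->].
have mB' i : measurable (B' i).
  have -> : B' i = \bigcap_(j in [set j | enum_val j = i]) B j.
    by apply/seteqP; split=> y h j; exact: h.
  by apply: fin_bigcap_measurable; [exact: finite_finset|move=> j _].
pose C i : set V := if i \in S then F `&` cochart z0 W @^-1` (B' i) else ~` F.
have mC i : measurable (C i).
  rewrite /C; case: ifP => _; last exact: measurableC.
  apply: measurableI => //; rewrite -[X in measurable X]setTI; exact: measurable_cochart.
have -> : \bigcap_(j in [set: 'I_#|S|]) ((fun x => cochart z0 W (X (enum_val j) x)) @^-1` B j)
      `&` facet_event S = \bigcap_(i in [set: 'I_N]) (X i @^-1` C i).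
  apply/seteqP; split=> [x [h1 h2] i _|x h].
    have := h2 i I; rewrite /C /=; case: ifP => // iS Fx; split=> // j ji.
    by have := h1 j I; rewrite /= ji.
  split=> [j _|i _] /=.
    have := h (enum_val j) I; rewrite /C /= enum_valP => -[_] /=; exact.
  by have := h i I; rewrite /C /=; case: ifP => // _ [].
rewrite Pr_rect//; congr _%:E.
rewrite (_ : \prod_j facet_law (B j) = \prod_(i < N) (if i \in S then facet_law (B' i) else 1)).
  rewrite /weight -big_split /=; apply: eq_bigr => i _; rewrite /C.
  case: ifP => _; first by have [_ _ ->] := facet_lawE (mB' i).
  by rewrite (bd_lawC i) mulr1.
transitivity (\prod_(i in S) facet_law (B' i)); last by rewrite big_mkcond.
by rewrite [RHS]big_enum_val; apply: eq_bigr => j _; rewrite B'E.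
Qed.

Lemma facet_lawT : facet_law setT = 1.
Proof.
have [p0 _] := facet_lawE measurableT; rewrite preimage_setT setIT => e.
by apply: (mulfI (lt0r_neq0 p0)); rewrite mulr1 -e.
Qed.

Lemma Pr_facet_event S : Pr (facet_event S) = (weight (bd_law F) S)%:E.
Proof.
have := @cond_law S (fun=> setT) (fun=> measurableT).
rewrite big1 => [|j _]; last exact: facet_lawT.
rewrite mulr1 => <-; congr (Pr _); apply/seteqP; split=> [x h|x []//].
by split.
Qed.

(** Defined on the whole sample space, but it counts vertices on [F] only where [facet_event S]
    holds. *)
Definition facet_faces (S : {set 'I_N}) (x : T) : R := (nb_faces 0
  (hull (fun j : 'I_#|S| => cochart z0 W (X (enum_val j) x) : 'rV[R]_k.+1)))%:R.

Lemma measurable_point (S : {set 'I_N}) (j : 'I_#|S|) :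
  measurable_fun setT ((fun x => cochart z0 W (X (enum_val j) x)) : T -> borel_rV R k.+1).
Proof. by apply: measurableT_comp; [exact: measurable_cochart|exact: measurable_funPT]. Qed.

(** A hull of [#|S|] points has at most [#|S|] vertices. This crude bound serves for small [S],
    where no asymptotics is available. *)
Lemma integral_facet_faces_le S :
  (0 <= \int[Pr]_(x in facet_event S) (facet_faces S x)%:E <=
   (weight (bd_law F) S * #|S|%:R)%:E)%E.
Proof.
have mE := measurable_facet_event S.
rewrite /facet_faces (integral_nb_faces0 (@measurable_point S))//; apply/andP; split.
  by apply: sume_ge0 => j _.
rewrite (@le_trans _ _ (\sum_(j < #|S|) Pr (facet_event S))%E)//.
  apply: lee_sum => j _; apply: le_measure; [rewrite inE|rewrite inE//|exact: subIsetr].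
  apply: measurableI => //; apply: measurable_vertex_event; exact: measurable_point.
by rewrite Pr_facet_event sumEFin lee_fin sumr_const card_ord mulr_natr.
Qed.

(** [Y] consists of the same maps on the same sample space, under the probability normalised on
    [facet_event S]. By [cond_law] these points are independent and uniform on [hull w], so the
    hypothesis applies to them. *)
Lemma integral_facet_faces (S : {set 'I_N}) val : weight (bd_law F) S != 0 ->
  (forall d' (T' : measurableType d') (Q : probability T' R)
    (Y : 'I_#|S| -> {RV Q >-> borel_rV R k.+1}),
    (forall i, uniform_on leb (hull w) (Y i)) -> independent_points Y ->
    'E_Q[fun x => (nb_faces 0 (hull (fun i => Y i x : 'rV[R]_k.+1)))%:R] = val%:E)%E ->
  (\int[Pr]_(x in facet_event S) (facet_faces S x)%:E = (weight (bd_law F) S * val)%:E)%E.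
Proof.
move=> wS hE; have mE := measurable_facet_event S.
(* The last argument is the default of [mnormalize] for a mass that cannot be normalised, a case
   excluded by [wS]. *)
pose Q : probability T R := mnormalize (mrestr Pr mE) Pr.
have QE (U : set T) : measurable U -> Q U = (Pr (U `&` facet_event S) * (weight (bd_law F) S)^-1%:E)%E.
  move=> mU; rewrite /Q /= /mnormalize /= /mrestr setTI Pr_facet_event.
  by rewrite eqe (negPf wS)/=.
pose Y j : {RV Q >-> borel_rV R k.+1} := mfun_Sub (mem_set (@measurable_point S j)).
have YE (B : 'I_#|S| -> set (borel_rV R k.+1)) : (forall j, measurable (B j)) ->
    Q (\bigcap_(j in [set: 'I_#|S|]) (Y j @^-1` B j)) = (\prod_j facet_law (B j))%:E.
  move=> mB; rewrite QE; last first.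
    apply: fin_bigcap_measurable; first exact: finite_finset.
    by move=> j _; rewrite -[X in measurable X]setTI; exact: measurable_funPT.
  by rewrite (cond_law mB) -EFinM mulrAC divff// mul1r.
have Y1 j B : measurable B -> Q (Y j @^-1` B) = (facet_law B)%:E.
  move=> mB; have := YE (fun i => if i == j then B else setT).
  rewrite (bigD1 j)//= eqxx big1 => [|i /negPf ->]; last exact: facet_lawT.
  rewrite mulr1 => <-; last by move=> i; case: ifP.
  congr (Q _); apply/seteqP; split=> x h; last by have := h j I; rewrite eqxx.
  by move=> i _; case: eqP => [->|].
have Yu j : uniform_on leb (hull w) (Y j).
  by move=> B mB; rewrite Y1//; have [_ ->] := facet_lawE mB.
have Yi : independent_points Y.
  by move=> B mB; rewrite YE// -prodEFin; apply: eq_bigr => j _; rewrite Y1.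
have := hE d T Q Y Yu Yi.
have mY := @measurable_point S.
rewrite unlock (integral_nb_faces0 mY)// => e.
rewrite (integral_nb_faces0 mY)//.
have {e} : (\sum_(i < #|S|) Pr (vertex_event (fun (j : 'I_#|S|) x => cochart z0 W (X (enum_val j) x)) i `&` facet_event S) * (weight (bd_law F) S)^-1%:E = val%:E)%E.
  rewrite -e; apply: eq_bigr => i _; rewrite setIT -QE//; exact: measurable_vertex_event.
rewrite -ge0_sume_distrl// => e; rewrite EFinM -e muleCA -EFinM divff// mule1//.
Qed.
End Conditioning.

Lemma map_enum_val (I : finType) (S : {set I}) : map (@enum_val I (mem S)) (enum 'I_#|S|) = enum S.
Proof.
case: (pickP (mem S)) => [x0 x0S|S0]; last first.
  have S00 : #|S| = 0%N by apply: eq_card0.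
  have -> : enum S = [::] by apply: size0nil; rewrite -cardE.
  by apply: size0nil; rewrite size_map size_enum_ord.
have S0 : (0 < #|S|)%N by apply/card_gt0P; exists x0.
apply: (@eq_from_nth _ x0) => [|i]; rewrite size_map size_enum_ord -?cardE// => iS.
rewrite (nth_map (Ordinal iS)) ?size_enum_ord// (enum_val_nth x0); congr nth.
by rewrite nth_enum_ord.
Qed.

Section Decomposition.
Context {R : realType} {k m N : nat} {d : measure_display} {T : measurableType d}.
Variable v : 'I_m -> 'rV[R]_k.+2.
Local Notation P := (hull v).
Local Notation D := (boundary P).
Local Notation H := (@hausdorff R k.+2 k.+1).
Local Notation V := (borel_rV R k.+2).
Local Notation Fs := (fset_set (facets P)).
Hypothesis dP : has_dim P k.+2.
Hypothesis H_gt0 : (0 < H D)%E.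
Hypothesis H_fin : (H D < +oo)%E.
Variables (Pr : probability T R) (X : 'I_N -> {RV Pr >-> V}).
Hypothesis hX : forall i, uniform_on H D (X i).

Lemma in_facets F : (F \in Fs) = (F \in facets P).
Proof. by rewrite in_fset_set//; apply: finite_facets. Qed.

Lemma facet_event_unique F (S : {set 'I_N}) x :
  facet_event X F S x <-> S = [set i | X i x \in F]%SET.
Proof.
split=> [h|->].
  apply/setP => i; rewrite inE; have := h i I => /=.
  by case: ifP => iS; [move=> Fx; apply/esym/mem_set|move=> Fx; apply/esym/negbTE/negP => /set_mem].
move=> i _ /=; rewrite inE; case: ifPn => [/set_mem//|/negP Fx].
by move=> /mem_set.
Qed.

(** The events of the various [S] partition the sample space, so one term survives: that of the
    actual index set [S0]. *)
Lemma nb_extreme_facet F z0 (W : 'M[R]_(k.+1, k.+2)) (Q : set 'rV[R]_k.+1) x :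
  row_free W -> F = chart z0 W @` Q ->
  (nb_extreme [seq z <- codom (fun i => X i x : 'rV[R]_k.+2) | z \in F])%:R =
  \sum_(S : {set 'I_N}) facet_faces X z0 W S x * \1_(facet_event X F S) x.
Proof.
move=> Wf FE; set S0 := [set i | X i x \in F]%SET.
rewrite (bigD1 S0)//= big1 => [|S /eqP SS0]; last first.
  by rewrite indicE memNset ?mulr0// => /facet_event_unique.
rewrite addr0 indicE mem_set ?mulr1; last exact/facet_event_unique.
rewrite /facet_faces nb_faces0 -(nb_extreme_chart z0 _ Wf); congr ((nb_extreme _)%:R).
rewrite /codom /image_mem filter_map -map_comp.
rewrite (_ : seq.filter _ _ = enum S0); last by rewrite [in LHS]enumT; apply: eq_filter => i; rewrite !inE.
rewrite -map_enum_val -map_comp; apply: eq_map => j /=; rewrite cochartK//.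
have := enum_valP j; rewrite inE => /set_mem; rewrite FE => -[y _ <-].
by exists y.
Qed.

(** Two kinds of null events are discarded for each point: missing the boundary, and lying on two
    distinct facets. *)
Lemma ae_unique_facet : {ae Pr, forall x, forall i, exists2 F, F \in Fs /\ F (X i x) &
  forall G, G \in Fs -> G (X i x) -> G = F}.
Proof.
have mFs F : F \in Fs -> measurable (F : set V).
  by rewrite in_facets => /set_mem; exact: measurable_facet.
have DE : D = \bigcup_(F in [set` Fs]) F.
  rewrite (boundary_bigcup_facets dP); apply: eq_bigcupl.
  by split=> F /=; rewrite in_facets; [move/mem_set|move/set_mem].
have mD : measurable (D : set V).
  by rewrite DE; apply: fin_bigcup_measurable => [|F /= /mFs]; first exact: finite_fset.
have H0 : H set0 = 0%E by exact: outer_measure0.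
apply: filter_forall => i.
have h1 : {ae Pr, forall x, D (X i x)}.
  exists (X i @^-1` ~` D); split=> //.
    by rewrite -[X in measurable X]setTI; apply: measurable_funPT => //; exact: measurableC.
  rewrite (Pr_X hX)//; last exact: measurableC.
  by rewrite /bd_law setICl H0 mul0e.
have h2 : {ae Pr, forall x, forall F G, F \in Fs -> G \in Fs -> F (X i x) -> G (X i x) -> F = G}.
  suff : (\forall x \ae Pr, (\bigcap_(F in [set` Fs]) \bigcap_(G in [set` Fs])
      [set x | F (X i x) -> G (X i x) -> F = G]) x).
    by apply: filterS => x h F G FF GF; exact: (h F FF G GF).
  apply: filter_bigI => F FF; apply: filter_bigI => G GF.
  have [->|FG] := pselect (F = G).
    by apply: (@filterS _ _ _ setT) => //; exact: filterT.
  exists (X i @^-1` (F `&` G)).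
  have mFG : measurable (F `&` G : set V) by apply: measurableI; exact: mFs.
  split=> //.
  - by rewrite -[X in measurable X]setTI; exact: measurable_funPT.
  - rewrite (Pr_X hX)// /bd_law.
    rewrite (_ : H (F `&` G `&` D) = 0%E) ?mul0e//; apply/eqP; rewrite eq_le.
    apply/andP; split; last exact: outer_measure_ge0.
    rewrite -(@facet_inter_null _ _ _ _ dP H_gt0 H_fin F G); [|by apply/set_mem; rewrite -in_facets
      |by apply/set_mem; rewrite -in_facets|exact: FG].
    exact: le_outer_measure.
  - by move=> x /= /not_implyP[Fx /not_implyP[Gx _]].
apply: filterS2 h1 h2 => x; rewrite DE => -[F /= FF Fx] h.
by exists F => // G GF Gx; exact: h.
Qed.

Variables (Z : set 'rV[R]_k.+2 -> 'rV[R]_k.+2) (C : set 'rV[R]_k.+2 -> 'M[R]_(k.+1, k.+2)).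
Variable Q : set 'rV[R]_k.+2 -> set 'rV[R]_k.+1.
Hypothesis CP : forall F, facets P F -> row_free (C F) /\ F = chart (Z F) (C F) @` Q F.

Lemma expected_vertices_facets :
  ('E_Pr[fun x => (nb_faces 0 (hull (fun i => X i x : 'rV[R]_k.+2)))%:R] =
   \sum_(F <- Fs) \sum_(S : {set 'I_N})
     \int[Pr]_(x in facet_event X F S) (facet_faces X (Z F) (C F) S x)%:E)%E.
Proof.
(* The value [0] off [Fs] makes [f] measurable for every [F], as the exchange of sum and integral
   asks. *)
pose f F S x := if F \in Fs then facet_faces X (Z F) (C F) S x * \1_(facet_event X F S) x else 0.
have mf F S : measurable_fun setT (f F S).
  have [FF|/negPf FF] := boolP (F \in Fs); rewrite /f FF; last exact: measurable_cst.
  apply: measurable_funM.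
    by apply: measurable_nb_faces0 => j; exact: measurable_point.
  apply: measurable_indic; apply: (measurable_facet_event dP).
  by apply/set_mem; rewrite -in_facets.
have f0 F S x : 0 <= f F S x by rewrite /f; case: ifP => // _; rewrite mulr_ge0.
have mX i : measurable_fun setT (X i : T -> V) by exact: measurable_funPT.
rewrite unlock (@ge0_ae_eq_integral _ _ _ _ _ _ (fun x => \sum_(F <- Fs) \sum_(S : {set 'I_N}) (f F S x)%:E)%E)//.
- rewrite ge0_integral_sum//; last first.
  + by move=> F x _; apply: sume_ge0 => S _; rewrite lee_fin.
  + by move=> F; apply: emeasurable_sum => S; exact/measurable_EFinP.
  rewrite [LHS]big_seq [RHS]big_seq; apply: eq_bigr => F FF.
  rewrite ge0_integral_sum//; last first.
  + by move=> S x _; rewrite lee_fin.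
  + by move=> S; exact/measurable_EFinP.
  apply: eq_bigr => S _; rewrite [RHS]integral_mkcond; apply: eq_integral => x _.
  rewrite /f FF patchE indicE; case: (x \in _); first by rewrite mulr1.
  by rewrite mulr0.
- by apply/measurable_EFinP; exact: measurable_nb_faces0.
- by apply: emeasurable_sum => F; apply: emeasurable_sum => S; exact/measurable_EFinP.
- by move=> x _; apply: sume_ge0 => F _; apply: sume_ge0 => S _; rewrite lee_fin.
apply: filterS ae_unique_facet => x hx _ /=.
rewrite nb_faces0 (@nb_extreme_facets _ _ _ v Fs).
- rewrite natr_sum -sumEFin [LHS]big_seq [RHS]big_seq; apply: eq_bigr => F FF.
  have /CP[Wf FE] : facets P F by apply/set_mem; rewrite -in_facets.
  by rewrite (nb_extreme_facet _ Wf FE) -sumEFin; apply: eq_bigr => S _; rewrite /f FF.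
- by move=> F; rewrite in_facets => /set_mem /(facetP _ dP).
- by move=> z /codomP[i ->]; exact: hx.
Qed.
End Decomposition.

(** * Asymptotics of binomial mixtures *)

Section Mixture.
Context {R : realType}.
Implicit Types (p a b t : R) (N M r : nat).

Lemma sum_prod_set a b N :
  \sum_(S : {set 'I_N}) \prod_(i < N) (if i \in S then a else b) = (a + b) ^+ N.
Proof. by rewrite -(bigA_distr _ _ (fun=> a) (fun=> b)) prodr_const card_ord. Qed.

Lemma sum_weight p N : \sum_(S : {set 'I_N}) weight p S = 1.
Proof. by rewrite sum_prod_set addrC subrK expr1n. Qed.

Lemma weight_ge0 p N (S : {set 'I_N}) : 0 <= p <= 1 -> 0 <= weight p S.
Proof.
by move=> /andP[p0 p1]; apply: prodr_ge0 => i _; case: ifP => //; rewrite subr_ge0.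
Qed.

Lemma expr_sub_ge t r : 0 <= t <= 1 -> 1 - r%:R * t <= (1 - t) ^+ r.
Proof.
move=> /andP[t0 t1]; elim: r => [|r IH]; first by rewrite mul0r subr0.
rewrite exprS; apply: (@le_trans _ _ ((1 - t) * (1 - r%:R * t))).
  rewrite -natr1; have h : 0 <= r%:R * t * t; [by rewrite !mulr_ge0|lra].
by apply: ler_wpM2l => //; rewrite subr_ge0.
Qed.

(** An elementary substitute for the exponential bound on [(1 - t) ^+ M]. *)
Lemma expr_sub_le t M : 0 <= t <= 1 -> (1 - t) ^+ M * (1 + M%:R * t) <= 1.
Proof.
move=> /andP[t0 t1]; elim: M => [|M IH]; first by rewrite mul0r addr0 mulr1.
apply: le_trans IH; rewrite exprSr -mulrA; apply: ler_wpM2l.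
  by rewrite exprn_ge0// subr_ge0.
have : 0 <= M%:R * t * t by rewrite !mulr_ge0.
have : 0 <= t * t by rewrite mulr_ge0.
rewrite -natr1; lra.
Qed.

(* Chernoff's argument: replacing [p] by [p / 2] costs [2 ^ #|S|] pointwise and
   makes the total mass [(1 - p / 2) ^ N]. *)
Lemma weight_tail p : 0 < p <= 1 -> exists M, (0 < M)%N /\ forall N,
  \sum_(S : {set 'I_N} | (#|S| * M < N)%N) weight p S <= 4^-1 ^+ (N %/ M).
Proof.
move=> /andP[p0 p1]; pose t := p / 2.
have t0 : 0 < t by rewrite divr_gt0.
have t1 : t <= 1 by rewrite /t; lra.
(* With [M * t] at least 7, [(1 - t) ^+ M] is at most 1/8, and the factor [2 ^+ q] lost by changing
   [p] still leaves [4^-1 ^+ q]. *)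
pose M := (Num.truncn (7 / t)).+1; exists M; split=> // N.
have rM : (1 - t) ^+ M <= 8^-1.
  have h8 : 8 <= 1 + M%:R * t.
    have : 7 / t <= M%:R by rewrite ltW// /M truncnS_gt.
    rewrite ler_pdivrMr//; lra.
  have := @expr_sub_le t M; rewrite ltW// t1 => /(_ isT) h.
  rewrite -[8^-1]mul1r ler_pdivlMr//; apply: le_trans h; apply: ler_wpM2l => //.
  by rewrite exprn_ge0// subr_ge0.
set q := (N %/ M)%N.
have hq : (1 - t) ^+ N <= 8^-1 ^+ q.
  apply: (@le_trans _ _ ((1 - t) ^+ (M * q))).
    apply: ler_wiXn2l; rewrite ?subr_ge0// ?lerBlDr ?lerDl ?ltW//.
    by rewrite mulnC leq_divM.
  by rewrite exprM lerXn2r// ?nnegrE ?invr_ge0// exprn_ge0// subr_ge0.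
apply: (@le_trans _ _ (\sum_(S : {set 'I_N}) 2 ^+ q * \prod_(i < N) (if i \in S then t else 1 - p))).
  rewrite [leRHS](bigID (fun S : {set 'I_N} => #|S| * M < N)%N)/=.
  rewrite -[leLHS]addr0 lerD//; last first.
    apply: sumr_ge0 => S _; rewrite mulr_ge0// ?exprn_ge0//; apply: prodr_ge0 => i _.
    by case: ifP => _; rewrite ?subr_ge0// ltW.
  apply: ler_sum => S SM.
  have -> : weight p S = 2 ^+ #|S| * \prod_(i < N) (if i \in S then t else 1 - p).
    rewrite -prodr_const [X in X * _]big_mkcond -big_split; apply: eq_bigr => i _ /=.
    by case: ifP => _; rewrite ?mul1r// /t mulrC divfK// pnatr_eq0.
  apply: ler_wpM2r.
    by apply: prodr_ge0 => i _; case: ifP => _; rewrite ?subr_ge0// ltW.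
  by rewrite ler_eXn2l// ?ltr1n// leq_divRL// ltnW.
rewrite -mulr_sumr sum_prod_set.
have -> : t + (1 - p) = 1 - t by rewrite /t; field.
apply: (@le_trans _ _ (2 ^+ q * 8^-1 ^+ q)); first by rewrite ler_wpM2l// exprn_ge0.
by rewrite -exprMn; rewrite (_ : 2 * 8^-1 = 4^-1 :> R)//; field.
Qed.

Lemma ln_natr_eventually (A : R) : exists N0, forall N, (N0 <= N)%N -> A <= ln (N%:R : R).
Proof.
exists (Num.truncn (expR A)).+1 => N hN.
have hE : expR A <= N%:R.
  by apply: (@le_trans _ _ (Num.truncn (expR A)).+1%:R); rewrite ?ler_nat// ltW// truncnS_gt.
rewrite -[A]expRK ler_ln ?posrE ?expR_gt0//.
exact: lt_le_trans (expR_gt0 A) hE.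
Qed.

(** [a S] stands for the contribution of the index set [S]. The threshold [N0] is chosen before [a],
    hence before any probability space, as the quantifiers of [expected_faces_asymp] demand. *)
Lemma mixture_asymp p (K : R) r (eps : nat -> R) k0 (delta : R) :
  0 < p <= 1 -> eps @ \oo --> (0 : R) -> 0 < delta ->
  exists N0, forall N, (N0 <= N)%N -> forall a : {set 'I_N} -> R,
  (forall S : {set 'I_N}, 0 <= a S <= weight p S * #|S|%:R) ->
  (forall S : {set 'I_N}, (k0 <= #|S|)%N -> weight p S != 0 ->
    a S = weight p S * (K * ln #|S|%:R ^+ r * (1 + eps #|S|))) ->
  `|\sum_S a S - K * ln N%:R ^+ r| <= delta * ln N%:R ^+ r.
Proof.
move=> p01 /cvgr0Pnorm_le heps delta0.
have [M [M0 tail]] := weight_tail p01.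
(* In units of [ln N%:R ^+ r], large sets cost [|K| * eta] twice, for [eps] and for the change of
   logarithm; the tail costs [eta] and [|K| * eta]. The total is [(3 * |K| + 1) * eta]. *)
pose eta := delta / (3 * `|K| + 1).
have K0 : 0 < 3 * `|K| + 1 by have := normr_ge0 K; lra.
have eta0 : 0 < eta by rewrite divr_gt0.
have [k1 _ hk1] := heps _ eta0.
(* The last bound makes [r * ln M / ln N] at most [eta], so that Bernoulli's inequality controls
   [(1 - ln M / ln N) ^+ r]. *)
have [N1 hN1] := ln_natr_eventually (Num.max 1 (Num.max (ln M%:R) (r%:R * ln M%:R / eta))).
(* For [q = N %/ M] at least [Q], [(q + 1) ^ 2 <= 4 ^ q] gives [N * 4 ^ (- q) <= M * (q + 1) * 4 ^
   (- q) <= M / (q + 1) <= eta]. *)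
pose Q := (Num.truncn (M%:R / eta)).+1.
exists (maxn N1 (M * maxn 1 (maxn Q (maxn k0 k1))))%N => N hN a a0 aE.
have hL : Num.max 1 (Num.max (ln M%:R) (r%:R * ln M%:R / eta)) <= ln N%:R :> R.
  by apply: hN1; apply: leq_trans hN; exact: leq_maxl.
have hMN j : (j <= maxn 1 (maxn Q (maxn k0 k1)))%N -> (j * M <= N)%N.
  move=> hj; apply: leq_trans hN; apply: leq_trans (leq_maxr _ _).
  by rewrite mulnC leq_mul2l hj orbT.
have N0 : (0 < N)%N by apply: leq_trans (hMN 1%N (leq_maxl _ _)); rewrite mul1n.
set L := ln N%:R in hL *; rewrite !ge_max in hL; case/and3P: hL => L1 LM LMr.
have L0 : 0 < L by lra.
have lM0 : 0 <= ln M%:R :> R by apply: ln_ge0; rewrite ler1n.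
have Lr1 : 1 <= L ^+ r by rewrite exprn_ege1.
have Lr0 : 0 < L ^+ r by lra.
have w0 (S : {set 'I_N}) : 0 <= weight p S.
  by apply: weight_ge0; case/andP: p01 => p0 ->; rewrite ltW.
pose bad (S : {set 'I_N}) := (#|S| * M < N)%N.
have bound S : `|a S - weight p S * (K * L ^+ r)| <=
    weight p S * (2 * `|K| * eta * L ^+ r) +
    (if bad S then weight p S else 0) * (N%:R + `|K| * L ^+ r).
  have := a0 S => /andP[aS0 aS1].
  have [wS|wS] := eqVneq (weight p S) 0.
    move: aS0 aS1; rewrite wS !mul0r => h1 h2; have -> : a S = 0 by lra.
    by rewrite subr0 normr0 if_same mul0r add0r.
  have KL : 0 <= `|K| * L ^+ r by rewrite mulr_ge0// ltW.
  case: ifPn => hS.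
    apply: (@le_trans _ _ (weight p S * (N%:R + `|K| * L ^+ r))); last first.
      by rewrite lerDr mulr_ge0// mulr_ge0// ?mulr_ge0// ltW.
    apply: le_trans (ler_normB _ _) _; rewrite mulrDr lerD//.
      rewrite ger0_norm//; apply: le_trans aS1 _; rewrite ler_wpM2l// ler_nat.
      by rewrite -[leqRHS](card_ord N) max_card.
    by rewrite normrM (ger0_norm (w0 S)) normrM (ger0_norm (ltW Lr0)).
  move: hS; rewrite /bad -leqNgt => hS.
  have hcard j : (j <= maxn 1 (maxn Q (maxn k0 k1)))%N -> (j <= #|S|)%N.
    by move=> /hMN hj; rewrite -(leq_pmul2r M0) (leq_trans hj).
  have S1 : (1 <= #|S|)%N by apply: hcard; exact: leq_maxl.
  have Sk0 : (k0 <= #|S|)%N by apply: hcard; rewrite !leq_max leqnn !orbT.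
  have Sk1 : (k1 <= #|S|)%N by apply: hcard; rewrite !leq_max leqnn !orbT.
  have hep : `|eps #|S| | <= eta by exact: hk1.
  rewrite mul0r addr0 aE// -mulrBr normrM (ger0_norm (w0 S)) ler_wpM2l//.
  set l := ln _; have Sp : 0 < #|S|%:R :> R by rewrite ltr0n.
  have lL : l <= L.
    by rewrite /l /L ler_ln ?posrE ?ltr0n// ler_nat -[leqRHS](card_ord N) max_card.
  have l0 : 0 <= l by apply: ln_ge0; rewrite ler1n.
  have Ll : L - ln M%:R <= l.
    rewrite lerBlDr -lnM ?posrE ?ltr0n// -natrM ler_ln ?posrE ?ltr0n// ?muln_gt0 ?S1//.
    by rewrite ler_nat.
  have lr : l ^+ r <= L ^+ r by rewrite lerXn2r ?nnegrE// ltW.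
  have lr' : L ^+ r - l ^+ r <= eta * L ^+ r.
    pose t := ln M%:R / L.
    have t01 : 0 <= t <= 1 by rewrite divr_ge0 ?(ltW L0)// ler_pdivrMr// mul1r.
    have h1 : L ^+ r * (1 - t) ^+ r <= l ^+ r.
      rewrite -exprMn mulrBr mulr1 /t mulrC divfK ?gt_eqF//.
      by rewrite lerXn2r ?nnegrE// subr_ge0.
    have h2 := @expr_sub_ge t r t01.
    have h3 : r%:R * t <= eta.
      by rewrite /t mulrA ler_pdivrMr// [leRHS]mulrC -ler_pdivrMr.
    have h4 : L ^+ r * (1 - eta) <= L ^+ r * (1 - t) ^+ r by rewrite ler_pM2l//; lra.
    lra.
  rewrite (_ : K * l ^+ r * (1 + eps #|S|) - K * L ^+ r =
     K * (l ^+ r - L ^+ r) + K * (l ^+ r * eps #|S|)); last by ring.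
  apply: le_trans (ler_normD _ _) _; rewrite !normrM.
  have h1 : `|l ^+ r - L ^+ r| <= eta * L ^+ r by rewrite distrC ger0_norm// subr_ge0.
  have h2 : `|l ^+ r| * `|eps #|S| | <= L ^+ r * eta.
    by rewrite ger0_norm ?exprn_ge0// ler_pM// exprn_ge0.
  apply: (@le_trans _ _ (`|K| * (eta * L ^+ r) + `|K| * (L ^+ r * eta))).
    by rewrite lerD// ler_wpM2l.
  by rewrite le_eqVlt; apply/orP; left; apply/eqP; ring.
rewrite -[K * L ^+ r]mul1r -(sum_weight p N) mulr_suml -sumrB.
apply: le_trans (ler_norm_sum _ _ _) _; apply: le_trans (ler_sum _ (fun S _ => bound S)) _.
rewrite big_split/= -!mulr_suml sum_weight mul1r -big_mkcond/=.
set tl := \sum_(S | _) _; set q := (N %/ M)%N.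
have tl0 : 0 <= tl by apply: sumr_ge0.
have Ntl : N%:R * tl <= eta.
  have NM : N%:R <= M%:R * q.+1%:R :> R.
    by rewrite -natrM ler_nat mulnC ltnW// ltn_ceil.
  have qQ : M%:R / eta <= q.+1%:R.
    apply: (@le_trans _ _ Q%:R); first by rewrite ltW// /Q truncnS_gt.
    rewrite ler_nat leqW// leq_divRL//; apply: hMN.
    by rewrite !leq_max leqnn !orbT.
  have h4 : q.+1%:R ^+ 2 * 4^-1 ^+ q <= 1 :> R.
    rewrite exprVn ler_pdivrMr ?exprn_gt0// mul1r.
    rewrite (_ : 4 = 2 ^+ 2 :> R) -?exprM; last by rewrite -natrX.
    rewrite mulnC exprM lerXn2r ?nnegrE ?exprn_ge0// -natrX ler_nat ltn_expl//.
  apply: (@le_trans _ _ (M%:R * q.+1%:R * 4^-1 ^+ q)); first by apply: ler_pM => //; exact: tail.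
  rewrite ler_pdivrMr// in qQ.
  have q0 : 0 < q.+1%:R :> R by rewrite ltr0n.
  rewrite -(ler_pM2r q0).
  apply: (@le_trans _ _ (M%:R * (q.+1%:R ^+ 2 * 4^-1 ^+ q))); last first.
    by rewrite [leRHS]mulrC; apply: le_trans qQ; rewrite ler_piMr.
  rewrite (_ : M%:R * q.+1%:R * 4^-1 ^+ q * q.+1%:R = M%:R * (q.+1%:R ^+ 2 * 4^-1 ^+ q))//.
  by rewrite expr2 -!mulrA [4^-1 ^+ q * _]mulrC.
have tlN : tl <= eta.
  by apply: le_trans Ntl; rewrite ler_peMl// ler1n.
have -> : delta = (3 * `|K| + 1) * eta by rewrite /eta mulrC divfK// gt_eqF.
have h5 : tl * N%:R <= eta * L ^+ r.
  by rewrite mulrC; apply: le_trans Ntl _; rewrite ler_peMr// ltW.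
have h6 : tl * (`|K| * L ^+ r) <= eta * (`|K| * L ^+ r).
  by rewrite ler_wpM2r// mulr_ge0// ltW.
rewrite mulrDr; lra.
Qed.
End Mixture.

(** * Conclusion *)

Section Boundary.
Context {R : realType} {k m : nat}.
Variable v : 'I_m -> 'rV[R]_k.+2.
Local Notation P := (hull v).
Local Notation D := (boundary P).
Local Notation H := (@hausdorff R k.+2 k.+1).
Local Notation Fs := (fset_set (facets P)).
Hypothesis dP : has_dim P k.+2.
Hypothesis H_gt0 : (0 < H D)%E.
Hypothesis H_fin : (H D < +oo)%E.

Lemma bd_law_le1 B : bd_law v B <= 1.
Proof.
have BD : (H (B `&` D) <= H D)%E by apply: le_outer_measure; exact: subIsetr.
rewrite /bd_law; have h0 : (0 <= H (B `&` D))%E by exact: outer_measure_ge0.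
move: H_gt0 H_fin BD h0; case: (H D) => // h; rewrite lte_fin => h0 _.
case: (H (B `&` D)) => // b; rewrite !lee_fin => bh b0.
by rewrite inver gt_eqF// -EFinM /= ler_pdivrMr// mul1r.
Qed.

Lemma facet_asymp F z0 (W : 'M[R]_(k.+1, k.+2)) (w : 'I_m -> 'rV[R]_k.+1) (K : R) r (delta : R) :
  facets P F -> row_free W -> F = chart z0 W @` hull w ->
  hull w 0 -> (forall i, hull w (delta_mx 0 i)) ->
  expected_faces_asymp lebesgue_rV (hull w) 0 K r -> 0 < delta ->
  exists N0, forall N, (N0 <= N)%N -> forall d (T : measurableType d) (Pr : probability T R)
    (X : 'I_N -> {RV Pr >-> borel_rV R k.+2}),
    (forall i, uniform_on H D (X i)) -> independent_points X ->
  exists a : R,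
    (\sum_(S : {set 'I_N}) \int[Pr]_(x in facet_event X F S) (facet_faces X z0 W S x)%:E = a%:E)%E /\
    `|a - K * ln N%:R ^+ r| <= delta * ln N%:R ^+ r.
Proof.
move=> PF Wf FE w0 we [eps [eps0 [k0 _ hk0]]] delta0.
have p01 : 0 < bd_law v F <= 1.
  by rewrite bd_law_le1 andbT; have [] := facet_lawE dP H_gt0 H_fin PF Wf FE w0 we measurableT.
have [N0 hN0] := @mixture_asymp R _ K r eps k0 delta p01 eps0 delta0.
exists N0 => N hN d T Pr X hX hI.
pose I S : \bar R := (\int[Pr]_(x in facet_event X F S) (facet_faces X z0 W S x)%:E)%E.
have hle S : (0 <= I S <= (weight (bd_law v F) S * #|S|%:R)%:E)%E.
  exact: (integral_facet_faces_le dP H_gt0 H_fin hX hI PF Wf FE w0 we).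
have IE S : I S = (fine (I S))%:E.
  have /andP[h0 h1] := hle S; rewrite fineK// ge0_fin_numE//.
  by apply: (le_lt_trans h1); rewrite ltry.
exists (\sum_(S : {set 'I_N}) fine (I S)); split.
  by rewrite -sumEFin; apply: eq_bigr => S _; rewrite -IE.
apply: hN0 => // S; first by rewrite -!lee_fin -IE.
move=> kS wS; apply: EFin_inj; rewrite -IE.
apply: (integral_facet_faces dP H_gt0 H_fin hX hI PF Wf FE w0 we wS) => d' T' Q Y hY hYI.
exact: hk0.
Qed.

Variables (Z : set 'rV[R]_k.+2 -> 'rV[R]_k.+2) (C : set 'rV[R]_k.+2 -> 'M[R]_(k.+1, k.+2)).
Variable w : set 'rV[R]_k.+2 -> 'I_m -> 'rV[R]_k.+1.
Hypothesis CP : forall F, facets P F -> [/\ row_free (C F), F = chart (Z F) (C F) @` hull (w F),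
  hull (w F) 0 & forall i, hull (w F) (delta_mx 0 i)].

(** Constants and exponent are arbitrary because, besides the actual asymptotics, the case with all
    constants and the exponent equal to [0] is used. *)
Lemma boundary_asymp (K : set 'rV[R]_k.+2 -> R) r (delta : R) :
  (forall F, facets P F -> expected_faces_asymp lebesgue_rV (hull (w F)) 0 (K F) r) -> 0 < delta ->
  exists N0, forall N, (N0 <= N)%N -> forall d (T : measurableType d) (Pr : probability T R)
    (X : 'I_N -> {RV Pr >-> borel_rV R k.+2}),
    (forall i, uniform_on H D (X i)) -> independent_points X ->
  exists a : R,
    'E_Pr[fun x => (nb_faces 0 (hull (fun i => X i x : 'rV[R]_k.+2)))%:R]%E = a%:E /\
    `|a - (\sum_(F <- Fs) K F) * ln N%:R ^+ r| <= delta * ln N%:R ^+ r.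
Proof.
move=> hK delta0; pose s := (#|` Fs|%fset).+1; pose de := delta / s%:R.
have de0 : 0 < de by rewrite divr_gt0// ltr0n.
have : forall F, exists N0, facets P F -> forall N, (N0 <= N)%N ->
    forall d (T : measurableType d) (Pr : probability T R)
    (X : 'I_N -> {RV Pr >-> borel_rV R k.+2}),
    (forall i, uniform_on H D (X i)) -> independent_points X ->
  exists a : R,
    (\sum_(S : {set 'I_N}) \int[Pr]_(x in facet_event X F S) (facet_faces X (Z F) (C F) S x)%:E = a%:E)%E /\
    `|a - K F * ln N%:R ^+ r| <= de * ln N%:R ^+ r.
  move=> F; have [PF|nPF] := pselect (facets P F); last by exists 0%N.
  have [Wf FE w0 we] := CP PF.
  have [N0 hN0] := facet_asymp PF Wf FE w0 we (hK F PF) de0.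
  by exists N0.
move=> /choice[N0 hN0]; exists (maxn 3 (\max_(F <- Fs) N0 F)) => N hN d T Pr X hX hI.
have N3 : (3 <= N)%N by apply: leq_trans hN; exact: leq_maxl.
have : forall F, exists a : R, F \in Fs ->
    (\sum_(S : {set 'I_N}) \int[Pr]_(x in facet_event X F S) (facet_faces X (Z F) (C F) S x)%:E = a%:E)%E /\
    `|a - K F * ln N%:R ^+ r| <= de * ln N%:R ^+ r.
  move=> F; have [FF|FF] := boolP (F \in Fs); last by exists 0.
  have PF : facets P F by apply/set_mem; rewrite -in_facets.
  have hF : (N0 F <= N)%N.
    by apply: leq_trans hN; apply: leq_trans (leq_maxr _ _); apply: leq_bigmax_seq.
  by have [a ha] := hN0 F PF N hF d T Pr X hX hI; exists a.
move=> /choice[a ha]; exists (\sum_(F <- Fs) a F); split.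
  rewrite (@expected_vertices_facets _ _ _ _ _ _ v dP H_gt0 H_fin Pr X hX Z C (fun F => hull (w F)));
    last by move=> F /CP[].
  rewrite -sumEFin big_seq [RHS]big_seq; apply: eq_bigr => F FF.
  by have [] := ha F FF.
rewrite mulr_suml -sumrB; apply: le_trans (ler_norm_sum _ _ _) _.
have L0 : 0 <= ln N%:R ^+ r :> R by rewrite exprn_ge0// ln_ge0// ler1n ltnW// ltnW.
apply: (@le_trans _ _ (\sum_(F <- Fs) de * ln N%:R ^+ r)).
  by rewrite big_seq [leRHS]big_seq; apply: ler_sum => F FF; have [] := ha F FF.
rewrite -mulr_suml; apply: ler_wpM2r => //.
rewrite big_const_seq count_predT iter_addr_0 -mulr_natr.
by rewrite /de mulrAC ler_pdivrMr ?ltr0n// ler_wpM2l ?(ltW delta0)// ler_nat.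
Qed.

End Boundary.

Lemma expected_vertices_ge1 (R : realType) n N d (T : measurableType d) (Pr : probability T R)
    (X : 'I_N.+1 -> {RV Pr >-> borel_rV R n}) :
  (1 <= 'E_Pr[fun x => (nb_faces 0 (hull (fun i => X i x : 'rV[R]_n)))%:R])%E.
Proof.
have mX i : measurable_fun setT (X i : T -> borel_rV R n) by exact: measurable_funPT.
rewrite -(expectation_cst Pr 1) unlock; apply: ge0_le_integral => //.
- exact/measurable_EFinP/measurable_cst.
- by apply/measurable_EFinP; exact: measurable_nb_faces0.
- by move=> x _; rewrite lee_fin ler1n nb_faces0 nb_extreme_gt0.
Qed.

Lemma expected_faces_asymp0 (R : realType) n (mu : set 'rV[R]_n -> \bar R) D l r r' :
  expected_faces_asymp mu D l 0 r -> expected_faces_asymp mu D l 0 r'.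
Proof.
move=> [eps [e0 h]]; exists eps; split=> //; apply: filterS h => N h d T Pr X hX hI.
rewrite !mul0r (_ : 0 = 0 * ln N%:R ^+ r * (1 + eps N)); last by rewrite !mul0r.
exact: h.
Qed.

Lemma boundary_vertices_asymp (R : realType) (c : nat -> nat -> R) (hc : face_constants c)
    k m (v : 'I_m -> 'rV[R]_k.+2) (dP : has_dim (hull v) k.+2) :
  expected_faces_asymp (hausdorff k.+1) (boundary (hull v)) 0
    (c k.+1 0%N * (flag (hull v))%:R) k.
Proof.
set H := hausdorff k.+1; set D := boundary (hull v).
(* The expectation depends only on [N], so that [eps N] can be read off any
   probability space carrying the points. *)
pose law N a := exists d (T : measurableType d) (Pr : probability T R)
    (X : 'I_N -> {RV Pr >-> borel_rV R k.+2}),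
    [/\ forall i, uniform_on H D (X i), independent_points X &
    'E_Pr[fun x => (nb_faces 0 (hull (fun i => X i x : 'rV[R]_k.+2)))%:R]%E = a%:E].
have vacuous : (\forall N \near \oo, forall d (T : measurableType d) (Pr : probability T R)
    (X : 'I_N -> {RV Pr >-> borel_rV R k.+2}),
    (forall i, uniform_on H D (X i)) -> independent_points X -> False) ->
  expected_faces_asymp H D 0 (c k.+1 0%N * (flag (hull v))%:R) k.
  move=> h; exists (fun=> 0); split; first exact: cvg_cst.
  by apply: filterS h => N hN d T Pr X hX hI; have := hN d T Pr X hX hI.
have [[H0 Hoo]|nH] := pselect ((0 < H D)%E /\ (H D < +oo)%E); last first.
  (* [uniform_on] divides by [H D], with junk values if it is [0] or [+oo]. *)
  apply: vacuous; exists 1%N => // -[//|N] _ d T Pr X hX _; apply: nH.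
  by apply: (uniform_on_gt0_fin _ (hX ord0)); exact: outer_measure_ge0.
have : forall F, exists z : 'rV[R]_k.+2 * 'M[R]_(k.+1, k.+2) * ('I_m -> 'rV[R]_k.+1),
    facets (hull v) F -> [/\ row_free z.1.2, F = chart z.1.1 z.1.2 @` hull z.2,
      has_dim (hull z.2) k.+1, hull z.2 0 & forall i, hull z.2 (delta_mx 0 i)].
  move=> F; have [/[dup] PF /facet_chart[z0 [W [w [h1 h2 h3 _ [h4 h5]]]]]|nPF] :=
    pselect (facets (hull v) F); first by exists (z0, W, w).
  by exists (0, 0, fun=> 0).
move=> /choice[z hz].
pose Z F := (z F).1.1; pose C F := (z F).1.2; pose w F := (z F).2.
have CP F : facets (hull v) F -> [/\ row_free (C F), F = chart (Z F) (C F) @` hull (w F),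
  hull (w F) 0 & forall i, hull (w F) (delta_mx 0 i)] by move=> /hz[].
pose Kf F : R := c k.+1 0%N * (flag (hull (w F)))%:R.
have hK F : facets (hull v) F -> expected_faces_asymp lebesgue_rV (hull (w F)) 0 (Kf F) k.
  move=> /hz[_ _ dw _ _]; have := @hc k.+1 0%N isT isT (hull (w F)) _ dw.
  by rewrite subSS subn0; apply; exists m, (w F).
set Fs := fset_set (facets (hull v)).
have flagE : (flag (hull v) = \sum_(F <- Fs) flag (hull (w F)))%N.
  rewrite flag_sum_facets big_seq [RHS]big_seq; apply: eq_bigr => F.
  rewrite in_facets => /set_mem PF; have [Wf FE _ _] := CP F PF.
  exact: flags_through_facet PF Wf FE.
set K := c k.+1 0%N * _.
have KE : K = \sum_(F <- Fs) Kf F by rewrite /K flagE natr_sum mulr_sumr.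
have asym := boundary_asymp dP H0 Hoo CP.
have [K0|K0] := eqVneq K 0.
  (* Here all facet constants vanish; the facet asymptotics, used with exponent
     [0], would make the expected number of vertices tend to [0], although it is
     at least [1]. Hence no such probability space exists for large [N]. *)
  apply: vacuous.
  have Kf0 F : facets (hull v) F -> Kf F = 0.
    move=> PF; move/eqP: K0; rewrite /K /Kf mulf_eq0 => /orP[/eqP ->|]; first by rewrite mul0r.
    rewrite pnatr_eq0 flagE sum_nat_seq_eq0 => /allP/(_ F) h.
    have FF : F \in Fs by rewrite in_facets; exact: mem_set.
    by have /eqP -> := h FF; rewrite mulr0.
  have hK0 F : facets (hull v) F -> expected_faces_asymp lebesgue_rV (hull (w F)) 0 0 0.
    by move=> PF; move: (hK F PF); rewrite (Kf0 F PF); exact: expected_faces_asymp0.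
  have [N0 hN0] := asym (fun=> 0) 0%N 2^-1 hK0 ltac:(by rewrite invr_gt0).
  exists (maxn 1 N0) => // -[|N] /=; first by rewrite geq_max.
  rewrite geq_max => /andP[_ hN] d T Pr X hX hI.
  have [a [aE ha]] := hN0 _ hN d T Pr X hX hI.
  have := expected_vertices_ge1 X; rewrite aE lee_fin => a1.
  move: ha; rewrite big1// mul0r subr0 expr0 mulr1 ger0_norm; lra.
have law_uniq N a b : law N a -> law N b -> a = b.
  move=> [d [T [Pr [X [hX hI hE]]]]] [d' [T' [Pr' [X' [hX' hI' hE']]]]].
  apply: EFin_inj; rewrite -hE -hE'; apply: expected_faces_law => B mB.
  by rewrite (Pr_rect hX hI mB) (Pr_rect hX' hI' mB).
(* Where no probability space carries such points, the default [0] does not disturb convergence. *)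
pose eps N : R := if pselect (exists a, law N a) is left h
  then sval (cid h) / (K * ln N%:R ^+ k) - 1 else 0.
have epsE N a : law N a -> eps N = a / (K * ln N%:R ^+ k) - 1.
  move=> ha; rewrite /eps; case: pselect => [h|[]]; last by exists a.
  by case: cid => b /= hb; rewrite (law_uniq _ _ _ hb ha).
have [N1 hN1] := @ln_natr_eventually R 1.
have KL N : (N1 <= N)%N -> 0 < ln N%:R ^+ k :> R.
  by move=> /hN1 L1; rewrite exprn_gt0//; apply: lt_le_trans L1.
exists eps; split.
  apply/cvgr0Pnorm_le => e e0.
  (* Division by [K * ln N%:R ^+ k] turns the absolute tolerance [e * |K|] into the relative
     tolerance [e]. *)
  have [N0 hN0] := asym Kf k (e * `|K|) hK ltac:(by rewrite mulr_gt0// normr_gt0).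
  exists (maxn N1 N0) => // N /=; rewrite geq_max => /andP[NN1 NN0].
  have L0 := KL N NN1.
  have [[a ha]|nh] := pselect (exists a, law N a); last first.
    by rewrite /eps; case: pselect => [//|_]; rewrite normr0 ltW.
  rewrite (epsE _ _ ha); case: (ha) => d [T [Pr [X [hX hI hE]]]].
  have [b [bE hb]] := hN0 N NN0 d T Pr X hX hI.
  move: hb; rewrite -KE; have -> : b = a by apply: EFin_inj; rewrite -bE.
  move=> hb; have KL0 : K * ln N%:R ^+ k != 0 by rewrite mulf_neq0// gt_eqF.
  rewrite -[X in _ - X](divff KL0) -mulrBl normrM normfV ler_pdivrMr ?normr_gt0//.
  by rewrite [in leRHS]normrM (gtr0_norm L0) mulrA.
have [N0 hN0] := asym Kf k 1 hK ltr01.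
exists (maxn N1 N0) => // N /=; rewrite geq_max => /andP[NN1 NN0] d T Pr X hX hI.
have [a [aE _]] := hN0 N NN0 d T Pr X hX hI.
have ha : law N a by exists d, T, Pr, X.
have L0 := KL N NN1.
rewrite aE (epsE _ _ ha) addrCA subrr addr0 mulrC divfK// mulf_neq0// gt_eqF//.
Qed.

Theorem mainTheorem3 (R : realType) (c : nat -> nat -> R)
    (hc : face_constants c) (n : nat) (hn : (2 <= n)%N)
    (P : set 'rV[R]_n) (hP : polytope P) (hdim : has_dim P n) :
  expected_faces_asymp (hausdorff (n - 1)) (boundary P) 0
    (c (n - 1)%N 0%N * (flag P)%:R) (n - 2).
Proof.
(* With [n = k.+2] the facets have dimension [k.+1], which is positive, as the outer measure
   instances require. *)
case: n hn P hP hdim => [//|[//|k]] _ P [m [v ->]] dP.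
rewrite !subSS !subn0; exact: boundary_vertices_asymp.
Qed.
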